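(* Let $\mathbb B$ be a standard Brownian motion, $\alpha\ge0$, and $$\mathbb V_\alpha=\Big(\int_0^1\lambda^\alpha(\mathbb B(\lambda)-\lambda\mathbb B(1))^2\,\mathrm d\lambda\Big)^{1/2}.$$ (i) The characteristic function of $\mathbb V_\alpha^2$ is given by $$\varphi_{\mathbb V_\alpha^2}(t)=\Big(\frac{(1+i)\sqrt t}{\alpha+2}\Big)^{\frac1{2(\alpha+2)}}\Big(\Gamma\Big(\frac{\alpha+3}{\alpha+2}\Big)J_{1/(\alpha+2)}\Big(\frac{2(1+i)\sqrt t}{\alpha+2}\Big)\Big)^{-1/2},$$ where $J_\gamma$ is the Bessel function of the first kind of order $\gamma$. Moreover, $\mathbb V_\alpha$ has a Lebesgue density and is positive with probability $1$. (ii) The random variables $\mathbb V_\alpha^{-1}$ and $\mathbb G_\alpha=\mathbb B(1)/\mathbb V_\alpha$ have subexponential distributions. (iii) Let $\mathbb V_\alpha^{(1)},\ldots,\mathbb V_\alpha^{(p)}$ have the same distribution as $\mathbb V_\alpha$. Then, as $p\to\infty$, $\max_{\ell=1,\ldots,p}\mathbb V_\alpha^{(\ell)}=O_{\mathbb P}(\sqrt{\log(p)})$.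
   Context: $\Gamma(\cdot)$ is the Gamma function. In (i), $t\in\mathbb R$ and $\sqrt t=i\sqrt{|t|}$ for $t<0$; the right-hand side is understood by continuity (value $1$ at $t=0$), i.e. as the continuous branch in $t$ of $\big(\Gamma(\tfrac{\alpha+3}{\alpha+2})J_{1/(\alpha+2)}(2z)\,z^{-1/(\alpha+2)}\big)^{-1/2}$ at $z=(1+i)\sqrt t/(\alpha+2)$, where $w\mapsto J_\gamma(w)w^{-\gamma}$ is entire. A random variable $Z$ has a subexponential distribution if $\mathbb P(|Z|\ge t)\le2\exp(-Kt)$ for all $t\ge0$ and some constant $K>0$ (equivalently, its $\psi_1$-Orlicz norm is finite). *)

(* Defs.v *)
From HB Require Import structures.
From mathcomp Require Import all_boot all_order all_algebra.
From mathcomp Require Import all_classical all_reals all_analysis.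
From mathcomp Require Import complex.

Set Implicit Arguments.
Unset Strict Implicit.
Unset Printing Implicit Defensive.

Import Order.TTheory GRing.Theory Num.Theory.
Import numFieldNormedType.Exports.

Local Open Scope classical_set_scope.
Local Open Scope ring_scope.
Local Open Scope complex_scope.

Section special_functions.
Context {R : realType}.

(* Euler's integral; it converges for 0 < x, the only case used here. *)
Definition Gamma (x : R) : R :=
  \int[lebesgue_measure]_(s in `]0, +oo[) (s `^ (x - 1) * expR (- s)).

(* Principal argument, in ]-pi, pi]. *)
Definition carg (z : R[i]) : R :=
  let a := acos (complex.Re z / Normc.normc z) in if 0 <= complex.Im z then a else - a.

(* Principal branch of z ^ a for a real exponent a. *)
Definition cpowR (z : R[i]) (a : R) : R[i] :=
  (Normc.normc z `^ a)%:C * (cos (a * carg z) +i* sin (a * carg z)).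

Definition cseries_sum (u : nat -> R[i]) : R[i] :=
  limn (series (fun k => complex.Re (u k))) +i* limn (series (fun k => complex.Im (u k))).

(* J_g(z) = \sum_k (-1)^k / (k! Gamma (k + g + 1)) (z / 2)^(2 k + g), for an
   order g > -1 (so that every argument of Gamma is positive). *)
Definition besselJ (g : R) (z : R[i]) : R[i] :=
  cpowR (z / 2) g *
  cseries_sum (fun k =>
    ((-1) ^+ k / (k`!%:R * Gamma (k%:R + g + 1)))%:C * (z / 2) ^+ (2 * k)).

(* Square root of a real number, equal to i * sqrt |t| when t < 0. *)
Definition csqrt (t : R) : R[i] :=
  if 0 <= t then (Num.sqrt t)%:C else 0 +i* Num.sqrt `|t|.

(* f is the continuous branch of F ^ (- 1 / 2) with value 1 at t = 0; F is
   only used at t != 0. At most one f qualifies: the quotient of two of them is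
   continuous on the real line, has square 1 and takes the value 1 at 0.
   Continuity is stated for the real and imaginary parts. *)
Definition inv_sqrt_branch (F f : R -> R[i]) : Prop :=
  [/\ continuous (fun t => complex.Re (f t)), continuous (fun t => complex.Im (f t)),
      f 0 = 1 &
      forall t, t != 0 -> F t * f t ^+ 2 = 1].

End special_functions.

Section probability_notions.
Context d (T : measurableType d) (R : realType) (P : probability T R).

Definition charfun (X : T -> R) (t : R) : R[i] :=
  (\int[P]_w cos (t * X w)) +i* (\int[P]_w sin (t * X w)).

Definition has_lebesgue_density (X : T -> R) : Prop :=
  exists f : R -> R,
    [/\ measurable_fun [set: R] f, forall x, 0 <= f x &
        forall A : set R, measurable A ->
          P (X @^-1` A) = (\int[lebesgue_measure]_(x in A) (f x)%:E)%E].

Definition subexponential (Z : T -> R) : Prop :=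
  exists K : R, 0 < K /\
    forall t : R, 0 <= t ->
      (P [set w | (t <= `|Z w|)%R] <= (2 * expR (- (K * t)))%:E)%E.

(* For finitely many variables the product rule over all Borel sets gives the
   rule for every subfamily, on taking A i = setT. *)
Definition mutually_independent (n : nat) (X : 'I_n -> T -> R) : Prop :=
  forall A : 'I_n -> set R, (forall i, measurable (A i)) ->
    P [set w | forall i, A i (X i w)] = (\prod_(i < n) P (X i @^-1` A i))%E.

(* Only the times t >= 0 matter: B is a process indexed by [0, +oo[. *)
Record standard_brownian_motion (B : R -> T -> R) : Prop := {
  bm_measurable : forall t, 0 <= t -> measurable_fun [set: T] (B t) ;
  bm_start : {ae P, forall w, B 0 w = 0} ;
  bm_independent : forall (n : nat) (t : nat -> R), 0 <= t 0%N ->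
    (forall i, (i < n)%N -> t i <= t i.+1) ->
    mutually_independent (fun (i : 'I_n) w => B (t i.+1) w - B (t i) w) ;
  bm_gaussian : forall s t, 0 <= s -> s < t ->
    forall A : set R, measurable A ->
      P ((fun w => B t w - B s w) @^-1` A) = normal_prob 0 (Num.sqrt (t - s)) A ;
  bm_continuous : forall w, {within `[0, +oo[, continuous (fun t => B t w)}
}.

Definition bridge_norm (alpha : R) (B : R -> T -> R) (w : T) : R :=
  Num.sqrt (\int[lebesgue_measure]_(l in `[0, 1])
              (l `^ alpha * (B l w - l * B 1 w) ^+ 2)).

End probability_notions.

(* The probability space may change with n. *)
Definition bigO_P (R : realType) (d : nat -> measure_display)
    (T : forall n, measurableType (d n)) (P : forall n, probability (T n) R)
    (X : forall n, T n -> R) (a : nat -> R) : Prop :=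
  forall eps : R, 0 < eps -> exists M : R, 0 < M /\
    \forall n \near \oo,
      (P n [set w | (M * a n < `|X n w|)%R] <= eps%:E)%E.

(* Main.v *)
(* Discretise the path with N equal steps. Conditioning the Gaussian walk on its
   endpoint and integrating out the increments one at a time gives, for
   [0 <= Re s], the exact formula [(E exp (- s Q_N))^2 * d_0 = 1], where [d] solves
   the second-order difference equation of [u'' = 2 s x^alpha u] backwards from
   [d_N = 0]. A discrete Wronskian argument compares [d_0] with [u 1], where
   [u 0 = 0] and [u' 0 = 1], so that [(E exp (- s V^2))^2 * u 1 = 1] in the limit.
   For [s = - i t] the power series of [u 1] is the Bessel series. For real [s] it
   grows like [exp (c sqrt s)], which makes the probability that [V^2 <= eps]
   exponentially small in [1 / eps] and yields the subexponential bounds; convexity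
   of the exponential and Fatou's lemma bound [E exp (V^2 / 16)], whence the maximum.
   For the density, shift the path by [th] times a tent function: by the
   Cameron-Martin formula the law of [V^2] is equivalent to that of the shifted
   functional, a nonconstant quadratic polynomial in [th]. Averaging over [th]
   shows that it gives no mass to a Lebesgue-null set. *)
Require Import Defs.
From HB Require Import structures.
From mathcomp Require Import all_boot all_order all_algebra.
From mathcomp Require Import all_classical all_reals all_analysis.
From mathcomp Require Import complex measurable_realfun ring lra zify.

Set Implicit Arguments.
Unset Strict Implicit.
Unset Printing Implicit Defensive.

Import Order.TTheory GRing.Theory Num.Theory.
Import numFieldNormedType.Exports.

Local Open Scope classical_set_scope.
Local Open Scope ring_scope.
Local Open Scope complex_scope.

(** * Complex-valued integrals *)

(** Only squares of Gaussian constants are computed: a Gaussian integral with complex parameter is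
    known up to a root [kap] with [kap ^+ 2] prescribed, and the transform enters as [E ^+ 2]. So no
    branch of a complex square root is followed through the limits; the branch in the statement is
    fixed by continuity of the characteristic function and its value 1 at 0. The increments of the
    bridge are not independent, which is why the endpoint is pinned: for fixed [y] the integrand is
    a product of functions of successive partial sums of an i.i.d. walk. The half-plane [0 <= Re s]
    contains both real [s] and [s = - i t], and keeps every factor of modulus at most 1. Two limits
    are taken in a fixed order: the mesh tends to 0 with the series truncated at [M], so that
    constants depending on [M] disappear, and only then [M] grows. The tent comes from a drift that
    is constant on the first half of the interval and zero afterwards; its density involves only the
    value of the path at 1/2 and is the same on every mesh having 1/2 as a grid point. *)

Section dominated.
Context d (T : measurableType d) (R : realType) (mu : {measure set T -> \bar R}).
Implicit Types (D : set T) (f g : T -> R).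

Lemma integrable_dominated D f g : measurable D -> measurable_fun D f ->
  (forall x, D x -> `|f x| <= g x) -> mu.-integrable D (EFin \o g) ->
  mu.-integrable D (EFin \o f).
Proof.
move=> mD mf fg ig; apply: (le_integrable mD _ _ ig); first exact/measurable_EFinP.
move=> x Dx /=; rewrite lee_fin (le_trans (fg _ Dx))// ler_norm//.
Qed.

Lemma RintegrableZl D f (k : R) : measurable D -> mu.-integrable D (EFin \o f) ->
  mu.-integrable D (EFin \o (fun x => k * f x)).
Proof. by move=> mD h; exact: (integrableZl mD k h). Qed.

Lemma cvg_Rintegral_dominated D (f_ : (T -> R)^nat) f g : measurable D ->
  (forall n, measurable_fun D (f_ n)) ->
  {ae mu, forall x, D x -> f_ n x @[n --> \oo] --> f x} ->
  measurable_fun D f ->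
  (forall n x, D x -> `|f_ n x| <= g x) ->
  mu.-integrable D (EFin \o g) ->
  (\int[mu]_(x in D) f_ n x) @[n --> \oo] --> \int[mu]_(x in D) f x.
Proof.
move=> mD mf_ cf mf fg ig.
have mE h : measurable_fun D h -> measurable_fun D (EFin \o h).
  by move=> ?; exact/measurable_EFinP.
have cfE : {ae mu, forall x, D x ->
    (fun n => (EFin \o f_ n) x) @ \oo --> (EFin \o f) x}.
  apply: filterS cf => x h Dx; apply: cvg_EFin; first exact: nearW.
  exact: h.
have [|int_f _] := @dominated_convergence _ _ _ mu _ mD
   (fun n => EFin \o f_ n) (EFin \o f) (EFin \o g) (fun n => mE _ _ (mf_ n)) (mE _ _ mf) cfE ig.
  by apply: aeW => x n Dx /=; rewrite lee_fin fg.
move=> h; apply: fine_cvg; rewrite /Rintegral fineK; first exact: h.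
exact: integrable_fin_num.
Qed.

End dominated.

Section complex_exponential.
Context {R : realType}.
Implicit Types z u : R[i].

Definition cexp z : R[i] :=
  (expR (complex.Re z) * cos (complex.Im z)) +i*
  (expR (complex.Re z) * sin (complex.Im z)).

Lemma cexpD z u : cexp (z + u) = cexp z * cexp u.
Proof.
case: z u => [a b] [c e]; rewrite /cexp /=; simpc; rewrite expRD cosD sinD.
by apply/eqP; rewrite eq_complex /=; apply/andP; split; apply/eqP; ring.
Qed.

Lemma cexp0 : cexp 0 = 1.
Proof. by rewrite /cexp /= expR0 cos0 sin0 !mul1r. Qed.

Lemma cexp_real (x : R) : cexp x%:C = (expR x)%:C.
Proof. by rewrite /cexp /= cos0 sin0 mulr1 mulr0. Qed.

Lemma cexp_neq0 z : cexp z != 0.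
Proof.
apply/eqP => h; have := cexpD z (- z); rewrite subrr cexp0 h mul0r.
by move/eqP; rewrite oner_eq0.
Qed.

Lemma cexpN z : cexp (- z) = (cexp z)^-1.
Proof.
by apply: (mulfI (cexp_neq0 z)); rewrite -cexpD subrr cexp0 mulfV ?cexp_neq0.
Qed.

Lemma cexp_sum (I : Type) (r : seq I) (P : pred I) (F : I -> R[i]) :
  cexp (\sum_(i <- r | P i) F i) = \prod_(i <- r | P i) cexp (F i).
Proof.
by apply: (big_morph cexp cexpD); exact: cexp0.
Qed.

Lemma normc_cexp z : Normc.normc (cexp z) = expR (complex.Re z).
Proof.
rewrite /cexp /= !exprMn -mulrDr cos2Dsin2 mulr1 sqrtr_sqr ger0_norm//.
Qed.

Lemma normc_ge0 z : 0 <= Normc.normc z.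
Proof. by case: z => a b; exact: sqrtr_ge0. Qed.

Lemma normcD z u : Normc.normc (z + u) <= Normc.normc z + Normc.normc u.
Proof. exact: le_normcD. Qed.

Lemma normc_real (x : R) : Normc.normc x%:C = `|x|.
Proof. by rewrite /= expr0n /= addr0 sqrtr_sqr. Qed.

Lemma ler_Re_normc z : `|complex.Re z| <= Normc.normc z.
Proof.
case: z => a b /=; rewrite -sqrtr_sqr ler_wsqrtr// lerDl sqr_ge0//.
Qed.

Lemma ler_Im_normc z : `|complex.Im z| <= Normc.normc z.
Proof.
case: z => a b /=; rewrite -sqrtr_sqr ler_wsqrtr// lerDr sqr_ge0//.
Qed.

Lemma normc_le_ReIm z : Normc.normc z <= `|complex.Re z| + `|complex.Im z|.
Proof.
case: z => a b /=.
rewrite -[leRHS]ger0_norm ?addr_ge0// -sqrtr_sqr ler_wsqrtr//.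
rewrite -(real_normK (num_real a)) -(real_normK (num_real b)) sqrrD.
by rewrite -addrA lerD2l lerDr mulrn_wge0 ?mulr_ge0.
Qed.

Lemma RecD z u : complex.Re (z + u) = complex.Re z + complex.Re u.
Proof. by case: z u => [a b] [c e]. Qed.

Lemma ImcD z u : complex.Im (z + u) = complex.Im z + complex.Im u.
Proof. by case: z u => [a b] [c e]. Qed.

Lemma RecM z u : complex.Re (z * u) =
  complex.Re z * complex.Re u - complex.Im z * complex.Im u.
Proof. by case: z u => [a b] [c e]. Qed.

Lemma ImcM z u : complex.Im (z * u) =
  complex.Re z * complex.Im u + complex.Im z * complex.Re u.
Proof. by case: z u => [a b] [c e]. Qed.

Lemma RecN z : complex.Re (- z) = - complex.Re z.
Proof. by case: z. Qed.

Lemma ImcN z : complex.Im (- z) = - complex.Im z.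
Proof. by case: z. Qed.

Lemma complex_ext z u : complex.Re z = complex.Re u ->
  complex.Im z = complex.Im u -> z = u.
Proof. by case: z u => [a b] [c e] /= -> ->. Qed.

End complex_exponential.

Section complex_integral.
Context d (T : measurableType d) (R : realType) (mu : {measure set T -> \bar R}).
Implicit Types (f g : T -> R[i]).

Definition cint f : R[i] :=
  (\int[mu]_x complex.Re (f x)) +i* (\int[mu]_x complex.Im (f x)).

Definition cintegrable f : Prop :=
  mu.-integrable setT (EFin \o (fun x => complex.Re (f x))) /\
  mu.-integrable setT (EFin \o (fun x => complex.Im (f x))).

Definition cmeasurable (f : T -> R[i]) : Prop :=
  measurable_fun setT (fun x => complex.Re (f x)) /\
  measurable_fun setT (fun x => complex.Im (f x)).

Lemma eq_cint f g : f =1 g -> cint f = cint g.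
Proof. by move=> /funext ->. Qed.

Lemma cintegrable_dominated f (g : T -> R) : cmeasurable f ->
  (forall x, Normc.normc (f x) <= g x) -> mu.-integrable setT (EFin \o g) ->
  cintegrable f.
Proof.
move=> [mr mi] fg ig; split; apply: integrable_dominated ig => // x _.
  exact: le_trans (ler_Re_normc _) (fg x).
exact: le_trans (ler_Im_normc _) (fg x).
Qed.

Lemma cmeasurableM f g : cmeasurable f -> cmeasurable g ->
  cmeasurable (fun x => f x * g x).
Proof.
move=> [fr fi] [gr gi]; split.
  under eq_fun do rewrite RecM.
  by apply: measurable_funB; apply: measurable_funM.
under eq_fun do rewrite ImcM.
by apply: measurable_funD; apply: measurable_funM.
Qed.

Lemma cmeasurableD f g : cmeasurable f -> cmeasurable g ->
  cmeasurable (fun x => f x + g x).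
Proof.
move=> [fr fi] [gr gi]; split.
  by under eq_fun do rewrite RecD; apply: measurable_funD.
by under eq_fun do rewrite ImcD; apply: measurable_funD.
Qed.

Lemma cmeasurable_cst (c : R[i]) : cmeasurable (fun=> c).
Proof. by split; exact: measurable_cst. Qed.

Lemma cmeasurable_real (f : T -> R) : measurable_fun setT f ->
  cmeasurable (fun x => (f x)%:C).
Proof. by move=> mf; split => //=; exact: measurable_cst. Qed.

Lemma cmeasurable_exp f : cmeasurable f -> cmeasurable (fun x => cexp (f x)).
Proof.
move=> [fr fi]; split; rewrite /cexp /=.
  apply: measurable_funM; first exact: measurableT_comp.
  by apply: measurableT_comp fi; exact: (continuous_measurable_fun (@continuous_cos R)).
apply: measurable_funM; first exact: measurableT_comp.
by apply: measurableT_comp fi; exact: (continuous_measurable_fun (@continuous_sin R)).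
Qed.

Lemma cmeasurable_prod (I : Type) (r : seq I) (P : pred I) (F : I -> T -> R[i]) :
  (forall i, cmeasurable (F i)) ->
  cmeasurable (fun x => \prod_(i <- r | P i) F i x).
Proof.
move=> mF; elim: r => [|i r IH].
  by under eq_fun do rewrite big_nil; exact: cmeasurable_cst.
under eq_fun do rewrite big_cons; case: (P i) => //; exact: cmeasurableM.
Qed.

Lemma cintegrableZl f c : cintegrable f -> cintegrable (fun x => c * f x).
Proof.
move=> [fr fi].
have h a b : mu.-integrable [set: T]
    (EFin \o (fun x => a * complex.Re (f x) + b * complex.Im (f x))).
  rewrite (_ : _ \o _ = (fun x => a%:E * (EFin \o (fun x => complex.Re (f x))) x) \+
    (fun x => b%:E * (EFin \o (fun x => complex.Im (f x))) x))%E.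
    by apply: integrableD => //; exact: integrableZl.
  by apply/funext => x /=; rewrite EFinD !EFinM.
split.
  by under eq_fun do rewrite RecM -mulNr; exact: h.
by under eq_fun do rewrite ImcM addrC; exact: h.
Qed.

Lemma cintZl f c : cintegrable f -> cint (fun x => c * f x) = c * cint f.
Proof.
move=> [fr fi].
have h a b : \int[mu]_x (a * complex.Re (f x) + b * complex.Im (f x)) =
    a * \int[mu]_x complex.Re (f x) + b * \int[mu]_x complex.Im (f x).
  rewrite RintegralD//; first by rewrite !RintegralZl.
    exact: (integrableZl measurableT a fr).
  exact: (integrableZl measurableT b fi).
apply: complex_ext; rewrite ?RecM ?ImcM /=.
  by rewrite -mulNr -h; apply: eq_Rintegral => x _; rewrite RecM mulNr.
by rewrite addrC -h; apply: eq_Rintegral => x _; rewrite ImcM addrC.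
Qed.

Lemma cintD f g : cintegrable f -> cintegrable g ->
  cint (fun x => f x + g x) = cint f + cint g.
Proof.
move=> [fr fi] [gr gi]; apply: complex_ext; rewrite ?RecD ?ImcD /= -RintegralD//.
  by apply: eq_Rintegral => x _; rewrite RecD.
by apply: eq_Rintegral => x _; rewrite ImcD.
Qed.

Lemma cintegrableD f g : cintegrable f -> cintegrable g ->
  cintegrable (fun x => f x + g x).
Proof.
move=> [fr fi] [gr gi]; split.
  by under eq_fun do rewrite RecD; exact: (integrableD measurableT fr gr).
by under eq_fun do rewrite ImcD; exact: (integrableD measurableT fi gi).
Qed.

End complex_integral.

(** * Gaussian integrals *)

Section real_gaussian.
Context {R : realType}.
Notation mu := (@lebesgue_measure R).
Implicit Types a m x : R.

Definition gau a m x : R := expR (- (a * (x - m) ^+ 2)).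

(** Recognised as a multiple of the normal density of variance [1 / (2 a)], so that integrability
    and total mass are inherited from it. *)
Lemma gauE a m : 0 < a -> gau a m =
  (fun x => (normal_peak (Num.sqrt (a *+ 2)^-1))^-1 *
            normal_pdf m (Num.sqrt (a *+ 2)^-1) x).
Proof.
move=> a0; apply/funext => x.
have s0 : Num.sqrt (a *+ 2)^-1 != 0 by rewrite gt_eqF// sqrtr_gt0 invr_gt0 pmulrn_lgt0.
rewrite normal_pdfE//= mulrA mulVf ?mul1r; last by rewrite gt_eqF// normal_peak_gt0.
rewrite /normal_fun sqr_sqrtr ?invr_ge0 ?mulrn_wge0 ?(ltW a0)//.
rewrite (_ : (a *+ 2)^-1 *+ 2 = a^-1); last by field; rewrite gt_eqF.
by rewrite invrK mulrC mulrN.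
Qed.

Lemma measurable_gau a m : measurable_fun setT (gau a m).
Proof.
apply: measurableT_comp => //; apply: measurableT_comp => //.
apply: measurable_funM => //; apply: measurable_funX; exact: measurable_funB.
Qed.

Lemma integrable_gau a m : 0 < a -> mu.-integrable setT (EFin \o gau a m).
Proof.
move=> a0; rewrite gauE// (_ : _ \o _ = fun x =>
  ((normal_peak (Num.sqrt (a *+ 2)^-1))^-1%:E *
   (normal_pdf m (Num.sqrt (a *+ 2)^-1) x)%:E)%E); last by apply/funext.
by apply: integrableZl => //; exact: integrable_normal_pdf.
Qed.

Lemma integral_gau a m : 0 < a -> \int[mu]_x gau a m x = Num.sqrt (pi / a).
Proof.
move=> a0; rewrite gauE// RintegralZl//; last exact: integrable_normal_pdf.
rewrite /Rintegral integral_normal_pdf /= mulr1 /normal_peak invrK.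
rewrite sqr_sqrtr ?invr_ge0 ?mulrn_wge0 ?(ltW a0)//.
by congr (Num.sqrt _); field; rewrite gt_eqF.
Qed.

(** The difference of the exponents is [a] times a square plus a nonnegative term. The geometric
    majorant gives the decay at both ends of [[- n, n]]. *)
Lemma gau_nat_le a m (n : nat) : 0 < a ->
  gau a m n%:R <= expR (a + a * 2 * `|m|) * expR (- (a * 2)) ^+ n /\
  gau a m (- n%:R) <= expR (a + a * 2 * `|m|) * expR (- (a * 2)) ^+ n.
Proof.
move=> a0; rewrite -expRM_natl -expRD.
have h x : 0 <= x ^+ 2 by exact: sqr_ge0.
have m1 : m <= `|m| by exact: ler_norm.
have m2 : - m <= `|m| by rewrite -normrN ler_norm.
split; rewrite ler_expR -subr_ge0.
  rewrite (_ : _ - _ = a * ((n%:R - m - 1) ^+ 2 + 2 * (`|m| - m))); last by ring.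
  by rewrite mulr_ge0 ?(ltW a0)// addr_ge0// mulr_ge0// subr_ge0.
rewrite (_ : _ - _ = a * ((n%:R + m - 1) ^+ 2 + 2 * (`|m| + m))); last by ring.
by rewrite mulr_ge0 ?(ltW a0)// addr_ge0// mulr_ge0//; lra.
Qed.

Lemma cvg_gau_nat a m : 0 < a ->
  gau a m n%:R @[n --> \oo] --> 0 /\ gau a m (- n%:R) @[n --> \oo] --> 0.
Proof.
move=> a0.
have c : expR (a + a * 2 * `|m|) * expR (- (a * 2)) ^+ n @[n --> \oo] --> 0.
  rewrite -(mulr0 (expR (a + a * 2 * `|m|))); apply: cvgM; first exact: cvg_cst.
  apply: cvg_expr; rewrite ger0_norm ?expR_ge0// expR_lt1 oppr_lt0; exact: mulr_gt0.
split; apply: (squeeze_cvgr _ (cvg_cst 0) c); apply: nearW => n;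
  rewrite expR_ge0 /=; by have [] := gau_nat_le m n a0.
Qed.

(** Replaces integration by parts on the whole line: over [[- n, n]] the integral is a boundary
    term, which the Gaussian bound on [F] sends to 0. *)
Lemma integral_derive_gau0 (F f : R -> R) a m K : 0 < a ->
  (forall x, is_derive x 1 F (f x)) -> continuous f ->
  (forall x, `|F x| <= K * gau a m x) -> (forall x, `|f x| <= K * gau a m x) ->
  \int[mu]_x f x = 0.
Proof.
move=> a0 dF cf bF bf.
have iK : mu.-integrable setT (EFin \o (fun x => K * gau a m x)).
  rewrite (_ : _ \o _ = fun x => (K%:E * (EFin \o gau a m) x)%E)//.
  by apply: integrableZl => //; exact: integrable_gau.
have mf : measurable_fun setT f by exact: continuous_measurable_fun.
(* At its centre [m] the Gaussian equals 1, so the bound on [F] there forces the sign of [K]. *)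
have K0 : 0 <= K.
  have := le_trans (normr_ge0 _) (bF m).
  by rewrite /gau subrr expr0n mulr0 oppr0 expR0 mulr1.
pose f_ n := f \_ `[- n%:R, n%:R].
have c1 : \int[mu]_x f_ n x @[n --> \oo] --> \int[mu]_x f x.
  apply: (@cvg_Rintegral_dominated _ _ _ mu setT f_ f (fun x => K * gau a m x)) => //.
  - by move=> n; apply/(measurable_restrictT _ _).1 => //; exact: measurable_funTS.
  - apply: aeW => x _; apply: cvg_near_cst.
    near=> n; rewrite /f_ patchE mem_set//= in_itv /=; apply/andP; split.
      rewrite lerNl (le_trans (ler_norm _))// normrN; near: n; exact: nbhs_infty_ger.
    rewrite (le_trans (ler_norm _))//; near: n; exact: nbhs_infty_ger.
  - move=> n x _; rewrite /f_ patchE; case: ifP => // _.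
    by rewrite normr0 mulr_ge0 ?expR_ge0.
have c2 : \int[mu]_x f_ n x @[n --> \oo] --> 0 - 0.
  have -> : (fun n => \int[mu]_x f_ n x) = (fun n : nat => F n%:R - F (- n%:R)).
    apply/funext => n; rewrite /f_ -Rintegral_mkcond.
    have [->|n0] := eqVneq n 0%N; first by rewrite oppr0 set_itv1 Rintegral_set1 subrr.
    have ab : (- n%:R : R) < n%:R.
      have : (0 : R) < n%:R by rewrite ltr0n lt0n.
      lra.
    have cF : continuous F.
      by move=> x; apply/differentiable_continuous/derivable1_diffP; apply: ex_derive.
    rewrite /Rintegral (@continuous_FTC2 _ f F)//.
    - by apply: continuous_subspaceT.
    - split=> [x _| |]; [exact: ex_derive|apply: cvg_at_right_filter; exact: cF|
        apply: cvg_at_left_filter; exact: cF].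
    - by move=> x _; rewrite derive1E; exact: derive_val.
  have b0 (u : nat -> R) : gau a m (u n) @[n --> \oo] --> 0 -> F (u n) @[n --> \oo] --> 0.
    move=> h; have c : K * gau a m (u n) @[n --> \oo] --> 0.
      by rewrite -(mulr0 K); apply: cvgM => //; exact: cvg_cst.
    have cN : - (K * gau a m (u n)) @[n --> \oo] --> 0.
      by rewrite -oppr0; exact: cvgN.
    apply: (squeeze_cvgr _ cN c); apply: nearW => n; by rewrite -ler_norml.
  by apply: cvgB; apply: b0; have [] := @cvg_gau_nat a m a0.
by rewrite -(subrr (0 : R)); apply: (cvg_unique _ c1 c2).
Unshelve. all: end_near. Qed.

End real_gaussian.

Section complex_derivative.
Context {R : realType}.
Implicit Types (f g : R -> R[i]) (x : R).

Definition is_cderive f x (l : R[i]) : Prop :=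
  is_derive x 1 (fun y => complex.Re (f y)) (complex.Re l) /\
  is_derive x 1 (fun y => complex.Im (f y)) (complex.Im l).

Lemma is_cderive_eq f x l l' : is_cderive f x l -> l = l' -> is_cderive f x l'.
Proof. by move=> ? <-. Qed.

Lemma is_cderive_cst (c : R[i]) x : is_cderive (fun=> c) x 0.
Proof. by split; exact: is_derive_cst. Qed.

Lemma is_cderive_id x : is_cderive (fun y => y%:C) x 1.
Proof. by split => /=; [exact: is_derive_id | exact: is_derive_cst]. Qed.

Lemma is_cderiveD f g x l k : is_cderive f x l -> is_cderive g x k ->
  is_cderive (fun y => f y + g y) x (l + k).
Proof.
move=> [fr fi] [gr gi]; split; rewrite ?RecD ?ImcD.
  by under eq_fun do rewrite RecD; exact: is_deriveD.
by under eq_fun do rewrite ImcD; exact: is_deriveD.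
Qed.

Lemma is_cderiveM f g x l k : is_cderive f x l -> is_cderive g x k ->
  is_cderive (fun y => f y * g y) x (l * g x + f x * k).
Proof.
move=> [fr fi] [gr gi]; split.
  under eq_fun do rewrite RecM.
  apply: (is_derive_eq (is_deriveB (is_deriveM fr gr) (is_deriveM fi gi))).
  rewrite RecD !RecM -![_ *: _]/(_ * _); ring.
under eq_fun do rewrite ImcM.
apply: (is_derive_eq (is_deriveD (is_deriveM fr gi) (is_deriveM fi gr))).
rewrite ImcD !ImcM -![_ *: _]/(_ * _); ring.
Qed.

Lemma is_cderiveZ f x l (c : R[i]) : is_cderive f x l ->
  is_cderive (fun y => c * f y) x (c * l).
Proof.
move=> fl; apply: is_cderive_eq (is_cderiveM (is_cderive_cst c x) fl) _.
by rewrite mul0r add0r.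
Qed.

Lemma is_cderive_exp f x l : is_cderive f x l ->
  is_cderive (fun y => cexp (f y)) x (l * cexp (f x)).
Proof.
move=> [fr fi]; split; rewrite /cexp /=.
  have := is_deriveM (is_derive1_comp (is_derive_expR _) fr)
    (is_derive1_comp (is_derive_cos _) fi).
  move=> h; apply: (is_derive_eq h).
  rewrite RecM /= -![_ *: _]/(_ * _); ring.
have := is_deriveM (is_derive1_comp (is_derive_expR _) fr)
  (is_derive1_comp (is_derive_sin _) fi).
move=> h; apply: (is_derive_eq h).
rewrite ImcM /= -![_ *: _]/(_ * _); ring.
Qed.

Lemma is_cderive0_cst f : (forall x, is_cderive f x 0) -> forall x y, f x = f y.
Proof.
move=> f0 x y; apply: complex_ext.
  by apply: (@is_derive_0_is_cst _ (fun y => complex.Re (f y))) => z; have [] := f0 z.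
by apply: (@is_derive_0_is_cst _ (fun y => complex.Im (f y))) => z; have [] := f0 z.
Qed.

Lemma is_cderive_continuous f (l : R -> R[i]) : (forall x, is_cderive f x (l x)) ->
  continuous (fun y => complex.Re (f y)) /\ continuous (fun y => complex.Im (f y)).
Proof.
move=> fl; split=> x; apply/differentiable_continuous/derivable1_diffP;
  have [[h _] [k _]] := fl x; assumption.
Qed.

End complex_derivative.

(** * Gaussian integrals with complex parameters *)

Section complex_gaussian.
Context {R : realType}.
Notation mu := (@lebesgue_measure R).
Implicit Types (p q : R[i]) (x : R).

Definition cgau p q x : R[i] := cexp (- 2^-1 * p * x%:C ^+ 2 + q * x%:C).

Lemma is_cderive_cgau p q x : is_cderive (cgau p q) x ((q - p * x%:C) * cgau p q x).
Proof.
have h := is_cderiveM (is_cderive_id x) (is_cderive_id x).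
have := is_cderive_exp (is_cderiveD (is_cderiveZ (- 2^-1 * p) h)
  (is_cderiveZ q (is_cderive_id x))).
move/is_cderive_eq; apply; congr (_ * _); by field.
Qed.

Lemma is_cderive_cgau_param (p p' q q' : R[i]) x (t : R) :
  is_cderive (fun t => cgau (p + t%:C * p') (q + t%:C * q') x) t
   ((- 2^-1 * p' * x%:C ^+ 2 + q' * x%:C) * cgau (p + t%:C * p') (q + t%:C * q') x).
Proof.
have h (a b : R[i]) : is_cderive (fun t => a + t%:C * b) t b.
  apply: is_cderive_eq (is_cderiveD (is_cderive_cst a t)
    (is_cderiveM (is_cderive_id t) (is_cderive_cst b t))) _.
  by rewrite mulr0 addr0 mul1r add0r.
have := is_cderive_exp (is_cderiveD
  (is_cderiveM (is_cderiveZ (- 2^-1) (h p p')) (is_cderive_cst (x%:C ^+ 2) t))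
  (is_cderiveM (h q q') (is_cderive_cst x%:C t))).
by move/is_cderive_eq; apply; rewrite !mulr0 !addr0.
Qed.

(** Depends on the parameters only through the real part of [p] and a bound on that of [q], hence is
    uniform along the parameter segments used below. *)
Definition cgau_bound (a c : R) : R := expR (c ^+ 2 / a) * (1 + 8 / a).

(** Of the decay rate [a / 2], where [a] is the real part of [p], Young's inequality spends [a / 4]
    on the linear term and [a / 8] pays for the factor [1 + x ^+ 2]; the last [a / 8] remains in
    [gau]. The factor covers moments up to order 2. *)
Lemma normc_cgau_le p q x (c : R) : 0 < complex.Re p -> `|complex.Re q| <= c ->
  (1 + x ^+ 2) * Normc.normc (cgau p q x) <=
  cgau_bound (complex.Re p) c * gau (complex.Re p / 8) 0 x.
Proof.
move=> a0 ec; rewrite /cgau normc_cexp.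
have -> : complex.Re (- 2^-1 * p * x%:C ^+ 2 + q * x%:C) =
    - (complex.Re p / 2) * x ^+ 2 + complex.Re q * x.
  have -> : (2^-1 : R[i]) = (2^-1 : R)%:C by rewrite fmorphV rmorph_nat.
  clear a0 ec; case: p q => [a b] [e f].
  rewrite -rmorphXn -rmorphN; simpc => /=; ring.
move: a0 ec; set a := complex.Re p; set e := complex.Re q => a0 ec.
rewrite /gau subr0 /cgau_bound.
have h1 : - (a / 2) * x ^+ 2 + e * x <= c ^+ 2 / a - a / 4 * x ^+ 2.
  rewrite -subr_ge0.
  have -> : c ^+ 2 / a - a / 4 * x ^+ 2 - (- (a / 2) * x ^+ 2 + e * x) =
     a^-1 * ((a / 2 * x - e) ^+ 2 + (c ^+ 2 - e ^+ 2)) by field; rewrite gt_eqF.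
  rewrite mulr_ge0 ?invr_ge0 ?(ltW a0)// addr_ge0 ?sqr_ge0// subr_ge0.
  rewrite -(real_normK (num_real e)) lerXn2r// nnegrE//.
  exact: le_trans ec.
have h2 : (1 + x ^+ 2) <= (1 + 8 / a) * expR (a / 8 * x ^+ 2).
  have k : 1 + a / 8 * x ^+ 2 <= expR (a / 8 * x ^+ 2) by exact: expR_ge1Dx.
  apply: (@le_trans _ _ ((1 + 8 / a) * (1 + a / 8 * x ^+ 2))).
    have -> : (1 + 8 / a) * (1 + a / 8 * x ^+ 2) =
      1 + x ^+ 2 + (8 / a + a / 8 * x ^+ 2) by field; rewrite gt_eqF.
    have ia : 0 < a^-1 by rewrite invr_gt0.
    have x2 := sqr_ge0 x; have ax := mulr_ge0 (ltW a0) x2; lra.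
  by rewrite ler_pM2l// addr_gt0// divr_gt0.
apply: (@le_trans _ _ ((1 + 8 / a) * expR (a / 8 * x ^+ 2) *
    expR (c ^+ 2 / a - a / 4 * x ^+ 2))).
  by apply: ler_pM; rewrite ?expR_ge0 ?addr_ge0 ?sqr_ge0 ?ler_expR.
rewrite -mulrA -expRD [leRHS]mulrAC mulrC -!expRD ler_wpM2r//; last first.
  by rewrite ler_expR; lra.
by rewrite addr_ge0// divr_ge0// ltW.
Qed.

Lemma cmeasurable_cgau p q : cmeasurable (cgau p q).
Proof.
have [cr ci] := is_cderive_continuous (is_cderive_cgau p q).
by split; exact: continuous_measurable_fun.
Qed.

Lemma cmeasurable_X n : cmeasurable (fun x : R => x%:C ^+ n).
Proof.
split => /=; under eq_fun do rewrite -rmorphXn; last exact: measurable_cst.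
exact: measurable_funX.
Qed.

Lemma normc_X_le (n : nat) x : (n <= 2)%N -> Normc.normc (x%:C ^+ n) <= 1 + x ^+ 2.
Proof.
move=> n2; rewrite -rmorphXn normc_real normrX.
have h := sqr_ge0 (`|x| - 1).
have k := real_normK (num_real x).
case: n n2 => [|[|[|//]]] _; rewrite ?expr0 ?expr1 -?k.
- by rewrite lerDl sqr_ge0.
- move: h; rewrite sqrrB1; have := normr_ge0 x; nra.
- by rewrite lerDr.
Qed.

Lemma cintegrable_Xcgau p q n : (n <= 2)%N -> 0 < complex.Re p ->
  cintegrable mu (fun x => x%:C ^+ n * cgau p q x).
Proof.
move=> n2 p0; apply: (@cintegrable_dominated _ _ R mu (fun x => x%:C ^+ n * cgau p q x) (fun x =>
   cgau_bound (complex.Re p) `|complex.Re q| * gau (complex.Re p / 8) 0 x)).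
- apply: cmeasurableM; [exact: cmeasurable_X|exact: cmeasurable_cgau].
- move=> x; rewrite Normc.normcM; apply: le_trans (normc_cgau_le _ _ (lexx _)) => //.
  by rewrite ler_wpM2r ?normc_ge0// normc_X_le.
- by apply: RintegrableZl => //; apply: integrable_gau; rewrite divr_gt0.
Qed.

Definition cgau_moment n p q := cint mu (fun x => x%:C ^+ n * cgau p q x).

Lemma cgau_poly_bound p q (c : nat -> R[i]) : 0 < complex.Re p ->
  exists K, forall x,
    Normc.normc ((c 0%N + c 1%N * x%:C + c 2%N * x%:C ^+ 2) * cgau p q x) <=
    K * gau (complex.Re p / 8) 0 x.
Proof.
move=> p0; pose L := Normc.normc (c 0%N) + Normc.normc (c 1%N) + Normc.normc (c 2%N).
exists (L * cgau_bound (complex.Re p) `|complex.Re q|) => x.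
rewrite Normc.normcM -mulrA.
apply: (@le_trans _ _ (L * ((1 + x ^+ 2) * Normc.normc (cgau p q x)))); last first.
  rewrite ler_wpM2l ?addr_ge0 ?normc_ge0//; exact: normc_cgau_le.
rewrite [leRHS]mulrA ler_wpM2r ?normc_ge0//.
apply: (le_trans (normcD _ _)); rewrite 2!mulrDl lerD//; last first.
  by rewrite Normc.normcM ler_wpM2l ?normc_ge0// normc_X_le.
apply: (le_trans (normcD _ _)); rewrite lerD//; last first.
  by rewrite Normc.normcM ler_wpM2l ?normc_ge0// -[x%:C]expr1 normc_X_le.
by rewrite ler_peMr ?normc_ge0// lerDl sqr_ge0.
Qed.

Lemma cint_derive0 (F f : R -> R[i]) p q (c c' : nat -> R[i]) : 0 < complex.Re p ->
  (forall x, F x = (c 0%N + c 1%N * x%:C + c 2%N * x%:C ^+ 2) * cgau p q x) ->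
  (forall x, f x = (c' 0%N + c' 1%N * x%:C + c' 2%N * x%:C ^+ 2) * cgau p q x) ->
  (forall x, is_cderive F x (f x)) -> cint mu f = 0.
Proof.
move=> p0 FE fE dF.
have [K hK] := cgau_poly_bound q c p0; have [K' hK'] := cgau_poly_bound q c' p0.
have p8 : 0 < complex.Re p / 8 by rewrite divr_gt0.
have M1 : K <= Num.max K K' by rewrite le_max lexx.
have M2 : K' <= Num.max K K' by rewrite le_max lexx orbT.
have [cr ci] : continuous (fun y => complex.Re (f y)) /\
    continuous (fun y => complex.Im (f y)).
  rewrite (_ : f = fun x => (c' 0%N + c' 1%N * x%:C + c' 2%N * (x%:C * x%:C)) * cgau p q x).
    apply: is_cderive_continuous => x; apply: is_cderiveM; last exact: is_cderive_cgau.
    apply: is_cderiveD; last by apply: is_cderiveZ; apply: is_cderiveM; exact: is_cderive_id.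
    by apply: is_cderiveD; [exact: is_cderive_cst|apply: is_cderiveZ; exact: is_cderive_id].
  by apply/funext => x; rewrite fE.
have bF x : Normc.normc (F x) <= Num.max K K' * gau (complex.Re p / 8) 0 x.
  by rewrite FE; apply: (le_trans (hK x)); rewrite ler_wpM2r ?expR_ge0.
have bf x : Normc.normc (f x) <= Num.max K K' * gau (complex.Re p / 8) 0 x.
  by rewrite fE; apply: (le_trans (hK' x)); rewrite ler_wpM2r ?expR_ge0.
apply: complex_ext => /=.
  apply: (@integral_derive_gau0 _ (fun x => complex.Re (F x)) _
    (complex.Re p / 8) 0 (Num.max K K')) => //.
  - by move=> x; have [] := dF x.
  - by move=> x; exact: le_trans (ler_Re_normc _) (bF x).
  - by move=> x; exact: le_trans (ler_Re_normc _) (bf x).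
apply: (@integral_derive_gau0 _ (fun x => complex.Im (F x)) _
  (complex.Re p / 8) 0 (Num.max K K')) => //.
- by move=> x; have [] := dF x.
- by move=> x; exact: le_trans (ler_Im_normc _) (bF x).
- by move=> x; exact: le_trans (ler_Im_normc _) (bf x).
Qed.

(** The integral of the derivative [(q - p x) * cgau p q x] of the Gaussian itself vanishes. *)
Lemma cgau_moment1 p q : 0 < complex.Re p ->
  p * cgau_moment 1 p q = q * cgau_moment 0 p q.
Proof.
move=> p0; apply/eqP; rewrite eq_sym -subr_eq0; apply/eqP.
have i0 := @cintegrable_Xcgau p q 0 isT p0.
have i1 := @cintegrable_Xcgau p q 1 isT p0.
rewrite /cgau_moment -mulNr -!cintZl// -cintD; [|exact: cintegrableZl..].
apply: (@cint_derive0 (cgau p q) _ p q (nth 0 [:: 1]) (nth 0 [:: q; -p])) => //=.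
- by move=> x; ring.
- by move=> x; ring.
- move=> x; apply: is_cderive_eq (is_cderive_cgau p q x) _; ring.
Qed.

(** The integral of the derivative of [x * cgau p q x] vanishes. *)
Lemma cgau_moment2 p q : 0 < complex.Re p ->
  p * cgau_moment 2 p q = cgau_moment 0 p q + q * cgau_moment 1 p q.
Proof.
move=> p0; apply/eqP; rewrite eq_sym -subr_eq0; apply/eqP.
have i0 := @cintegrable_Xcgau p q 0 isT p0.
have i1 := @cintegrable_Xcgau p q 1 isT p0.
have i2 := @cintegrable_Xcgau p q 2 isT p0.
rewrite /cgau_moment -mulNr -!cintZl// -cintD//; last exact: cintegrableZl.
rewrite -cintD; [|apply: cintegrableD => //|]; try exact: cintegrableZl.
apply: (@cint_derive0 (fun x => x%:C * cgau p q x) _ p q (nth 0 [:: 0; 1])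
  (nth 0 [:: 1; q; -p])) => //=.
- by move=> x; ring.
- by move=> x; ring.
- move=> x; apply: is_cderive_eq (is_cderiveM (is_cderive_id x) (is_cderive_cgau p q x)) _.
  ring.
Qed.

(** Differentiation under the integral sign. A purely imaginary [p'] keeps the real part of the
    quadratic parameter constant, so one majorant [G] serves all [u] within distance 1 of [t]. *)
Lemma is_cderive_cgau_moment0 (p p' q q' : R[i]) (t : R) : 0 < complex.Re p ->
  complex.Re p' = 0 ->
  is_cderive (fun t => cgau_moment 0 (p + t%:C * p') (q + t%:C * q')) t
   (- 2^-1 * p' * cgau_moment 2 (p + t%:C * p') (q + t%:C * q') +
    q' * cgau_moment 1 (p + t%:C * p') (q + t%:C * q')).
Proof.
move=> p0 p'0.
pose P (t : R) := p + t%:C * p'; pose Q (t : R) := q + t%:C * q'.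
have reP u : complex.Re (P u) = complex.Re p.
  by rewrite /P RecD RecM /= p'0 mulr0 mul0r subr0 addr0.
have P0 u : 0 < complex.Re (P u) by rewrite reP.
pose f u x := x%:C ^+ 0 * cgau (P u) (Q u) x.
pose g u x := (- 2^-1 * p' * x%:C ^+ 2 + q' * x%:C) * cgau (P u) (Q u) x.
have df x u : is_cderive (f ^~ x) u (g u x).
  have := is_cderive_cgau_param p p' q q' x u.
  by rewrite /f; under [X in _ -> is_cderive X _ _]eq_fun do rewrite expr0 mul1r.
have intf u : cintegrable mu (f u) by exact: cintegrable_Xcgau.
pose c := `|complex.Re q| + (`|t| + 1) * `|complex.Re q'|.
pose L := Normc.normc (- 2^-1 * p') + Normc.normc q'.
pose G x := L * (cgau_bound (complex.Re p) c * gau (complex.Re p / 8) 0 x).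
have intG : mu.-integrable setT (EFin \o G).
  apply: RintegrableZl => //; apply: RintegrableZl => //; apply: integrable_gau.
  by rewrite divr_gt0.
have L0 : 0 <= L by rewrite addr_ge0 ?normc_ge0.
have G0 x : 0 <= G x.
  rewrite mulr_ge0// mulr_ge0 ?expR_ge0// mulr_ge0 ?expR_ge0// addr_ge0//.
  by rewrite divr_ge0 ?(ltW p0).
have It u : `]t - 1, t + 1[%classic u -> `|complex.Re (Q u)| <= c.
  rewrite /= in_itv /= => /andP[u1 u2].
  rewrite /Q RecD RecM /= mul0r subr0 (le_trans (ler_normD _ _))// lerD2l.
  rewrite normrM ler_wpM2r// ler_norml; apply/andP; split.
    have := ler_norm (- t); rewrite normrN; lra.
  have := ler_norm t; lra.
have gG u x : `]t - 1, t + 1[%classic u -> Normc.normc (g u x) <= G x.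
  move=> uI; rewrite /g Normc.normcM /G.
  have := @normc_cgau_le (P u) (Q u) x c (P0 u) (It _ uI); rewrite reP => h.
  apply: le_trans (ler_wpM2l L0 h); rewrite [leRHS]mulrA ler_wpM2r ?normc_ge0//.
  apply: (le_trans (normcD _ _)); rewrite mulrDl [X in X + _]Normc.normcM.
  rewrite [X in _ + X]Normc.normcM lerD//.
    by apply: ler_wpM2l; rewrite ?normc_ge0// normc_X_le.
  by apply: ler_wpM2l; rewrite ?normc_ge0// -[x%:C]expr1 normc_X_le.
have tI : `]t - 1, t + 1[%classic t by rewrite /= in_itv /=; apply/andP; split; lra.
have main (h : R[i] -> R) (mh : forall z, `|h z| <= Normc.normc z)
    (dh : forall x (u : R), is_derive u 1 (fun u : R => h (f u x)) (h (g u x)))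
    (ih : forall u : R, mu.-integrable setT (EFin \o (fun x => h (f u x)))) :
    is_derive t 1 (fun u : R => \int[mu]_x h (f u x)) (\int[mu]_x h (g t x)).
  have d1 u x : partial1of2 (fun u x => h (f u x)) u x = h (g u x).
    by rewrite partial1of2E; exact: derive_val.
  have dv x y : `]t - 1, t + 1[%classic x -> [set: R] y ->
      derivable ((fun u x => h (f u x)) ^~ y) x 1.
    by move=> _ _; have [] := dh y x.
  have bd x y : `]t - 1, t + 1[%classic x -> [set: R] y ->
      `|partial1of2 (fun u x => h (f u x)) x y| <= G y.
    by move=> xI _; rewrite d1; exact: le_trans (mh _) (gG _ _ xI).
  have der := @derivable_under_integral R _ _ mu (fun u x => h (f u x)) setT measurableT t
     (t - 1) (t + 1) tI (fun u _ => ih u) dv G G0 intG bd.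
  have val := @differentiation_under_integral R _ _ mu (fun u x => h (f u x)) setT measurableT t
     (t - 1) (t + 1) tI (fun u _ => ih u) dv G G0 intG bd.
  apply: DeriveDef; first exact: der.
  rewrite -derive1E val//; apply: eq_Rintegral => x _; exact: d1.
have -> : - 2^-1 * p' * cgau_moment 2 (P t) (Q t) + q' * cgau_moment 1 (P t) (Q t) =
    cint mu (g t).
  have i1 := @cintegrable_Xcgau (P t) (Q t) 1 isT (P0 t).
  have i2 := @cintegrable_Xcgau (P t) (Q t) 2 isT (P0 t).
  rewrite /cgau_moment -!cintZl// -cintD; [|exact: cintegrableZl..].
  by apply: eq_cint => x; rewrite /g expr1; ring.
split.
  apply: (main (@complex.Re R)) => [z|x u|u]; first exact: ler_Re_normc.
    by have [] := df x u.
  by have [] := intf u.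
apply: (main (@complex.Im R)) => [z|x u|u]; first exact: ler_Im_normc.
  by have [] := df x u.
by have [] := intf u.
Qed.

(* No contour integration: along the segment from [Re p] to [p] (and from [0] to
   [q]) the quotient of the two sides satisfies a linear differential equation,
   because the moments of the Gaussian are tied by integrals of derivatives. *)
Lemma complex_gaussian_integral p : 0 < complex.Re p ->
  exists kap : R[i], kap ^+ 2 * p = 1 /\ forall q, cint mu (cgau p q) = (Num.sqrt (2 * pi))%:C * kap * cexp (q ^+ 2 / (2 * p)).
Proof.
move=> p0.
have pn0 z : 0 < complex.Re z -> z != 0.
  by move=> z0; apply/eqP => zE; move: z0; rewrite zE /= ltxx.
have M0E z q : cgau_moment 0 z q = cint mu (cgau z q).
  by apply: eq_cint => x; rewrite expr0 mul1r.
have n2 : (2 : R[i]) != 0 by rewrite pnatr_eq0.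
pose r := (complex.Re p)%:C; pose s := 0 +i* complex.Im p.
have rs : p = r + s by rewrite /r /s; case: (p) => a b; simpc.
have Rr : 0 < complex.Re r by [].
have ReP u : complex.Re (r + u%:C * s) = complex.Re p.
  by rewrite RecD RecM /= mulr0 mul0r subr0 addr0.
(* The square of the moment avoids a root of the parameter. Writing [P] for the parameter and [Mk]
   for the moments, [M0' = - s M2 / 2] and [P M2 = M0] make the derivative of [M0 ^ 2 P] cancel; at
   [u = 0] the parameter is real. *)
pose D u := cgau_moment 0 (r + u%:C * s) 0 * cgau_moment 0 (r + u%:C * s) 0 * (r + u%:C * s).
have dD u : is_cderive D u 0.
  have P0 : 0 < complex.Re (r + u%:C * s) by rewrite ReP.
  have h := @is_cderive_cgau_moment0 r s 0 0 u Rr (erefl _).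
  have E0 (v : R) : 0 + v%:C * 0 = 0 :> R[i] by rewrite mulr0 addr0.
  have {}h : is_cderive (fun t => cgau_moment 0 (r + t%:C * s) 0) u
      (- 2^-1 * s * cgau_moment 2 (r + u%:C * s) 0).
    move: h; rewrite E0 mul0r addr0.
    by under [X in is_cderive X _ _ -> _]eq_fun do rewrite E0.
  have k : is_cderive (fun t => r + t%:C * s) u s.
    apply: is_cderive_eq (is_cderiveD (is_cderive_cst r u)
      (is_cderiveM (is_cderive_id u) (is_cderive_cst s u))) _.
    by rewrite mulr0 addr0 mul1r add0r.
  apply: is_cderive_eq (is_cderiveM (is_cderiveM h h) k) _.
  have := cgau_moment2 0 P0; rewrite mul0r addr0 => m2.
  have -> : cgau_moment 0 (r + u%:C * s) 0 = (r + u%:C * s) * cgau_moment 2 (r + u%:C * s) 0.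
    by rewrite m2.
  by field.
have D1 : D 1 = D 0 := is_cderive0_cst dD 1 0.
have D0 : D 0 = (2 * pi)%:C.
  rewrite /D mul0r addr0 M0E.
  have -> : cint mu (cgau r 0) = (Num.sqrt (2 * pi / complex.Re p))%:C.
    rewrite /cint.
    have E x : cgau r 0 x = (gau (complex.Re p / 2) 0 x)%:C.
      rewrite /cgau /gau mul0r addr0 subr0 -cexp_real; congr cexp.
      rewrite (_ : (2^-1 : R[i]) = (2^-1)%:C); last by rewrite fmorphV rmorph_nat.
      by rewrite /r -rmorphXn -rmorphN -!rmorphM /=; congr (_ %:C); ring.
    rewrite -/(cint mu (cgau r 0)) (eq_cint mu E); apply: complex_ext => /=.
      rewrite integral_gau ?divr_gt0//; congr (Num.sqrt _).
      by field; rewrite gt_eqF.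
    by rewrite Rintegral_cst// mul0r.
  rewrite -!rmorphM -expr2 sqr_sqrtr ?divr_ge0 ?mulr_ge0 ?pi_ge0 ?(ltW p0)//=.
  by rewrite divfK// gt_eqF.
pose kap := (Num.sqrt (2 * pi))^-1%:C * cgau_moment 0 p 0.
have s2pi : Num.sqrt (2 * pi) != 0 :> R by rewrite gt_eqF// sqrtr_gt0 mulr_gt0 ?pi_gt0.
exists kap; split.
  rewrite /kap exprMn -mulrA.
  have -> : cgau_moment 0 p 0 ^+ 2 * p = (2 * pi)%:C.
    by rewrite -D0 -D1 /D mul1r -rs expr2.
  rewrite -rmorphXn -rmorphM /= exprVn sqr_sqrtr ?mulr_ge0 ?pi_ge0// mulVf//.
  by rewrite gt_eqF// mulr_gt0 ?pi_gt0.
move=> q.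
(* The first moment relation gives the moment the logarithmic derivative [u q ^ 2 / p], which the
   exponential factor cancels. *)
pose H (u : R) := cgau_moment 0 p (u%:C * q) * cexp (- (q ^+ 2 / (2 * p)) * (u%:C * u%:C)).
have dH u : is_cderive H u 0.
  have h := @is_cderive_cgau_moment0 p 0 0 q u p0 (erefl _).
  have {}h : is_cderive (fun t => cgau_moment 0 p (t%:C * q)) u
      (q * cgau_moment 1 p (u%:C * q)).
    move: h; rewrite !mulr0 mul0r !addr0 !add0r.
    by under [X in is_cderive X _ _ -> _]eq_fun do rewrite mulr0 addr0 add0r.
  have k := is_cderive_exp (is_cderiveZ (- (q ^+ 2 / (2 * p)))
     (is_cderiveM (is_cderive_id u) (is_cderive_id u))).
  apply: is_cderive_eq (is_cderiveM h k) _.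
  have -> : cgau_moment 1 p (u%:C * q) = u%:C * q * cgau_moment 0 p (u%:C * q) / p.
    by rewrite -cgau_moment1// mulrAC mulfV ?mul1r// pn0.
  by field; rewrite pn0.
have : H 1 = H 0 := is_cderive0_cst dH 1 0.
have e1 : (1 : R)%:C = 1 :> R[i] by [].
have e0 : (0 : R)%:C = 0 :> R[i] by [].
rewrite /H e1 e0 !mul1r !mul0r !mulr0 mulr1 cexp0 mulr1 cexpN => h.
rewrite -M0E /kap mulrA -rmorphM /= divff// mul1r -h -mulrA mulVf ?mulr1//.
exact: cexp_neq0.
Qed.

End complex_gaussian.

(** * Integrals against the normal law, and translations *)

Section normal_integral.
Context {R : realType}.
Notation mu := (@lebesgue_measure R).
Variables (m s : R).
Local Open Scope ereal_scope.

(** Both functions have the same integral over every measurable set. This turns integrals against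
    the law into Lebesgue integrals with an explicit density. *)
Let ae_normal_density :
  ae_eq mu setT (Radon_Nikodym_SigmaFinite.f (normal_prob m s) mu)
    (fun x => (normal_pdf m s x)%:E).
Proof.
have dom := normal_prob_dominates m s.
apply: integral_ae_eq => //.
- exact: Radon_Nikodym_SigmaFinite.f_integrable.
- by apply/measurable_EFinP; exact: measurable_normal_pdf.
- by move=> A _ mA; rewrite -Radon_Nikodym_SigmaFinite.f_integral.
Qed.

Lemma ge0_integral_normal_prob (f : R -> \bar R) : (forall x, 0 <= f x) ->
  measurable_fun setT f ->
  \int[normal_prob m s]_x f x = \int[mu]_x (f x * (normal_pdf m s x)%:E).
Proof.
move=> f0 mf; have dom := normal_prob_dominates m s.
rewrite -(Radon_Nikodym_SigmaFinite.change_of_variables dom)//.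
apply: ae_eq_integral => //.
- apply: emeasurable_funM => //.
  exact: measurable_int (Radon_Nikodym_SigmaFinite.f_integrable dom).
- apply: emeasurable_funM => //; apply/measurable_EFinP; exact: measurable_normal_pdf.
- exact: ae_eqe_mul2l ae_normal_density.
Qed.

Lemma Rintegral_normal_prob (f : R -> R) : measurable_fun setT f ->
  (normal_prob m s).-integrable setT (EFin \o f) ->
  (\int[normal_prob m s]_x f x = \int[mu]_x (f x * normal_pdf m s x))%R.
Proof.
move=> mf intf; rewrite /Rintegral; congr fine.
have dom := normal_prob_dominates m s.
rewrite [in LHS]integralE [in RHS]integralE.
have mE : measurable_fun setT (EFin \o f) by exact/measurable_EFinP.
rewrite ge0_integral_normal_prob//; last exact: measurable_funepos.
rewrite ge0_integral_normal_prob//; last exact: measurable_funeneg.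
have n0 := normal_pdf_ge0 m s.
congr (_ - _); apply: eq_integral => x _.
  rewrite !funeposE /= -!EFin_max -EFinM; congr EFin.
  by rewrite maxr_pMl// mul0r.
rewrite !funenegE /= -!EFin_max -EFinM; congr EFin.
by rewrite maxr_pMl// mul0r mulNr.
Qed.

End normal_integral.

Section translation.
Context {R : realType}.
Notation mu := (@lebesgue_measure R).

(** The image of Lebesgue measure under a translation gives half-open intervals their length, which
    characterises Lebesgue measure. *)
Lemma lebesgue_measure_translation (c : R) (A : set R) : measurable A ->
  mu ((fun x => x + c) @^-1` A) = mu A.
Proof.
move=> mA; pose f : measurableTypeR R -> measurableTypeR R := fun x => x + c.
have mf : measurable_fun setT f by exact: measurable_funD.
pose M := isMeasurableFun.Build _ _ _ _ f mf.
pose F : {mfun (measurableTypeR R) >-> (measurableTypeR R)} := HB.pack f M.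
have := @lebesgue_measure_unique R (pushforward mu F) _ A mA.
move=> -> // X /ocitvP[->|[[a b] /= ab ->]]; first by rewrite !measure0.
rewrite /pushforward (_ : F @^-1` _ = `]a - c, b - c]%classic).
  by rewrite !lebesgue_measure_itv /= !lte_fin ltrD2r ab -!EFinB; congr EFin; ring.
by apply/seteqP; split=> x /=; rewrite !in_itv /= ltrBlDr lerBrDr.
Qed.

Lemma ge0_integral_translation (c : R) (f : R -> \bar R) : measurable_fun setT f ->
  (forall x, 0 <= f x)%E ->
  (\int[mu]_x f (x + c)%R = \int[mu]_x f x)%E.
Proof.
move=> mf f0; pose g : measurableTypeR R -> measurableTypeR R := fun x => x + c.
have mg : measurable_fun setT g by exact: measurable_funD.
pose M := isMeasurableFun.Build _ _ _ _ g mg.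
pose F : {mfun (measurableTypeR R) >-> (measurableTypeR R)} := HB.pack g M.
transitivity (\int[pushforward mu F]_x f x)%E.
  by rewrite ge0_integral_pushforward.
by apply: eq_measure_integral => A mA _; exact: lebesgue_measure_translation.
Qed.

(** One-dimensional Cameron-Martin formula: the weight taken at [x + c] is the quotient of the
    normal densities at [x] and at [x + c]. *)
Lemma normal_prob_shift (s c : R) (f : R -> \bar R) : s != 0 ->
  measurable_fun setT f -> (forall x, 0 <= f x)%E ->
  (\int[normal_prob 0 s]_x f (x + c)%R =
   \int[normal_prob 0 s]_x (f x * (expR (c / s ^+ 2 * x - c ^+ 2 / (s ^+ 2 *+ 2)))%:E))%E.
Proof.
move=> s0 mf f0.
have mfc : measurable_fun setT (fun x : R => f (x + c)).
  by apply: measurableT_comp mf _; exact: measurable_funD.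
have mw : measurable_fun setT (fun x : R => expR (c / s ^+ 2 * x - c ^+ 2 / (s ^+ 2 *+ 2))).
  apply: measurableT_comp => //; apply: measurable_funB => //; exact: measurable_funM.
rewrite ge0_integral_normal_prob// ge0_integral_normal_prob//; last 2 first.
- by move=> x; rewrite mule_ge0// lee_fin expR_ge0.
- by apply: emeasurable_funM => //; exact/measurable_EFinP.
rewrite -[RHS](ge0_integral_translation c); last 2 first.
- apply: emeasurable_funM; last by apply/measurable_EFinP; exact: measurable_normal_pdf.
  by apply: emeasurable_funM => //; exact/measurable_EFinP.
- by move=> x; rewrite !mule_ge0// lee_fin ?expR_ge0 ?normal_pdf_ge0.
apply: eq_integral => x _; rewrite -muleA -EFinM; congr (_ * _%:E)%E.
rewrite !normal_pdfE// /normal_fun mulrCA -expRD; congr (_ * expR _).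
field; exact: s0.
Qed.

End translation.

(** * Resampling one independent Gaussian increment *)

Section update.
Context {R : realType} (n : nat).

Definition upd (t : n.-tuple R) (j : 'I_n) (x : R) : n.-tuple R :=
  [tuple if i == j then x else tnth t i | i < n].

Lemma tnth_upd t j x i : tnth (upd t j x) i = if i == j then x else tnth t i.
Proof. by rewrite tnth_mktuple. Qed.

(** A generating family stable under intersection, so that laws of vectors need only be compared
    where independence is stated. *)
Definition boxes : set (set (n.-tuple R)) :=
  [set C | exists2 A : 'I_n -> set R, (forall i, measurable (A i)) &
     C = [set t | forall i, A i (tnth t i)]].

Lemma measurable_tupleE : @measurable _ (n.-tuple R) = <<s boxes >>.
Proof.
apply/seteqP; split.
  rewrite [X in X `<=` _](_ : _ = g_sigma_preimage (fun i (x : n.-tuple R) => tnth x i))//.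
  apply: smallest_sub; first exact: smallest_sigma_algebra.
  move=> B; rewrite -bigcup_seq/= => -[j _ [A mA <-]]; rewrite setTI.
  apply: sub_sigma_algebra; exists (fun i => if i == j then A else setT).
    by move=> i; case: ifP.
  apply/seteqP; split => [t /= At i|t /= /(_ j)]; last by rewrite eqxx.
  by case: ifP => // /eqP ->.
apply: smallest_sub; first exact: sigma_algebra_measurable.
move=> _ [A mA ->].
rewrite (_ : [set t | _] = \big[setI/setT]_(i < n) ((@tnth n R ^~ i) @^-1` A i)).
  apply: bigsetI_measurable => i _; rewrite -[X in measurable X]setTI.
  exact: measurable_tnth.
apply/seteqP; split=> t; rewrite -bigcap_seq /=.
  by move=> h i _; exact: h.
by move=> h i; apply: h; rewrite /= mem_index_enum.
Qed.

Lemma measurable_upd d (T : measurableType d) (f : T -> n.-tuple R) (g : T -> R) j :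
  measurable_fun setT f -> measurable_fun setT g ->
  measurable_fun setT (fun x => upd (f x) j (g x)).
Proof.
move=> mf mg; apply/measurable_fun_tnthP => i /=.
rewrite (_ : _ \o _ = fun x => if i == j then g x else tnth (f x) i); last first.
  by apply/funext => x /=; rewrite tnth_upd.
case: (i == j) => //; exact: (measurable_fun_tnthP f).1.
Qed.

End update.

Section resampling.
Context d (T : measurableType d) (R : realType) (P : probability T R) (n : nat).
Variables (X : 'I_n -> T -> R) (nu : probability (measurableTypeR R) R).
Hypothesis mX : forall i, measurable_fun setT (X i).
Hypothesis indepX : mutually_independent P X.
Hypothesis lawX : forall i (A : set R), measurable A -> P (X i @^-1` A) = nu A.

Definition rvec (w : T) : n.-tuple R := [tuple X i w | i < n].

Lemma measurable_rvec : measurable_fun setT rvec.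
Proof.
apply/measurable_fun_tnthP => i; rewrite (_ : _ \o _ = X i)//.
by apply/funext => w /=; rewrite tnth_mktuple.
Qed.

Let resampled (j : 'I_n) (z : T * measurableTypeR R) : n.-tuple R := upd (rvec z.1) j z.2.

Let measurable_resampled j : measurable_fun setT (resampled j).
Proof.
by apply: measurable_upd => //; apply: measurableT_comp measurable_rvec _.
Qed.

(** On a box both sides are the product of the marginal probabilities. Hence a coordinate may be
    drawn afresh and integrated out by Fubini on [P \x nu], without a product measure on tuples. *)
Let law_resampled j (C : set (n.-tuple R)) : measurable C ->
  P (rvec @^-1` C) = (P \x nu)%E (resampled j @^-1` C).
Proof.
move=> mC.
pose M := isMeasurableFun.Build _ _ _ _ rvec measurable_rvec.
pose F : {mfun T >-> n.-tuple R} := HB.pack rvec M.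
pose N := isMeasurableFun.Build _ _ _ _ (resampled j) (measurable_resampled j).
pose G : {mfun (T * measurableTypeR R)%type >-> n.-tuple R} := HB.pack (resampled j) N.
suff: pushforward P F C = pushforward (P \x nu)%E G C by [].
apply: (@measure_unique _ R _ (@boxes R n) (fun=> setT) (@measurable_tupleE R n) _ _ _
  (pushforward P F) (pushforward (P \x nu)%E G)) => //.
- move=> _ _ [A mA ->] [B mB ->]; exists (fun i => A i `&` B i).
    by move=> i; exact: measurableI.
  by apply/seteqP; split=> t /= => [[h1 h2] i|h]; [split|split => i; have [] := h i].
- by move=> _; exists (fun=> setT) => //; apply/seteqP; split.
- by rewrite bigcup_const.
- move=> _ [A mA ->].
  rewrite -[LHS]/(P (rvec @^-1` _)) -[RHS]/((P \x nu)%E (resampled j @^-1` _)).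
  have -> : rvec @^-1` [set t | forall i, A i (tnth t i)] = [set w | forall i, A i (X i w)].
    by apply/seteqP; split => w /= h i; have := h i; rewrite tnth_mktuple.
  rewrite indepX//.
  (* The constraint on coordinate [j] is lifted from the old vector and carried by the fresh
     variable instead. *)
  pose A' i := if i == j then setT else A i.
  have mA' i : measurable (A' i) by rewrite /A'; case: ifP.
  have -> : resampled j @^-1` [set t | forall i, A i (tnth t i)] =
      [set w | forall i, A' i (X i w)] `*` A j.
    apply/seteqP; split => -[w x] /=.
      move=> h; split => [i|]; last by have := h j; rewrite tnth_upd eqxx.
      by have := h i; rewrite tnth_upd /A' tnth_mktuple; case: ifP.
    move=> [h1 h2] i; have := h1 i; rewrite tnth_upd /A' tnth_mktuple.
    by case: eqP => // ->.
  have mB : measurable [set w | forall i, A' i (X i w)].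
    rewrite (_ : [set w | _] = \big[setI/setT]_(i < n) (X i @^-1` A' i)).
      apply: bigsetI_measurable => i _; rewrite -[X in measurable X]setTI.
      exact: mX.
    apply/seteqP; split=> t; rewrite -bigcap_seq /=.
      by move=> h i _; exact: h.
    by move=> h i; apply: h; rewrite /= mem_index_enum.
  rewrite (product_measure1E P nu mB (mA j)).
  rewrite [X in (X * _)%E](indepX mA') [in LHS](bigD1 j)//= [in RHS](bigD1 j)//=.
  rewrite {1}/A' eqxx preimage_setT probability_setT mul1e muleC lawX//; congr (_ * _)%E.
  by apply: eq_bigr => i ij; rewrite /A' (negbTE ij).
- move=> _; rewrite -[X in (X < _)%E]/(P (rvec @^-1` _)) preimage_setT; apply: le_lt_trans (ltry 1).
  exact: probability_le1.
Qed.

Lemma ge0_integral_resample j (f : n.-tuple R -> \bar R) :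
  measurable_fun setT f -> (forall t, 0 <= f t)%E ->
  (\int[P]_w f (rvec w) = \int[P]_w \int[nu]_x f (upd (rvec w) j x))%E.
Proof.
move=> mf f0.
pose M := isMeasurableFun.Build _ _ _ _ rvec measurable_rvec.
pose F : {mfun T >-> n.-tuple R} := HB.pack rvec M.
pose N := isMeasurableFun.Build _ _ _ _ (resampled j) (measurable_resampled j).
pose G : {mfun (T * measurableTypeR R)%type >-> n.-tuple R} := HB.pack (resampled j) N.
transitivity (\int[pushforward P F]_t f t)%E; first by rewrite ge0_integral_pushforward.
transitivity (\int[pushforward (P \x nu) G]_t f t)%E.
  by apply: eq_measure_integral => A mA _; exact: law_resampled.
rewrite ge0_integral_pushforward//= fubini_tonelli1//.
by apply: measurableT_comp mf _; exact: measurable_resampled.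
Qed.

Lemma Rintegral_resample j (f : n.-tuple R -> R) (K : R) :
  measurable_fun setT f -> (forall t, `|f t| <= K) ->
  \int[P]_w f (rvec w) = \int[P]_w \int[nu]_x f (upd (rvec w) j x).
Proof.
move=> mf fK.
have mE : measurable_fun setT (EFin \o f) by exact/measurable_EFinP.
have bint d' (T' : measurableType d') (Q : {finite_measure set T' -> \bar R}) (g : T' -> R) :
    measurable_fun setT g -> (forall x, `|g x| <= K) -> Q.-integrable setT (EFin \o g).
  move=> mg gK; apply: (@integrable_dominated _ _ _ _ _ _ (fun=> K)) => //.
  exact: finite_measure_integrable_cst.
have mr := measurable_rvec.
pose M := isMeasurableFun.Build _ _ _ _ rvec measurable_rvec.
pose F : {mfun T >-> n.-tuple R} := HB.pack rvec M.
pose N := isMeasurableFun.Build _ _ _ _ (resampled j) (measurable_resampled j).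
pose G : {mfun (T * measurableTypeR R)%type >-> n.-tuple R} := HB.pack (resampled j) N.
have mfG : measurable_fun setT (f \o resampled j).
  by apply: measurableT_comp mf _; exact: measurable_resampled.
transitivity (fine (\int[pushforward P F]_t (f t)%:E)%E).
  rewrite integral_pushforward//; apply: bint => //.
  exact: measurableT_comp mf _.
transitivity (fine (\int[pushforward (P \x nu) G]_t (f t)%:E)%E).
  by congr fine; apply: eq_measure_integral => A mA _; exact: law_resampled.
have iG : (P \x nu)%E.-integrable setT (EFin \o (f \o resampled j)).
  apply: (@integrable_dominated _ _ _ _ _ _ (fun=> K)) => //.
    by move=> z _; exact: fK.
  apply/integrableP; split; first exact: measurable_cst.
  rewrite (eq_integral (cst `|K|%:E))// integral_cst//= -setXTT product_measure1E//.
  have -> : (P setT * nu setT = 1)%E by rewrite [X in (X * _)%E](@probability_setT _ _ _ P) [X in (_ * X)%E](@probability_setT _ _ _ nu) mule1.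
  by rewrite mule1 ltry.
rewrite integral_pushforward//=.
rewrite [X in fine X](_ : _ = \int[P \x nu]_z (EFin \o (f \o resampled j)) z)%E//.
rewrite -integral12_prod_meas1//; congr fine; apply: eq_integral => w _.
rewrite fineK//; apply: integrable_fin_num => //.
apply: bint => [|x]; last exact: fK.
apply: measurableT_comp mf _; apply: measurable_upd => //.
Qed.

Lemma cint_resample j (f : n.-tuple R -> R[i]) (K : R) :
  cmeasurable f -> (forall t, Normc.normc (f t) <= K) ->
  cint P (fun w => f (rvec w)) =
  cint P (fun w => cint nu (fun x => f (upd (rvec w) j x))).
Proof.
move=> [mr mi] fK; apply: complex_ext => /=.
  apply: (Rintegral_resample j (K := K) mr) => t.
  exact: le_trans (ler_Re_normc _) (fK t).
apply: (Rintegral_resample j (K := K) mi) => t.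
exact: le_trans (ler_Im_normc _) (fK t).
Qed.

End resampling.

Section bounded_integrals.
Context d (T : measurableType d) (R : realType).

Lemma integrable_bounded (Q : {finite_measure set T -> \bar R}) (f : T -> R) (K : R) :
  measurable_fun setT f -> (forall x, `|f x| <= K) -> Q.-integrable setT (EFin \o f).
Proof.
move=> mf fK; apply: (@integrable_dominated _ _ _ _ _ _ (fun=> K)) => //.
exact: finite_measure_integrable_cst.
Qed.

Lemma cintegrable_bounded (Q : {finite_measure set T -> \bar R}) (f : T -> R[i]) (K : R) :
  cmeasurable f -> (forall x, Normc.normc (f x) <= K) -> cintegrable Q f.
Proof.
move=> mf fK; apply: (cintegrable_dominated mf fK).
exact: finite_measure_integrable_cst.
Qed.

Lemma cint_cst (Q : probability T R) (c : R[i]) : cint Q (fun=> c) = c.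
Proof.
apply: complex_ext => /=; rewrite Rintegral_cst//.
  by rewrite [X in fine X](@probability_setT _ _ _ Q) mulr1.
by rewrite [X in fine X](@probability_setT _ _ _ Q) mulr1.
Qed.

End bounded_integrals.

Lemma Rintegral_translation (R : realType) (c : R) (f : R -> R) :
  measurable_fun setT f ->
  \int[lebesgue_measure]_x f (x + c) = \int[lebesgue_measure]_x f x.
Proof.
move=> mf; rewrite /Rintegral; congr fine; rewrite [in LHS]integralE [in RHS]integralE.
have mE : measurable_fun setT (EFin \o f) by exact/measurable_EFinP.
congr (_ - _)%E.
  rewrite -[RHS](ge0_integral_translation c)//; last exact: measurable_funepos.
  by apply: eq_integral => x _; rewrite !funeposE.
rewrite -[RHS](ge0_integral_translation c)//; last exact: measurable_funeneg.
by apply: eq_integral => x _; rewrite !funenegE.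
Qed.

Lemma cint_translation (R : realType) (c : R) (f : R -> R[i]) : cmeasurable f ->
  cint lebesgue_measure (fun x => f (x + c)) = cint lebesgue_measure f.
Proof.
move=> [mr mi]; apply: complex_ext => /=.
  exact: (Rintegral_translation c mr).
exact: (Rintegral_translation c mi).
Qed.

Lemma cint_normal_prob (R : realType) (s : R) (f : R -> R[i]) (K : R) :
  cmeasurable f -> (forall x, Normc.normc (f x) <= K) ->
  cint (normal_prob 0 s) f =
  cint lebesgue_measure (fun x => (normal_pdf 0 s x)%:C * f x).
Proof.
move=> [mr mi] fK; have h (g : R -> R) : measurable_fun setT g ->
    (forall x, `|g x| <= K) -> \int[normal_prob 0 s]_x g x =
    \int[lebesgue_measure]_x (g x * normal_pdf 0 s x).
  by move=> mg gK; apply: Rintegral_normal_prob => //; exact: (@integrable_bounded _ _ R (normal_prob 0 s) g K).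
apply: complex_ext => /=; rewrite h//.
- by apply: eq_Rintegral => x _; rewrite RecM /= mul0r subr0 mulrC.
- by move=> x; exact: le_trans (ler_Re_normc _) (fK x).
- by apply: eq_Rintegral => x _; rewrite ImcM /= mul0r addr0 mulrC.
- by move=> x; exact: le_trans (ler_Im_normc _) (fK x).
Qed.

Section partial_sums.
Context {R : realType} (N : nat).
Implicit Types t : N.-tuple R.

Definition psum (k : nat) t : R := \sum_(i < N | (i < k)%N) tnth t i.

Lemma psum0 t : psum 0 t = 0.
Proof. by rewrite /psum big_pred0. Qed.

(** Thanks to this, factors at earlier times leave the inner integral when an increment is
    resampled. *)
Lemma psum_upd_le k t (j : 'I_N) x : (k <= j)%N -> psum k (upd t j x) = psum k t.
Proof.
move=> kj; apply: eq_bigr => i ik; rewrite tnth_upd; case: eqP => // ij.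
by move: ik; rewrite ij ltnNge kj.
Qed.

Lemma psumS t (j : 'I_N) : psum j.+1 t = psum j t + tnth t j.
Proof.
rewrite /psum (bigD1 j) ?ltnSn//= addrC; congr (_ + _); apply: eq_bigl => i.
by rewrite ltnS andbC -ltn_neqAle.
Qed.

Lemma psumS_upd t (j : 'I_N) x : psum j.+1 (upd t j x) = psum j t + x.
Proof. by rewrite psumS psum_upd_le// tnth_upd eqxx. Qed.

Lemma measurable_psum k : measurable_fun setT (psum k).
Proof.
rewrite /psum; under eq_fun do rewrite big_mkcond /=.
apply: measurable_sum => i; case: (i < k)%N => //; exact: measurable_tnth.
Qed.

End partial_sums.

Lemma Re_inv_gt0 (R : realType) (z : R[i]) : 0 < complex.Re z -> 0 < complex.Re z^-1.
Proof.
case: z => a b /= a0; rewrite divr_gt0// ltr_pwDl ?sqr_ge0// exprn_gt0//.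
Qed.

Lemma Re_gt0_neq0 (R : realType) (z : R[i]) : 0 < complex.Re z -> z != 0.
Proof. by move=> z0; apply/eqP => zE; move: z0; rewrite zE /= ltxx. Qed.

Lemma normc_prod_le1 (R : realType) (I : Type) (r : seq I) (Q : pred I) (F : I -> R[i]) :
  (forall i, Normc.normc (F i) <= 1) -> Normc.normc (\prod_(i <- r | Q i) F i) <= 1.
Proof.
move=> F1; apply: (big_ind (fun z => Normc.normc z <= 1)) => //.
  by rewrite Normc.normc1.
by move=> x y x1 y1; rewrite Normc.normcM mulr_ile1 ?normc_ge0.
Qed.

(** * Laplace transform of the discretised bridge *)

Section discrete_bridge.
Context d (T : measurableType d) (R : realType) (P : probability T R) (n : nat).
Let h : R := n.+1%:R^-1.
Variables (X : 'I_n.+1 -> T -> R).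
Hypothesis mX : forall i, measurable_fun setT (X i).
Hypothesis indepX : mutually_independent P X.
Hypothesis lawX : forall i (A : set R), measurable A ->
  P (X i @^-1` A) = normal_prob 0 (Num.sqrt h) A.
Variables (s : R[i]) (w : nat -> R) (dd : nat -> R[i]).
Hypothesis s0 : 0 <= complex.Re s.
Hypothesis w0 : forall k, 0 <= w k.
Hypothesis dN : dd n.+1 = 0.
Hypothesis dn : dd n = h%:C.
Hypothesis dS : forall k, (k < n)%N ->
  dd k = (2 + 2 * s * (h ^+ 2 * w k.+1)%:C) * dd k.+1 - dd k.+2.

Let h0 : 0 < h. Proof. by rewrite invr_gt0 ltr0n. Qed.
Let hC0 : h%:C != 0 :> R[i].
Proof. by rewrite (fmorph_eq0 (real_complex R)) gt_eqF. Qed.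

Definition grid (k : nat) : R := k%:R * h.
Notation l := grid.

Definition bridge_factor (k : nat) (y x : R) : R[i] :=
  cexp (- s * (h * w k * (x - l k * y) ^+ 2)%:C).
Notation f := bridge_factor.

(** For [c = 1 / (1 - l k)] this is, up to normalisation, the Gaussian density of reaching [y] at
    time 1 from [x] at time [l k], in the bridge coordinate [x - l k * y]. The weight [s] will only
    modify [c]. *)
Definition bridge_gauss (c : R[i]) (k : nat) (y x : R) : R[i] :=
  cexp (- 2^-1 * c * (x - l k * y)%:C ^+ 2 +
        ((x - l k * y) * y - (1 - l k) * y ^+ 2 / 2)%:C).
Notation G := bridge_gauss.

(** A discrete logarithmic derivative of [dd], plus the weight at step [k]: the substitution that
    linearises a Riccati recursion. For [s = 0] one has [dd k = 1 - l k], and the value is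
    [1 / (1 - l k)]. *)
Definition bridge_coef (k : nat) : R[i] :=
  (1 - dd k.+1 / dd k) / h%:C + 2 * s * (h * w k)%:C.
Notation cc := bridge_coef.

Lemma gridS k : l k.+1 = l k + h.
Proof. by rewrite /grid -natr1 mulrDl mul1r. Qed.

Lemma grid_max : l n = 1 - h.
Proof.
have : l n.+1 = 1 by rewrite /grid /h divff// pnatr_eq0.
by rewrite gridS => <-; rewrite addrK.
Qed.

(** Backward induction. The first summand of [cc k] is the inverse of [(cc k.+1)^-1 + h], and
    inversion preserves the open right half-plane, which adding the weight does not leave. This
    makes every Gaussian integral converge. *)
Lemma bridge_coef_gt0 k : (k <= n)%N -> dd k != 0 /\ 0 < complex.Re (cc k).
Proof.
have hw j : 0 <= complex.Re (2 * s * (h * w j)%:C).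
  rewrite RecM /= mulr0 subr0 mulr_ge0 ?mulr_ge0 ?(ltW h0)//.
  rewrite (_ : (2 : R[i]) = (2 : R)%:C); last by rewrite rmorph_nat.
  by rewrite RecM /= mul0r subr0 mulr_ge0.
suff H j : forall k, (k + j = n)%N -> dd k != 0 /\ 0 < complex.Re (cc k).
  by move=> kn; apply: (H (n - k)%N); rewrite subnKC.
elim: j {k} => [|j IH] k; rewrite ?addn0.
  move=> ->; split; first by rewrite dn.
  rewrite /bridge_coef dN mul0r subr0 div1r RecD ltr_pwDl//.
  by rewrite Re_inv_gt0.
rewrite -addSnnS => kn; have [d1 c1] := IH _ kn.
have kn' : (k < n)%N by rewrite -kn leq_addr.
have E : dd k = dd k.+1 * (1 + h%:C * cc k.+1).
  rewrite dS// /bridge_coef rmorphM rmorphXn /= [(h * w k.+1)%:C]rmorphM /=.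
  by field; rewrite d1 hC0.
have hc : 0 < complex.Re (1 + h%:C * cc k.+1).
  by rewrite RecD RecM /= mul0r subr0 ltr_pwDl// mulr_ge0 ?(ltW h0) ?(ltW c1).
have hc0 := Re_gt0_neq0 hc; have c10 := Re_gt0_neq0 c1.
split; first by rewrite E mulf_neq0.
rewrite /bridge_coef RecD ltr_pwDl//.
have -> : (1 - dd k.+1 / dd k) / h%:C = ((cc k.+1)^-1 + h%:C)^-1.
  by rewrite E; field; rewrite hC0 hc0 d1 c10.
by rewrite Re_inv_gt0// RecD addr_gt0 ?Re_inv_gt0.
Qed.

Lemma bridge_coefS k : (k < n)%N ->
  dd k = dd k.+1 * (1 + h%:C * cc k.+1) /\
  cc k = cc k.+1 / (1 + h%:C * cc k.+1) + 2 * s * (h * w k)%:C.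
Proof.
move=> kn; have [d1 c1] := bridge_coef_gt0 kn.
have E : dd k = dd k.+1 * (1 + h%:C * cc k.+1).
  rewrite dS// /bridge_coef rmorphM rmorphXn /= [(h * w k.+1)%:C]rmorphM /=.
  by field; rewrite d1 hC0.
have hc : 0 < complex.Re (1 + h%:C * cc k.+1).
  by rewrite RecD RecM /= mul0r subr0 ltr_pwDl// mulr_ge0 ?(ltW h0) ?(ltW c1).
have hc0 := Re_gt0_neq0 hc.
split => //; rewrite {1}/bridge_coef E; congr (_ + _).
by field; rewrite hC0 hc0 d1.
Qed.

Lemma normc_bridge_factor k y x : Normc.normc (f k y x) <= 1.
Proof.
rewrite normc_cexp RecM RecN /= mulr0 subr0 -expR0 ler_expR mulNr oppr_le0.
by rewrite mulr_ge0// mulr_ge0 ?sqr_ge0// mulr_ge0 ?(ltW h0).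
Qed.

Lemma normc_bridge_gauss (c : R[i]) k y : 0 < complex.Re c ->
  exists K, forall x, Normc.normc (G c k y x) <= K.
Proof.
move=> c0; exists (expR (y ^+ 2 / (2 * complex.Re c) - (1 - l k) * y ^+ 2 / 2)) => x.
rewrite normc_cexp ler_expR RecD [X in _ + X]/= addrA lerD2r.
set b := x - l k * y.
have -> : complex.Re (- 2^-1 * c * b%:C ^+ 2) = - 2^-1 * complex.Re c * b ^+ 2.
  have -> : (2^-1 : R[i]) = (2^-1 : R)%:C by rewrite fmorphV rmorph_nat.
  rewrite -rmorphXn -rmorphN RecM /= mulr0 subr0 RecM /= mul0r subr0.
  by [].
rewrite -subr_ge0.
have -> : y ^+ 2 / (2 * complex.Re c) - (- 2^-1 * complex.Re c * b ^+ 2 + b * y) =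
   (y - complex.Re c * b) ^+ 2 / (2 * complex.Re c) by field; rewrite gt_eqF.
by rewrite divr_ge0 ?sqr_ge0// mulr_ge0// ltW.
Qed.

Lemma cmeasurable_bridge_gauss c k y d' (T' : measurableType d') (g : T' -> R) :
  measurable_fun setT g -> cmeasurable (fun t => G c k y (g t)).
Proof.
move=> mg; apply: cmeasurable_exp; apply: cmeasurableD.
  apply: cmeasurableM; first exact: cmeasurable_cst.
  apply: cmeasurableM; first by apply: cmeasurable_real; exact: measurable_funB.
  by apply: cmeasurable_real; exact: measurable_funB.
apply: cmeasurable_real; apply: measurable_funB => //.
by apply: measurable_funM => //; exact: measurable_funB.
Qed.

(** Completing the square in an increment of variance [h] keeps the Gaussian shape: [c^-1] grows by
    [h], and the constant produced is known through its square. *)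
Lemma bridge_gauss_step c k : 0 < complex.Re c ->
  exists kap : R[i], kap ^+ 2 * (1 + h%:C * c) = 1 /\
    forall y x, cint (normal_prob 0 (Num.sqrt h)) (fun z => G c k.+1 y (x + z)) =
      kap * G (c / (1 + h%:C * c)) k y x.
Proof.
move=> c0; have p0 : 0 < complex.Re (c + h^-1%:C).
  by rewrite RecD addr_gt0//= invr_gt0.
have [kap [kapE H]] := complex_gaussian_integral p0.
have hc0 : 1 + h%:C * c != 0.
  by apply: Re_gt0_neq0; rewrite RecD RecM /= mul0r subr0 ltr_pwDl// mulr_ge0// ltW.
have pn0 := Re_gt0_neq0 p0.
have hV : h^-1%:C = (h%:C)^-1 :> R[i] by rewrite fmorphV.
have sh0 : Num.sqrt h != 0 by rewrite gt_eqF// sqrtr_gt0.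
exists (kap * (Num.sqrt h)^-1%:C); split.
  rewrite exprMn -rmorphXn /= exprVn sqr_sqrtr ?(ltW h0)// -[RHS]kapE hV.
  by field; rewrite hC0.
move=> y x; have [K hK] := normc_bridge_gauss k.+1 y c0.
rewrite (@cint_normal_prob _ _ _ K); last 2 first.
- by apply: cmeasurable_bridge_gauss; exact: measurable_funD.
- by move=> z; exact: hK.
set b := x - l k * y.
pose q : R[i] := y%:C - c * (b - h * y)%:C.
pose A : R[i] := (normal_peak (Num.sqrt h))%:C *
  cexp (- 2^-1 * c * (b - h * y)%:C ^+ 2 +
        ((b - h * y) * y - (1 - l k - h) * y ^+ 2 / 2)%:C).
have E z : (normal_pdf 0 (Num.sqrt h) z)%:C * G c k.+1 y (x + z) =
    A * cgau (c + h^-1%:C) q z.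
  rewrite normal_pdfE//= /A /bridge_gauss /cgau gridS rmorphM -!mulrA; congr (_ * _).
  rewrite /normal_fun /= -[(expR _)%:C]cexp_real -!cexpD; congr cexp.
  rewrite subr0 sqr_sqrtr ?(ltW h0)// /q.
  rewrite (_ : x + z - (l k + h) * y = (b - h * y) + z); last by rewrite /b; ring.
  rewrite (_ : - z ^+ 2 / (h *+ 2) = - 2^-1 * h^-1 * z ^+ 2); last by field; rewrite gt_eqF.
  rewrite !(rmorphD, rmorphB, rmorphM, rmorphN, rmorphXn) /=.
  rewrite (_ : (2^-1)%:C = (2^-1 : R[i])); last by rewrite fmorphV rmorph_nat.
  by rewrite rmorph1; field.
rewrite (eq_cint lebesgue_measure E) cintZl; last first.
  have := @cintegrable_Xcgau _ (c + h^-1%:C) q 0 isT p0.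
  rewrite (_ : (fun x => x%:C ^+ 0 * _) = cgau (c + h^-1%:C) q)//.
  by apply/funext => z; rewrite expr0 mul1r.
rewrite H /A /bridge_gauss -/b.
have -> : (normal_peak (Num.sqrt h))%:C = (Num.sqrt h)^-1%:C * (Num.sqrt (2 * pi))^-1%:C :> R[i].
  rewrite -rmorphM /=; congr (_%:C); rewrite /normal_peak sqr_sqrtr ?(ltW h0)//.
  by rewrite -invfM -sqrtrM ?(ltW h0)// mulrA [h * 2]mulrC mulr_natl mulrnAl.
have s2pi : (Num.sqrt (2 * pi))%:C != 0 :> R[i].
  by rewrite (fmorph_eq0 (real_complex R)) gt_eqF// sqrtr_gt0 mulr_gt0 ?pi_gt0.
set e1 := cexp _; set e2 := cexp _; set e3 := cexp _.
have -> : e3 = e1 * e2.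
  rewrite /e1 /e2 /e3 -cexpD; congr cexp; rewrite /q hV.
  rewrite !(rmorphD, rmorphB, rmorphM, rmorphN, rmorphXn) /=.
  rewrite (_ : (2^-1)%:C = (2^-1 : R[i])); last by rewrite fmorphV rmorph_nat.
  rewrite rmorph1; field.
  by apply/andP; split; [exact: hC0|rewrite addrC mulrC; exact: hc0].
have E2 : (Num.sqrt (2 * pi))^-1%:C * (Num.sqrt (2 * pi))%:C = 1 :> R[i].
  by rewrite fmorphV mulVf.
set u := (Num.sqrt h)^-1%:C; set v := (Num.sqrt (2 * pi))^-1%:C.
set u' := (Num.sqrt (2 * pi))%:C.
have -> : u * v * e1 * (u' * kap * e2) = (v * u') * (kap * u * (e1 * e2)) by ring.
by rewrite E2 mul1r.
Qed.

Lemma cmeasurable_bridge_factor k y d' (T' : measurableType d') (g : T' -> R) :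
  measurable_fun setT g -> cmeasurable (fun t => f k y (g t)).
Proof.
move=> mg; apply: cmeasurable_exp; apply: cmeasurableM; first exact: cmeasurable_cst.
apply: cmeasurable_real; apply: measurable_funM => //; apply: measurable_funX.
exact: measurable_funB.
Qed.

(* Integrated over [y], the last factor disintegrates the law of the walk with
   respect to its endpoint [psum n.+1 t = y]. *)
Definition pinned (y : R) (t : n.+1.-tuple R) : R[i] :=
  \prod_(i < n.+1) f i y (psum i t) * (normal_pdf 0 (Num.sqrt h) (y - psum n t))%:C.

(** Start of the backward recursion: as [dd n.+1 = 0], the coefficient [cc n] is [h^-1] plus the
    weight, and [h^-1] comes from the density of the last increment. *)
Lemma pinned_last y x : f n y x * (normal_pdf 0 (Num.sqrt h) (y - x))%:C =
  (normal_peak (Num.sqrt h))%:C * G (cc n) n y x.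
Proof.
have sh0 : Num.sqrt h != 0 by rewrite gt_eqF// sqrtr_gt0.
rewrite normal_pdfE//= rmorphM mulrCA; congr (_ * _).
rewrite /normal_fun /= -[(expR _)%:C]cexp_real -cexpD; congr cexp.
rewrite subr0 sqr_sqrtr ?(ltW h0)// /bridge_coef dN mul0r subr0.
rewrite (_ : - (y - x) ^+ 2 / (h *+ 2) = - 2^-1 * h^-1 * (y - x) ^+ 2); last by field; rewrite gt_eqF.
have -> : y - x = h * y - (x - l n * y) by rewrite grid_max; ring.
rewrite grid_max; set b := x - _.
rewrite !(rmorphD, rmorphB, rmorphM, rmorphN, rmorphXn, rmorph1) /=.
rewrite (_ : (2^-1)%:C = (2^-1 : R[i])); last by rewrite fmorphV rmorph_nat.
rewrite [h^-1%:C]fmorphV; field; exact: hC0.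
Qed.

(* Integrating out the increments one by one, from the last, keeps a Gaussian
   factor whose parameter follows the Riccati form of the recursion on [dd]. *)
Lemma pinned_expectation k : (k <= n)%N ->
  exists C : R[i], C ^+ 2 * dd k = ((2 * pi)^-1)%:C /\
   forall y, cint P (fun v => pinned y (rvec X v)) =
     cint P (fun v => \prod_(i < k) f i y (psum i (rvec X v)) *
                      (C * G (cc k) k y (psum k (rvec X v)))).
Proof.
suff H j : forall k, (k + j = n)%N ->
  exists C : R[i], C ^+ 2 * dd k = ((2 * pi)^-1)%:C /\
   forall y, cint P (fun v => pinned y (rvec X v)) =
     cint P (fun v => \prod_(i < k) f i y (psum i (rvec X v)) *
                      (C * G (cc k) k y (psum k (rvec X v)))).
  by move=> kn; apply: (H (n - k)%N); rewrite subnKC.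
elim: j {k} => [|j IH] k; rewrite ?addn0.
  move=> ->; exists (normal_peak (Num.sqrt h))%:C; split.
    rewrite dn -rmorphXn -rmorphM /=; congr (_%:C).
    rewrite /normal_peak exprVn sqr_sqrtr ?sqr_sqrtr ?(ltW h0)//; last first.
      by rewrite mulrn_wge0// mulr_ge0 ?pi_ge0 ?(ltW h0).
    have := pi_gt0 R; move: (pi : R) => p p0.
    by field; rewrite !gt_eqF.
  move=> y; apply: eq_cint => v; rewrite /pinned big_ord_recr /= -mulrA.
  by rewrite pinned_last.
rewrite -addSnnS => kn; have [C [CE CH]] := IH _ kn.
have kn' : (k < n)%N by rewrite -kn leq_addr.
have [dE ccE] := bridge_coefS kn'.
have [dk1 ck1] := bridge_coef_gt0 kn'.
have [kap [kapE kapH]] := bridge_gauss_step k ck1.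
have kN : (k < n.+1)%N by rewrite ltnS ltnW.
pose jk : 'I_n.+1 := Ordinal kN.
(* The factor [1 + h * cc k.+1] relating [dd k] to [dd k.+1] cancels [kap ^+ 2], so [C ^+ 2 * dd k]
   is invariant along the recursion. *)
exists (C * kap); split.
  rewrite -CE dE; set q := 1 + _ in kapE *.
  rewrite (_ : _ * _ = C ^+ 2 * dd k.+1 * (kap ^+ 2 * q)); last by ring.
  by rewrite kapE mulr1.
move=> y; rewrite CH.
have [K hK] := normc_bridge_gauss k.+1 y ck1.
pose Phi (t : n.+1.-tuple R) := \prod_(i < k.+1) f i y (psum i t) *
  (C * G (cc k.+1) k.+1 y (psum k.+1 t)).
have mPhi : cmeasurable Phi.
  apply: cmeasurableM.
    by apply: cmeasurable_prod => i; apply: cmeasurable_bridge_factor; exact: measurable_psum.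
  apply: cmeasurableM; first exact: cmeasurable_cst.
  by apply: cmeasurable_bridge_gauss; exact: measurable_psum.
have bPhi t : Normc.normc (Phi t) <= Normc.normc C * K.
  rewrite Normc.normcM Normc.normcM -[leRHS]mul1r.
  rewrite ler_pM ?mulr_ge0 ?normc_ge0//.
    by apply: normc_prod_le1 => i; exact: normc_bridge_factor.
  by rewrite ler_wpM2l ?normc_ge0.
rewrite -[LHS]/(cint P (fun v => Phi (rvec X v))).
rewrite (@cint_resample d T R P n.+1 X (normal_prob 0 (Num.sqrt h)) mX indepX lawX jk Phi _ mPhi bPhi).
apply: eq_cint => v.
set t := rvec X v.
have E x : Phi (upd t jk x) = (\prod_(i < k.+1) f i y (psum i t) * C) *
   G (cc k.+1) k.+1 y (psum k t + x).
  rewrite /Phi mulrA; congr (_ * _ * _).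
    by apply: eq_bigr => i _; rewrite psum_upd_le//= -ltnS.
  by rewrite (psumS_upd t jk).
rewrite (eq_cint (normal_prob 0 (Num.sqrt h)) E) cintZl; last first.
  apply: (@cintegrable_bounded _ _ _ _ _ K) => //.
  by apply: cmeasurable_bridge_gauss; exact: measurable_funD.
rewrite kapH big_ord_recr /= ccE /bridge_gauss /bridge_factor.
set b := psum k t - _.
set A := \prod_(_ < _) _.
have -> : cexp (- 2^-1 * (cc k.+1 / (1 + h%:C * cc k.+1) + 2 * s * (h * w k)%:C) *
    b%:C ^+ 2 + (b * y - (1 - l k) * y ^+ 2 / 2)%:C) =
   cexp (- s * (h * w k * b ^+ 2)%:C) *
   cexp (- 2^-1 * (cc k.+1 / (1 + h%:C * cc k.+1)) * b%:C ^+ 2 +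
     (b * y - (1 - l k) * y ^+ 2 / 2)%:C).
  rewrite -cexpD; congr cexp.
  set z := (b * y - _)%:C; set c := cc k.+1 / _.
  rewrite [(h * w k * b ^+ 2)%:C]rmorphM rmorphXn /=.
  by field.
by rewrite -!mulrA; congr (_ * _); rewrite !mulrA; congr (_ * _); ring.
Qed.

Definition bridge_quad (t : n.+1.-tuple R) : R :=
  h * \sum_(k < n.+1) w k * (psum k t - l k * psum n.+1 t) ^+ 2.

Lemma measurable_bridge_quad : measurable_fun setT bridge_quad.
Proof.
apply: measurable_funM => //; apply: measurable_sum => k; apply: measurable_funM => //.
apply: measurable_funX; apply: measurable_funB; first exact: measurable_psum.
apply: measurable_funM => //; exact: measurable_psum.
Qed.

Lemma bridge_quad_ge0 t : 0 <= bridge_quad t.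
Proof. by rewrite mulr_ge0 ?(ltW h0)// sumr_ge0// => k _; rewrite mulr_ge0 ?sqr_ge0. Qed.

Lemma cexp_bridge_quad t :
  cexp (- s * (bridge_quad t)%:C) = \prod_(i < n.+1) f i (psum n.+1 t) (psum i t).
Proof.
rewrite /bridge_factor -cexp_sum; congr cexp.
rewrite /bridge_quad mulr_sumr rmorph_sum mulr_sumr; apply: eq_bigr => i _.
by congr (_ * _%:C); rewrite mulrA.
Qed.

(** Fubini applies because the modulus is at most the normal density at [y - psum n], whose integral
    over [y] is 1 for every outcome. *)
Lemma pinned_swap :
  cint P (fun v => cint lebesgue_measure (fun y => pinned y (rvec X v))) =
  cint lebesgue_measure (fun y => cint P (fun v => pinned y (rvec X v))).
Proof.
have mr : measurable_fun setT (rvec X) by exact: measurable_rvec.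
have mz k : measurable_fun setT (fun z : T * measurableTypeR R => psum k (rvec X z.1)).
  apply: (measurableT_comp (@measurable_psum R n.+1 k)); exact: measurableT_comp.
have mp : cmeasurable (fun z : T * measurableTypeR R => pinned z.2 (rvec X z.1)).
  apply: cmeasurableM.
    apply: cmeasurable_prod => i; apply: cmeasurable_exp.
    apply: cmeasurableM; first exact: cmeasurable_cst.
    apply: cmeasurable_real; apply: measurable_funM => //; apply: measurable_funX.
    by apply: measurable_funB => //; apply: measurable_funM.
  apply: cmeasurable_real; apply: (measurableT_comp (measurable_normal_pdf _ _)).
  exact: measurable_funB.
pose g (z : T * measurableTypeR R) : R := normal_pdf 0 (Num.sqrt h) (z.2 - psum n (rvec X z.1)).
have mg : measurable_fun setT g.
  apply: (measurableT_comp (measurable_normal_pdf _ _)); exact: measurable_funB.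
have bp z : Normc.normc (pinned z.2 (rvec X z.1)) <= g z.
  rewrite Normc.normcM normc_real (ger0_norm (normal_pdf_ge0 _ _ _)) ler_piMl ?normal_pdf_ge0//.
  by apply: normc_prod_le1 => i; exact: normc_bridge_factor.
have ig : (P \x lebesgue_measure)%E.-integrable setT (EFin \o g).
  apply/integrableP; split; first exact/measurable_EFinP.
  rewrite (eq_integral (EFin \o g)); last first.
    by move=> z _ /=; rewrite ger0_norm ?normal_pdf_ge0.
  rewrite fubini_tonelli1//; last 2 first.
  - exact/measurable_EFinP.
  - by move=> z; rewrite lee_fin normal_pdf_ge0.
  rewrite (eq_integral (cst 1%E)); last first.
    move=> v _; rewrite /g /=.
    rewrite -[RHS](@integral_normal_pdf R 0 (Num.sqrt h)).
    apply: (@ge0_integral_translation _ (- psum n (rvec X v))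
      (fun y => (normal_pdf 0 (Num.sqrt h) y)%:E)).
      by apply/measurable_EFinP; exact: measurable_normal_pdf.
    by move=> x; rewrite lee_fin normal_pdf_ge0.
  rewrite integral_cst//= mul1e [X in (X < _)%E](@probability_setT _ _ _ P); exact: ltry.
have [ir ii] := cintegrable_dominated mp bp ig.
have key (q : T * measurableTypeR R -> R) : measurable_fun setT q ->
    (P \x lebesgue_measure)%E.-integrable setT (EFin \o q) ->
    (forall z, `|q z| <= g z) ->
    \int[P]_v \int[lebesgue_measure]_y q (v, y) = \int[lebesgue_measure]_y \int[P]_v q (v, y).
  move=> mq iq qg; rewrite /Rintegral; congr fine.
  transitivity (\int[P]_v \int[lebesgue_measure]_y (q (v, y))%:E)%E.
    apply: eq_integral => v _; rewrite fineK//.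
    apply: integrable_fin_num => //.
    apply: (@integrable_dominated _ _ _ _ _ _ (fun y => g (v, y))) => //.
      by apply: measurableT_comp mq _; exact: measurable_pair1.
    apply/integrableP; split.
      by apply/measurable_EFinP; apply: measurableT_comp mg _; exact: measurable_pair1.
    rewrite (eq_integral (fun y : measurableTypeR R => (normal_pdf 0 (Num.sqrt h) (y - psum n (rvec X v)))%:E)); last first.
      by move=> y _ /=; rewrite /g /= ger0_norm ?normal_pdf_ge0.
    rewrite (@ge0_integral_translation _ (- psum n (rvec X v))
      (fun y => (normal_pdf 0 (Num.sqrt h) y)%:E)).
    + by rewrite integral_normal_pdf ltry.
    + by apply/measurable_EFinP; exact: measurable_normal_pdf.
    + by move=> x; rewrite lee_fin normal_pdf_ge0.
  rewrite (Fubini iq); apply: eq_integral => y _; rewrite fineK//.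
  apply: integrable_fin_num => //.
  apply: (@integrable_bounded _ _ _ P _ (normal_peak (Num.sqrt h))).
    by apply: measurableT_comp mq _; exact: measurable_pair2.
  move=> v; apply: le_trans (qg _) _; apply: normal_pdf_ub.
  by rewrite gt_eqF// sqrtr_gt0.
have [mr' mi'] := mp.
apply: complex_ext => /=.
  apply: (key (fun z => complex.Re (pinned z.2 (rvec X z.1)))) => // z.
  exact: le_trans (ler_Re_normc _) (bp z).
apply: (key (fun z => complex.Im (pinned z.2 (rvec X z.1)))) => // z.
exact: le_trans (ler_Im_normc _) (bp z).
Qed.

(** Resampling the last increment and translating by [psum n] makes the endpoint [y] an integration
    variable. After all other increments are integrated out, [C * exp (- y ^ 2 / 2)] is left; its
    integral squared is [C ^+ 2 * (2 * pi)], the inverse of [dd 0]. *)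
Lemma discrete_bridge_transform :
  (cint P (fun v => cexp (- s * (bridge_quad (rvec X v))%:C))) ^+ 2 * dd 0 = 1.
Proof.
pose Phi (t : n.+1.-tuple R) := cexp (- s * (bridge_quad t)%:C).
have mPhi : cmeasurable Phi.
  apply: cmeasurable_exp; apply: cmeasurableM; first exact: cmeasurable_cst.
  by apply: cmeasurable_real; exact: measurable_bridge_quad.
have bPhi t : Normc.normc (Phi t) <= 1.
  rewrite normc_cexp RecM RecN /= mulr0 subr0 -expR0 ler_expR mulNr oppr_le0.
  by rewrite mulr_ge0// bridge_quad_ge0.
rewrite -[X in X ^+ 2]/(cint P (fun v => Phi (rvec X v))).
rewrite (@cint_resample d T R P n.+1 X (normal_prob 0 (Num.sqrt h)) mX indepX lawX ord_max Phi _ mPhi bPhi).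
have -> : cint P (fun v => cint (normal_prob 0 (Num.sqrt h))
     (fun x => Phi (upd (rvec X v) ord_max x))) =
   cint P (fun v => cint lebesgue_measure (fun y => pinned y (rvec X v))).
  apply: eq_cint => v; set t := rvec X v.
  rewrite (@cint_normal_prob _ _ _ 1) => [|//|x]; last exact: bPhi.
  - rewrite -[RHS](cint_translation (psum n t)); last first.
      apply: cmeasurableM.
        apply: cmeasurable_prod => i; apply: cmeasurable_exp.
        apply: cmeasurableM; first exact: cmeasurable_cst.
        apply: cmeasurable_real; apply: measurable_funM => //; apply: measurable_funX.
        by apply: measurable_funB => //; apply: measurable_funM.
      apply: cmeasurable_real; apply: (measurableT_comp (measurable_normal_pdf _ _)).
      exact: measurable_funB.
    apply: eq_cint => x; rewrite /pinned addrK mulrC; congr (_ * _).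
    rewrite /Phi cexp_bridge_quad (psumS_upd t (@ord_max n)) /= addrC.
    by apply: eq_bigr => i _; rewrite psum_upd_le//= -ltnS.
  - have [mr mi] := mPhi.
    have mu : measurable_fun setT (fun x => upd t ord_max x) by exact: measurable_upd.
    split; [exact: measurableT_comp mr mu|exact: measurableT_comp mi mu].
rewrite pinned_swap.
have [C [CE CH]] := pinned_expectation (leq0n n).
rewrite (eq_cint lebesgue_measure CH).
have E y : cint P (fun v => \prod_(i < 0) f i y (psum i (rvec X v)) *
    (C * G (cc 0) 0 y (psum 0 (rvec X v)))) = C * (gau 2^-1 0 y)%:C.
  rewrite -[RHS](cint_cst P); apply: eq_cint => v.
  rewrite big_ord0 mul1r psum0 /bridge_gauss /grid mul0r mul0r subr0 mul0r.
  congr (_ * _); rewrite expr0n /= mulr0 add0r /gau -cexp_real; congr (cexp (_%:C)).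
  by ring.
rewrite (eq_cint lebesgue_measure E) cintZl; last first.
  split => /=; first by apply: integrable_gau; rewrite invr_gt0.
  exact: integrable0.
have -> : cint lebesgue_measure (fun x => (gau 2^-1 0 x)%:C) = (Num.sqrt (2 * pi))%:C :> R[i].
  apply: complex_ext => /=.
    by rewrite integral_gau ?invr_gt0// invrK mulrC.
  by rewrite Rintegral_cst// mul0r.
rewrite exprMn mulrAC CE -rmorphXn -rmorphM /= sqr_sqrtr ?mulr_ge0 ?pi_ge0// mulVf//.
by rewrite gt_eqF// mulr_gt0 ?pi_gt0.
Qed.

End discrete_bridge.

(** * The Sturm-Liouville equation and its discretisation *)

Section power_second_difference.
Context {R : realType}.
Implicit Types x y p h : R.

Lemma MVT_closed (f df : R -> R) (a b : R) : a <= b ->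
  (forall x, a <= x <= b -> is_derive x 1 f (df x)) ->
  exists2 c, a <= c <= b & f b - f a = df c * (b - a).
Proof.
move=> ab fdf; have [||c cI cE] := @MVT_segment R f df a b ab.
- move=> x; rewrite in_itv /= => /andP[ax xb]; apply: fdf; lra.
- apply: derivable_within_continuous => x; rewrite in_itv /= => /fdf xd.
  exact: ex_derive.
- by exists c.
Qed.

Lemma powR_le1 x p : 0 <= x -> x <= 1 -> 0 <= p -> x `^ p <= 1.
Proof.
by move=> x0 x1 p0; have := @ge0_ler_powR R p p0 x 1 x0 ler01 x1; rewrite powR1.
Qed.

Lemma powR_lipschitz p x y : 1 <= p -> 0 < x -> x <= y -> y <= 1 ->
  `|y `^ p - x `^ p| <= p * (y - x).
Proof.
move=> p1 x0 xy y1.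
have [z|z /andP[xz zy] ->] := @MVT_closed (fun x : R => x `^ p) (fun z => p * z `^ (p - 1)) x y xy.
  by move=> /andP[xz _]; apply: is_derive1_powR; exact: lt_le_trans xz.
have z0 : 0 <= z by rewrite (le_trans (ltW x0)).
rewrite ger0_norm; last first.
  by rewrite mulr_ge0 ?subr_ge0// mulr_ge0 ?powR_ge0// (le_trans ler01).
rewrite ler_wpM2r ?subr_ge0// ler_piMr ?(le_trans ler01)//.
by rewrite powR_le1 ?subr_ge0// (le_trans zy).
Qed.

Let secd_bound p x t : 3 <= p -> 0 <= t -> t < x -> x + t <= 1 ->
  `|(x + t) `^ (p - 2) + (x - t) `^ (p - 2) - 2 * x `^ (p - 2)| <= 2 * (p - 2) * t.
Proof.
move=> p3 t0 tx xt1.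
have -> : (x + t) `^ (p - 2) + (x - t) `^ (p - 2) - 2 * x `^ (p - 2) =
  ((x + t) `^ (p - 2) - x `^ (p - 2)) - (x `^ (p - 2) - (x - t) `^ (p - 2)) by ring.
apply: (le_trans (ler_normB _ _)).
have h1 : `|(x + t) `^ (p - 2) - x `^ (p - 2)| <= (p - 2) * (x + t - x).
  by apply: powR_lipschitz; lra.
have h2 : `|x `^ (p - 2) - (x - t) `^ (p - 2)| <= (p - 2) * (x - (x - t)).
  by apply: powR_lipschitz; lra.
lra.
Qed.

(** Two mean value steps in [h] reduce the error to a second difference of the power [p - 2], which
    is Lipschitz on the unit interval when [3 <= p]. Order 3 in [h] is enough: the summation below
    loses two orders. *)
Lemma powR_second_difference p x h : 3 <= p -> 0 <= h -> h < x -> x + h <= 1 ->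
  `|(x + h) `^ p + (x - h) `^ p - 2 * x `^ p - h ^+ 2 * (p * (p - 1) * x `^ (p - 2))|
    <= 2 * (p * (p - 1) * (p - 2)) * h ^+ 3.
Proof.
move=> p3 h0 hx xh1.
have dp q t : 0 <= t -> t <= h -> is_derive t 1 (fun t => (x + t) `^ q) (q * (x + t) `^ (q - 1)).
  move=> t0 th; have xt0 : 0 < x + t by lra.
  have dd : is_derive t 1 (fun t => x + t) 1.
    by apply: is_derive_eq (is_deriveD (is_derive_cst x t 1) (is_derive_id t 1)) _; rewrite add0r.
  apply: is_derive_eq (is_derive1_comp (is_derive1_powR q xt0) dd) _.
  by rewrite mulr1.
have dm q t : 0 <= t -> t <= h -> is_derive t 1 (fun t => (x - t) `^ q) (- q * (x - t) `^ (q - 1)).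
  move=> t0 th; have xt0 : 0 < x - t by lra.
  have dd : is_derive t 1 (fun t => x - t) (- 1).
    by apply: is_derive_eq (is_deriveB (is_derive_cst x t 1) (is_derive_id t 1)) _; rewrite sub0r.
  have H := @is_derive1_comp R (fun y => y `^ q) (fun t => x - t) t _ _ (is_derive1_powR q xt0) dd.
  apply: (is_derive_eq H).
  by ring.
pose G := x `^ (p - 2).
pose f t : R := (x + t) `^ p + (x - t) `^ p - t ^+ 2 * (p * (p - 1) * G).
pose f1 t : R := p * ((x + t) `^ (p - 1) - (x - t) `^ (p - 1)) - 2 * t * (p * (p - 1) * G).
pose f2 t : R := p * (p - 1) * ((x + t) `^ (p - 2) + (x - t) `^ (p - 2) - 2 * G).
have pp : p - 1 - 1 = p - 2 by ring.
have d1 t : 0 <= t <= h -> is_derive t 1 f (f1 t).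
  move=> /andP[t0 th].
  have dt2 : is_derive t 1 (fun t => t ^+ 2 * (p * (p - 1) * G)) (2 * t * (p * (p - 1) * G)).
    move: (p * (p - 1) * G) => c.
    apply: is_derive_eq (is_deriveM (is_deriveX 2 (is_derive_id t (1:R))) (is_derive_cst c t 1)) _.
    by rewrite -![_ *: _]/(_ * _) !fctE /=; ring.
  apply: is_derive_eq (is_deriveB (is_deriveD (dp p t t0 th) (dm p t t0 th)) dt2) _.
  by rewrite /f1; ring.
have d2 t : 0 <= t <= h -> is_derive t 1 f1 (f2 t).
  move=> /andP[t0 th].
  have dt2 : is_derive t 1 (fun t => 2 * t * (p * (p - 1) * G)) (2 * (p * (p - 1) * G)).
    move: (p * (p - 1) * G) => c.
    apply: is_derive_eq (is_deriveM (is_deriveZ 2 (is_derive_id t (1:R))) (is_derive_cst c t 1)) _.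
    by rewrite -![_ *: _]/(_ * _) !fctE /=; ring.
  apply: is_derive_eq (is_deriveB (is_deriveZ p (is_deriveB (dp (p - 1) t t0 th) (dm (p - 1) t t0 th))) dt2) _.
  by rewrite /f2 -![_ *: _]/(_ * _) pp; ring.
have [c /andP[c0 ch] cE] := MVT_closed h0 d1.
have d2c t : 0 <= t <= c -> is_derive t 1 f1 (f2 t).
  by move=> /andP[t0 tc]; apply: d2; rewrite t0 (le_trans tc).
have [e /andP[e0 ec] eE] := MVT_closed c0 d2c.
have f10 : f1 0 = 0 by rewrite /f1 addr0 subr0; ring.
have f1c : f1 c = f2 e * c by have := eE; rewrite f10 !subr0.
have -> : (x + h) `^ p + (x - h) `^ p - 2 * x `^ p - h ^+ 2 * (p * (p - 1) * x `^ (p - 2)) =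
    f2 e * c * h.
  rewrite -f1c -[in RHS](subr0 h) -cE /f !addr0 !subr0 /G; ring.
have eh : e <= h by exact: le_trans ch.
have hf2 : `|f2 e| <= p * (p - 1) * (2 * (p - 2) * h).
  rewrite /f2 normrM ger0_norm ?mulr_ge0//; [|lra..].
  rewrite ler_wpM2l ?mulr_ge0//; [lra..|].
  apply: le_trans (secd_bound p3 e0 _ _) _; [lra..|].
  rewrite ler_wpM2l//; lra.
rewrite !normrM (ger0_norm c0) (ger0_norm h0).
have -> : 2 * (p * (p - 1) * (p - 2)) * h ^+ 3 = p * (p - 1) * (2 * (p - 2) * h) * h * h by ring.
by rewrite ler_wpM2r// ler_pM// -!normrM.
Qed.

End power_second_difference.

Section sturm_liouville.
Context {R : realType}.
Variables (alpha : R) (s : R[i]).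
Hypothesis alpha0 : 0 <= alpha.

(** Multiplying by [x^alpha] and integrating twice raises an exponent by [alpha + 2]; the first one
    is 1. All others are at least 3. *)
Definition sl_exp (m : nat) : R := m%:R * (alpha + 2) + 1.

Fixpoint sl_coef (m : nat) : R :=
  if m is m'.+1 then sl_coef m' / (sl_exp m * (sl_exp m - 1)) else 1.

Lemma sl_expS m : sl_exp m.+1 = sl_exp m + (alpha + 2).
Proof. by rewrite /sl_exp -natr1; ring. Qed.

Lemma sl_exp_ge1 m : 1 <= sl_exp m.
Proof. by rewrite lerDr mulr_ge0// addr_ge0. Qed.

Lemma sl_expS_ge3 m : 3 <= sl_exp m.+1.
Proof. by have a0 := alpha0; rewrite sl_expS; have := sl_exp_ge1 m; lra. Qed.

Lemma sl_coef_gt0 m : 0 < sl_coef m.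
Proof.
elim: m => [|m IH] //=; rewrite divr_gt0// mulr_gt0//.
  by have := sl_expS_ge3 m; lra.
by have := sl_expS_ge3 m; lra.
Qed.

Lemma sl_coefS m : sl_coef m.+1 * (sl_exp m.+1 * (sl_exp m.+1 - 1)) = sl_coef m.
Proof.
have h := sl_expS_ge3 m; rewrite /= divfK// mulf_neq0// gt_eqF//; lra.
Qed.

Lemma sl_coef_le m : sl_coef m <= (m`!%:R)^-1.
Proof.
elim: m => [|m IH]; first by rewrite /= fact0 invr1.
have h := sl_expS_ge3 m.
rewrite factS natrM invfM mulrC ler_pM ?invr_ge0 ?(ltW (sl_coef_gt0 _))//.
  by rewrite mulr_ge0//; lra.
have a0 := alpha0; have m0 : (0 : R) <= m%:R by [].
have am : 0 <= m%:R * alpha by rewrite mulr_ge0.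
have e : (m.+1%:R : R) = m%:R + 1 by rewrite -natr1.
have hm : m.+1%:R <= sl_exp m.+1 - 1 by rewrite /sl_exp e; nra.
rewrite lef_pV2 ?posrE ?ltr0n// ?mulr_gt0//; [|lra|lra].
by apply: le_trans hm _; rewrite ler_peMl//; lra.
Qed.

(* Terms of the power series of the solution of [u'' = 2 s x^alpha u],
   [u 0 = 0], [u' 0 = 1]. *)
Definition sl_term (m : nat) (x : R) : R[i] := (sl_coef m)%:C * (2 * s) ^+ m * (x `^ sl_exp m)%:C.

Definition sl_sum (M : nat) (x : R) : R[i] := \sum_(m < M.+1) sl_term m x.

(** Consistency constant of the truncated series, the sum of the constants of [power_grid_residual].
    It depends on [M] but not on the mesh. *)
Definition sl_resid (M : nat) : R := \sum_(m < M.+1)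
  sl_coef m * (2 * Normc.normc s) ^+ m * (4 + 2 * (sl_exp m * (sl_exp m - 1) * (sl_exp m - 2) + 2 `^ sl_exp m + sl_exp m * (sl_exp m - 1))).

Let A := Normc.normc s.

Let A0 : 0 <= A. Proof. exact: normc_ge0. Qed.

Lemma resid_const_ge1 (p : R) : p = 1 \/ 3 <= p ->
  1 <= 4 + 2 * (p * (p - 1) * (p - 2) + 2 `^ p + p * (p - 1)).
Proof.
have c2p : 0 <= 2 `^ p :> R by exact: powR_ge0.
case=> [p1|p3]; first by rewrite p1 in c2p *; lra.
have pp : 0 <= p * (p - 1) by rewrite mulr_ge0; lra.
have ppp : 0 <= p * (p - 1) * (p - 2) by rewrite mulr_ge0; lra.
lra.
Qed.

Lemma sl_exp1_ge3 m : sl_exp m = 1 \/ 3 <= sl_exp m.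
Proof.
case: m => [|j]; first by left; rewrite /sl_exp mul0r add0r.
by right; exact: sl_expS_ge3.
Qed.

Lemma normc_2s : Normc.normc (2 * s) = 2 * A.
Proof.
rewrite Normc.normcM; congr (_ * _).
by rewrite (_ : (2 : R[i]) = (2 : R)%:C) ?normc_real ?ger0_norm// rmorph_nat.
Qed.

Lemma normc_sum (I : Type) (r : seq I) (Q : pred I) (F : I -> R[i]) :
  Normc.normc (\sum_(i <- r | Q i) F i) <= \sum_(i <- r | Q i) Normc.normc (F i).
Proof.
elim/big_ind2 : _ => [|x1 x2 y1 y2 h1 h2|i _//]; first by rewrite Normc.normc0.
by apply: le_trans (normcD _ _) _; exact: lerD.
Qed.

Variables (n : nat).
Let h : R := n.+1%:R^-1.
Let h0 : 0 < h. Proof. by rewrite invr_gt0 ltr0n. Qed.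
Let h1 : h <= 1. Proof. by rewrite invf_le1 ?ltr0n// ler1n. Qed.
Let w (k : nat) : R := (k%:R * h) `^ alpha.

Lemma power_grid_residual p k : p = 1 \/ 3 <= p -> (0 < k)%N -> (k <= n)%N ->
  `|(k.+1%:R * h) `^ p + (k.-1%:R * h) `^ p - 2 * (k%:R * h) `^ p -
     h ^+ 2 * (p * (p - 1) * (k%:R * h) `^ (p - 2))| <=
   (2 * (p * (p - 1) * (p - 2) + 2 `^ p + p * (p - 1)) + 4) * h ^+ 3.
Proof.
move=> p13 k0 kn.
have kE : (k%:R : R) = k.-1%:R + 1 by rewrite natr1 prednK.
have kS : (k.+1%:R : R) = k%:R + 1 by rewrite natr1.
have c2p : 0 <= 2 `^ p :> R by exact: powR_ge0.
have hh : 0 <= h ^+ 3 by rewrite exprn_ge0// ltW.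
case: p13 => [p1|p3].
  have k10 : 0 <= k.-1%:R * h by rewrite mulr_ge0// ltW.
  rewrite p1 !powRr1 ?mulr_ge0 ?ler0n ?(ltW h0)// kS kE.
  rewrite (_ : _ - _ = 0); last by ring.
  rewrite normr0 mulr_ge0//; rewrite p1 in c2p; lra.
have pp : 0 <= p * (p - 1) by rewrite mulr_ge0; lra.
have ppp : 0 <= p * (p - 1) * (p - 2) by rewrite mulr_ge0; lra.
have [k1|k1] := eqVneq k 1%N.
  rewrite k1 /= mul0r powR0 ?gt_eqF//; last lra.
  rewrite addr0 mul1r powRM ?(ltW h0)//.
  have hp : h `^ p <= h ^+ 3.
    rewrite -powR_mulrn ?(ltW h0)//; apply: ger_powR; rewrite ?h0//.
  have hp2 : h `^ (p - 2) <= h.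
    by rewrite -[leRHS]powRr1 ?(ltW h0)//; apply: ger_powR; rewrite ?h0//; lra.
  have g0 : 0 <= h `^ p by exact: powR_ge0.
  have g2 : 0 <= h `^ (p - 2) by exact: powR_ge0.
  have e3 : h ^+ 3 = h ^+ 2 * h by ring.
  have h0' := h0; have h1' := h1.
  have q2 : h ^+ 2 * (p * (p - 1) * h `^ (p - 2)) <= p * (p - 1) * h ^+ 3.
    rewrite e3 mulrCA ler_wpM2l// ler_wpM2l ?sqr_ge0//.
  have q20 : 0 <= h ^+ 2 * (p * (p - 1) * h `^ (p - 2)).
    by rewrite mulr_ge0 ?sqr_ge0// mulr_ge0.
  have q3 : 2 `^ p * h `^ p <= 2 `^ p * h ^+ 3 by rewrite ler_wpM2l.
  have q30 : 0 <= 2 `^ p * h `^ p by rewrite mulr_ge0.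
  have q4 : 0 <= p * (p - 1) * (p - 2) * h ^+ 3 by rewrite mulr_ge0.
  have q5 : 0 <= p * (p - 1) * h ^+ 3 by rewrite mulr_ge0.
  have q6 : 0 <= 2 `^ p * h ^+ 3 by rewrite mulr_ge0.
  rewrite ler_norml; apply/andP; split; lra.
have k2 : (1 < k)%N by lia.
have km : (0 : R) < k.-1%:R by rewrite ltr0n; lia.
have xh : h < k%:R * h by rewrite kE mulrDl mul1r ltrDr mulr_gt0.
have x1 : k%:R * h + h <= 1.
  rewrite (_ : _ + _ = k.+1%:R * h); last by rewrite kS; ring.
  by rewrite /h ler_pdivrMr ?ltr0n// mul1r ler_nat ltnS.
have := powR_second_difference p3 (ltW h0) xh x1.
rewrite (_ : k%:R * h + h = k.+1%:R * h); last by rewrite kS; ring.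
rewrite (_ : k%:R * h - h = k.-1%:R * h); last by rewrite kE; ring.
move=> H; apply: le_trans H _; rewrite ler_wpM2r//; lra.
Qed.

Lemma sl_sum_residual M k : (0 < k)%N -> (k <= n)%N ->
  Normc.normc (sl_sum M (k.+1%:R * h) + sl_sum M (k.-1%:R * h) -
    (2 + 2 * s * (h ^+ 2 * w k)%:C) * sl_sum M (k%:R * h)) <=
  sl_resid M * h ^+ 3 + h ^+ 2 * (sl_coef M * (2 * A) ^+ M.+1).
Proof.
move=> k0 kn; set x := k%:R * h.
have x0 : 0 < x by rewrite mulr_gt0 ?ltr0n.
have x1 : x <= 1 by rewrite /x /h ler_pdivrMr ?ltr0n// mul1r ler_nat ltnW// ltnS.
pose g m := (sl_coef m)%:C * (2 * s) ^+ m *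
  (h ^+ 2 * (sl_exp m * (sl_exp m - 1) * x `^ (sl_exp m - 2)))%:C.
pose e m := (k.+1%:R * h) `^ sl_exp m + (k.-1%:R * h) `^ sl_exp m - 2 * x `^ sl_exp m -
     h ^+ 2 * (sl_exp m * (sl_exp m - 1) * x `^ (sl_exp m - 2)).
(* The second derivative of a term is [2 s x^alpha] times the previous term, so after summation only
   the top term [M] stays unmatched; it gives the last part of the bound. *)
have gS m : g m.+1 = 2 * s * (h ^+ 2 * w k)%:C * sl_term m x.
  rewrite /g /sl_term -(sl_coefS m) exprS.
  have -> : sl_exp m.+1 - 2 = alpha + sl_exp m by rewrite sl_expS; ring.
  rewrite powRD; last by rewrite (gt_eqF x0) implybT.
  rewrite -/(w k) !rmorphM /=; ring.
have g0 : g 0%N = 0.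
  by rewrite /g /sl_exp mul0r add0r subrr mulr0 mul0r mulr0 /= mulr0.
have sumg : \sum_(m < M.+1) g m =
    2 * s * (h ^+ 2 * w k)%:C * (sl_sum M x - sl_term M x).
  rewrite big_ord_recl g0 add0r /sl_sum big_ord_recr /= addrK mulr_sumr.
  by apply: eq_bigr => i _; rewrite -gS.
have -> : sl_sum M (k.+1%:R * h) + sl_sum M (k.-1%:R * h) -
    (2 + 2 * s * (h ^+ 2 * w k)%:C) * sl_sum M x =
  \sum_(m < M.+1) (sl_coef m)%:C * (2 * s) ^+ m * (e m)%:C -
     2 * s * (h ^+ 2 * w k)%:C * sl_term M x.
  have -> : \sum_(m < M.+1) (sl_coef m)%:C * (2 * s) ^+ m * (e m)%:C =
     sl_sum M (k.+1%:R * h) + sl_sum M (k.-1%:R * h) - 2 * sl_sum M x - \sum_(m < M.+1) g m.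
    rewrite /sl_sum mulr_sumr -big_split /= -!sumrB; apply: eq_bigr => m _.
    rewrite /e /g /sl_term !rmorphB /= rmorphD /= [(2 * _)%:C]rmorphM /=.
    rewrite (_ : (2 : R)%:C = 2 :> R[i]); last by rewrite rmorph_nat.
    ring.
  rewrite sumg; ring.
apply: (le_trans (normcD _ _)); rewrite normcN lerD//.
  apply: (le_trans (normc_sum _ _ _)); rewrite /sl_resid mulr_suml; apply: ler_sum => m _.
  rewrite !Normc.normcM !normc_real (ger0_norm (ltW (sl_coef_gt0 _))).
  have -> : Normc.normc ((2 * s) ^+ m) = (2 * A) ^+ m.
    elim: {e g gS g0 sumg} (nat_of_ord m) => [|j IH]; first by rewrite !expr0 Normc.normc1.
    by rewrite !exprS Normc.normcM IH normc_2s.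
  rewrite -[leRHS]mulrA ler_wpM2l ?mulr_ge0 ?exprn_ge0 ?mulr_ge0 ?(ltW (sl_coef_gt0 _))//.
  have pm : sl_exp m = 1 \/ 3 <= sl_exp m.
    case: (nat_of_ord m) => [|j]; first by left; rewrite /sl_exp mul0r add0r.
    by right; exact: sl_expS_ge3.
  by rewrite addrC; exact: power_grid_residual pm k0 kn.
rewrite Normc.normcM [X in X * _]Normc.normcM normc_2s normc_real ger0_norm; last first.
  by rewrite mulr_ge0 ?sqr_ge0 ?powR_ge0.
rewrite /sl_term !Normc.normcM !normc_real (ger0_norm (ltW (sl_coef_gt0 _))) (ger0_norm (powR_ge0 _ _)).
have -> : Normc.normc ((2 * s) ^+ M) = (2 * A) ^+ M.
  elim: {e g gS g0 sumg} M => [|j IH]; first by rewrite !expr0 Normc.normc1.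
  by rewrite !exprS Normc.normcM IH normc_2s.
have -> : 2 * A * (h ^+ 2 * w k) * (sl_coef M * (2 * A) ^+ M * x `^ sl_exp M) =
  h ^+ 2 * (sl_coef M * (2 * A) ^+ M.+1) * (w k * x `^ sl_exp M).
  rewrite [_ ^+ M.+1]exprS; move: (x `^ _) (w k) ((2 * A) ^+ M) (sl_coef M) => v1 v2 v3 v4; ring.
rewrite ler_piMr//.
  by rewrite mulr_ge0 ?sqr_ge0// mulr_ge0 ?(ltW (sl_coef_gt0 _))// exprn_ge0// mulr_ge0.
rewrite mulr_ile1 ?powR_ge0//.
  by rewrite /w powR_le1// ltW.
by rewrite powR_le1 ?(ltW x0)// (le_trans ler01)// sl_exp_ge1.
Qed.

Variable (dd : nat -> R[i]).
Hypothesis dN : dd n.+1 = 0.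
Hypothesis dn : dd n = h%:C.
Hypothesis dS : forall k, (k < n)%N ->
  dd k = (2 + 2 * s * (h ^+ 2 * w k.+1)%:C) * dd k.+1 - dd k.+2.

Let D : R := 2 * expR (4 * A + 1).

(** Discrete Gronwall argument for the modulus of [dd] plus that of its difference quotient [e]:
    this sum starts at [h + 1 <= 2] and grows by at most [1 + (4 A + 1) h] in each of at most [n]
    steps. *)
Lemma sl_discrete_bound k : (k <= n)%N -> Normc.normc (dd k) <= D.
Proof.
pose e k := (dd k - dd k.+1) / h%:C.
have hC0 : h%:C != 0 :> R[i] by rewrite (fmorph_eq0 (real_complex R)) gt_eqF.
have w1 j : (j <= n)%N -> 0 <= w j <= 1.
  move=> jn; rewrite powR_ge0 powR_le1// ?mulr_ge0 ?(ltW h0)//.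
  by rewrite /h ler_pdivrMr ?ltr0n// mul1r ler_nat ltnW// ltnS.
pose q := 1 + (4 * A + 1) * h.
have q0 : 0 <= q by rewrite addr_ge0// mulr_ge0 ?(ltW h0)// addr_ge0// mulr_ge0.
suff H j : forall k, (k + j = n)%N -> Normc.normc (dd k) + Normc.normc (e k) <= 2 * q ^+ j.
  move=> kn; have := H _ _ (subnKC kn).
  move=> H1; have : Normc.normc (dd k) <= 2 * q ^+ (n - k).
    by apply: le_trans H1; rewrite lerDl normc_ge0.
  move/le_trans; apply; rewrite /D ler_wpM2l//.
  have qe : q <= expR ((4 * A + 1) * h) by exact: expR_ge1Dx.
  apply: (@le_trans _ _ (expR ((4 * A + 1) * h) ^+ (n - k))).
    by rewrite lerXn2r ?nnegrE ?expR_ge0.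
  rewrite -expRM_natl ler_expR mulrCA ler_piMr//; first by rewrite addr_ge0// mulr_ge0.
  by rewrite /h ler_pdivrMr ?ltr0n// mul1r ler_nat (leq_trans (leq_subr _ _)).
elim: j {k} => [|j IH] k; rewrite ?addn0.
  move=> ->; rewrite expr0 mulr1 /e dN subr0 dn divff// normc_real Normc.normc1 ger0_norm ?(ltW h0)//.
  by rewrite -[2]/(1 + 1) lerD2r.
rewrite -addSnnS => kn; have := IH _ kn.
have kn' : (k < n)%N by rewrite -kn leq_addr.
have /andP[wk0 wk1] := w1 _ kn'.
set a := Normc.normc (dd k.+1); set b := Normc.normc (e k.+1).
have a0 : 0 <= a by exact: normc_ge0.
have b0 : 0 <= b by exact: normc_ge0.
move=> ab.
have eE : e k = e k.+1 + 2 * s * (h * w k.+1)%:C * dd k.+1.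
  rewrite /e (dS kn') !rmorphM /=; field; exact: hC0.
have dE : dd k = dd k.+1 + h%:C * e k by rewrite /e; field; exact: hC0.
have he : Normc.normc (e k) <= b + 2 * A * h * a.
  rewrite eE; apply: (le_trans (normcD _ _)); rewrite lerD2l Normc.normcM [X in X * _]Normc.normcM normc_2s normc_real.
  rewrite ger0_norm ?mulr_ge0 ?(ltW h0)// ler_wpM2r// -!mulrA ler_wpM2l// ler_wpM2l//.
  by rewrite ler_piMr// ltW.
have hd : Normc.normc (dd k) <= a + h * Normc.normc (e k).
  rewrite dE; apply: (le_trans (normcD _ _)); rewrite lerD2l Normc.normcM normc_real.
  by rewrite ger0_norm// ltW.
have hAa : 0 <= A * h * a by rewrite mulr_ge0// mulr_ge0// ltW.
have hhAa : h * (A * h * a) <= A * h * a by rewrite ler_piMl.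
have hhe := ler_wpM2l (ltW h0) he.
have hb : 0 <= h * b by rewrite mulr_ge0// ltW.
have ha : 0 <= h * a by rewrite mulr_ge0// ltW.
have hAb : 0 <= A * h * b by rewrite mulr_ge0// mulr_ge0// ltW.
apply: (@le_trans _ _ ((a + b) * q)); last by rewrite exprSr mulrA; exact: ler_wpM2r.
rewrite /q.
have -> : (a + b) * (1 + (4 * A + 1) * h) = a + b + 4 * (A * h * a) + 4 * (A * h * b) + h * a + h * b by ring.
have A0' := A0; have h0' := h0; have h1' := h1.
have hhe' : h * (b + 2 * A * h * a) = h * b + 2 * (h * (A * h * a)) by ring.
lra.
Qed.

(* The discrete Wronskian of [dd] and of the sampled series is constant up to
   the consistency error of the difference scheme. *)
Lemma sl_wronskian M : Normc.normc (sl_sum M 1 - dd 0) <=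
  2 * D * (sl_resid M * h + sl_coef M * (2 * A) ^+ M.+1).
Proof.
pose u k := sl_sum M (k%:R * h).
pose rho k := u k.+1 + u k.-1 - (2 + 2 * s * (h ^+ 2 * w k)%:C) * u k.
pose W k := u k.+1 * dd k - u k * dd k.+1.
have u0 : u 0%N = 0.
  rewrite /u mul0r /sl_sum big1// => m _; rewrite /sl_term powR0 ?mulr0//.
  by rewrite gt_eqF// (lt_le_trans ltr01)// sl_exp_ge1.
have WS k : (k < n)%N -> W k.+1 - W k = dd k.+1 * rho k.+1.
  move=> kn; rewrite /W /rho (dS kn) /=; ring.
have Wn : W n = h%:C * sl_sum M 1.
  rewrite /W dn dN mulr0 subr0 /u (_ : n.+1%:R * h = 1); last by rewrite /h divff// pnatr_eq0.
  by rewrite mulrC.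
have W0 : W 0%N = u 1%N * dd 0 by rewrite /W u0 mul0r subr0.
have Wsum : W n = W 0%N + \sum_(k < n) dd k.+1 * rho k.+1.
  have : forall j, (j <= n)%N -> W j = W 0%N + \sum_(k < j) dd k.+1 * rho k.+1.
    elim=> [_|j IH jn]; first by rewrite big_ord0 addr0.
    rewrite big_ord_recr /= addrA -IH 1?ltnW// -WS//; ring.
  by apply.
have D0 : 0 <= D by rewrite mulr_ge0// expR_ge0.
pose r := sl_resid M * h ^+ 3 + h ^+ 2 * (sl_coef M * (2 * A) ^+ M.+1).
have hrho k : (k < n)%N -> Normc.normc (rho k.+1) <= r.
  by move=> kn; exact: sl_sum_residual.
have hsum : Normc.normc (\sum_(k < n) dd k.+1 * rho k.+1) <= n%:R * (D * r).
  apply: (le_trans (normc_sum _ _ _)).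
  apply: (@le_trans _ _ (\sum_(k < n) D * r)).
    apply: ler_sum => k _; rewrite Normc.normcM ler_pM ?normc_ge0//.
      exact: sl_discrete_bound.
    exact: hrho.
  by rewrite sumr_const card_ord mulr_natl.
(* [W 0] involves [u 1] where [h] is wanted. The linear term gives [h] exactly, and the others have
   exponent at least 3. *)
have u1 : Normc.normc (h%:C - u 1%N) <= sl_resid M * h ^+ 2.
  rewrite /u mul1r /sl_sum big_ord_recl.
  have -> : sl_term (@ord0 M) h = h%:C.
    by rewrite /sl_term expr0 mulr1 /= mul1r /sl_exp mul0r add0r powRr1 ?(ltW h0).
  rewrite opprD addrA subrr add0r normcN; apply: (le_trans (normc_sum _ _ _)).
  rewrite /sl_resid big_ord_recl mulrDl ler_wpDl//.
    rewrite mulr_ge0 ?sqr_ge0// mulr_ge0 ?mulr_ge0 ?(ltW (sl_coef_gt0 _))//.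
    by apply: le_trans (resid_const_ge1 (sl_exp1_ge3 _)).
  rewrite mulr_suml; apply: ler_sum => m _.
  rewrite lift0; have p3 := sl_expS_ge3 m.
  move: (nat_of_ord m).+1 p3 => j p3.
  rewrite /sl_term !Normc.normcM !normc_real (ger0_norm (ltW (sl_coef_gt0 _))) (ger0_norm (powR_ge0 _ _)).
  have -> : Normc.normc ((2 * s) ^+ j) = (2 * A) ^+ j.
    elim: {p3} j => [|i IH]; first by rewrite !expr0 Normc.normc1.
    by rewrite !exprS Normc.normcM IH normc_2s.
  rewrite -[leRHS]mulrA ler_wpM2l ?mulr_ge0 ?exprn_ge0 ?mulr_ge0 ?(ltW (sl_coef_gt0 _))//.
  apply: (@le_trans _ _ (h ^+ 2)).
    rewrite -powR_mulrn ?(ltW h0)//; apply: ger_powR; first by rewrite h0 h1.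
    by rewrite (le_trans _ p3)// ler_nat.
  by rewrite ler_peMl ?sqr_ge0// resid_const_ge1//; right.
have E : h%:C * (sl_sum M 1 - dd 0) = \sum_(k < n) dd k.+1 * rho k.+1 - (h%:C - u 1%N) * dd 0.
  by rewrite mulrBr -Wn Wsum W0; ring.
have nh : n%:R * h <= 1 by rewrite /h ler_pdivrMr ?ltr0n// mul1r ler_nat.
have rS0 : 0 <= sl_resid M.
  rewrite sumr_ge0// => m _; rewrite mulr_ge0 ?mulr_ge0 ?(ltW (sl_coef_gt0 _)) ?exprn_ge0 ?mulr_ge0//.
  by apply: le_trans (resid_const_ge1 (sl_exp1_ge3 _)).
have eM0 : 0 <= sl_coef M * (2 * A) ^+ M.+1.
  by rewrite mulr_ge0 ?(ltW (sl_coef_gt0 _))// exprn_ge0// mulr_ge0.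
(* The Wronskian identity holds for [h] times the difference. The [n] residuals of order [h ^+ 3]
   add up to order [h ^+ 2], and the division leaves order [h]. *)
rewrite -(ler_pM2l h0).
have -> : h * Normc.normc (sl_sum M 1 - dd 0) = Normc.normc (h%:C * (sl_sum M 1 - dd 0)).
  by rewrite Normc.normcM normc_real ger0_norm// ltW.
rewrite E; apply: (le_trans (normcD _ _)); rewrite normcN Normc.normcM.
have d0 := sl_discrete_bound (leq0n n).
apply: (@le_trans _ _ (n%:R * (D * r) + sl_resid M * h ^+ 2 * D)).
  by rewrite lerD// ler_pM ?normc_ge0.
have -> : n%:R * (D * r) = n%:R * h * (D * (sl_resid M * h ^+ 2 + h * (sl_coef M * (2 * A) ^+ M.+1))).
  by rewrite /r; ring.
have k1 : 0 <= D * (sl_resid M * h ^+ 2 + h * (sl_coef M * (2 * A) ^+ M.+1)).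
  by rewrite mulr_ge0// addr_ge0// mulr_ge0 ?sqr_ge0// ltW.
have k2 := ler_wpM2r k1 nh; rewrite mul1r in k2.
have k3 : 0 <= D * (h * (sl_coef M * (2 * A) ^+ M.+1)) by rewrite mulr_ge0// mulr_ge0// ltW.
have -> : h * (2 * D * (sl_resid M * h + sl_coef M * (2 * A) ^+ M.+1)) =
  D * (sl_resid M * h ^+ 2 + h * (sl_coef M * (2 * A) ^+ M.+1)) + sl_resid M * h ^+ 2 * D +
  D * (h * (sl_coef M * (2 * A) ^+ M.+1)) by ring.
by rewrite -addrA lerD// lerDl.
Qed.

End sturm_liouville.

(** The recursion is run on pairs of consecutive values, with [j = n.+1 - k] as the induction
    variable. *)
Lemma backward_recursion (K : comNzRingType) (c : nat -> K) (x : K) (n : nat) :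
  exists dd : nat -> K, [/\ dd n.+1 = 0, dd n = x &
    forall k, (k < n)%N -> dd k = c k.+1 * dd k.+1 - dd k.+2].
Proof.
pose f := fix f (j : nat) : K * K :=
  if j is j'.+1 then ((f j').2, c (n - j')%N * (f j').2 - (f j').1) else (0, x).
exists (fun k => (f (n.+1 - k)%N).1); split; rewrite ?subnn// ?subSnn// => k kn.
have e1 : (n.+1 - k = (n - k.+1).+2)%N by lia.
have e2 : (n.+1 - k.+1 = (n - k.+1).+1)%N by lia.
have e3 : (n.+1 - k.+2 = n - k.+1)%N by lia.
rewrite e1 e2 e3 /=; congr (c _ * _ - _); lia.
Qed.

Section transform_limit.
Context {R : realType}.
Variables (alpha : R) (s : R[i]) (E_ : nat -> R[i]) (E : R[i]).
Hypothesis alpha0 : 0 <= alpha.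
Hypothesis E1 : forall n, Normc.normc (E_ n) <= 1.
Hypothesis ReE : complex.Re (E_ n) @[n --> \oo] --> complex.Re E.
Hypothesis ImE : complex.Im (E_ n) @[n --> \oo] --> complex.Im E.
Hypothesis Erec : forall (n : nat) (dd : nat -> R[i]),
  dd n.+1 = 0 -> dd n = (n.+1%:R^-1)%:C ->
  (forall k, (k < n)%N -> dd k =
    (2 + 2 * s * (n.+1%:R^-1 ^+ 2 * (k.+1%:R / n.+1%:R) `^ alpha)%:C) * dd k.+1 - dd k.+2) ->
  E_ n ^+ 2 * dd 0%N = 1.

Let A := Normc.normc s.
Let D : R := 2 * (2 * expR (4 * A + 1)).

(** The Wronskian estimate multiplied by [E_ n ^+ 2], whose product with [dd 0] is 1: the auxiliary
    sequence, which changes with [n], disappears. *)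
Let bound M n : Normc.normc (sl_sum alpha s M 1 * E_ n ^+ 2 - 1) <=
  D * (sl_resid alpha s M * n.+1%:R^-1 + sl_coef alpha M * (2 * A) ^+ M.+1).
Proof.
have [dd [dN dn dS]] := backward_recursion (fun k => 2 + 2 * s *
  (n.+1%:R^-1 ^+ 2 * (k%:R / n.+1%:R) `^ alpha)%:C) (n.+1%:R^-1)%:C n.
have H := Erec dN dn dS; have W := sl_wronskian alpha0 dN dn dS M.
have -> : sl_sum alpha s M 1 * E_ n ^+ 2 - 1 = (sl_sum alpha s M 1 - dd 0%N) * E_ n ^+ 2.
  by rewrite mulrBl -[in LHS]H [dd 0%N * _]mulrC.
rewrite Normc.normcM; apply: le_trans W; rewrite ler_piMr ?normc_ge0//.
by rewrite expr2 Normc.normcM mulr_ile1 ?normc_ge0.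
Qed.

Let cvg_bound M :
  D * (sl_resid alpha s M * n.+1%:R^-1 + sl_coef alpha M * (2 * A) ^+ M.+1)
  @[n --> \oo] --> D * (sl_coef alpha M * (2 * A) ^+ M.+1).
Proof.
rewrite -[X in D * X]add0r; apply: cvgM; first exact: cvg_cst.
apply: cvgD; last exact: cvg_cst.
rewrite -(mulr0 (sl_resid alpha s M)); apply: cvgM; first exact: cvg_cst.
exact: cvg_harmonic.
Qed.

(** With [M] fixed, refining the mesh removes [sl_resid] and leaves the truncation term. The factor
    2 adds the real and imaginary parts. *)
Lemma transform_limit_bound M : Normc.normc (sl_sum alpha s M 1 * E ^+ 2 - 1) <=
  2 * D * (sl_coef alpha M * (2 * A) ^+ M.+1).
Proof.
set u := sl_sum alpha s M 1.
have cR : complex.Re (u * E_ n ^+ 2 - 1) @[n --> \oo] --> complex.Re (u * E ^+ 2 - 1).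
  rewrite expr2 RecD !RecM ImcM /=.
  under eq_fun do rewrite expr2 RecD !RecM ImcM /=.
  apply: cvgD; last exact: cvg_cst.
  exact: (cvgB (cvgM (cvg_cst _) (cvgB (cvgM ReE ReE) (cvgM ImE ImE)))
    (cvgM (cvg_cst _) (cvgD (cvgM ReE ImE) (cvgM ImE ReE)))).
have cI : complex.Im (u * E_ n ^+ 2 - 1) @[n --> \oo] --> complex.Im (u * E ^+ 2 - 1).
  rewrite expr2 ImcD !ImcM RecM /=.
  under eq_fun do rewrite expr2 ImcD !ImcM RecM /=.
  apply: cvgD; last exact: cvg_cst.
  exact: (cvgD (cvgM (cvg_cst _) (cvgD (cvgM ReE ImE) (cvgM ImE ReE)))
    (cvgM (cvg_cst _) (cvgB (cvgM ReE ReE) (cvgM ImE ImE)))).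
have hR : `|complex.Re (u * E ^+ 2 - 1)| <= D * (sl_coef alpha M * (2 * A) ^+ M.+1).
  have h n : `|complex.Re (u * E_ n ^+ 2 - 1)| <=
      D * (sl_resid alpha s M * n.+1%:R^-1 + sl_coef alpha M * (2 * A) ^+ M.+1).
    exact: le_trans (ler_Re_normc _) (bound M n).
  have C : `|complex.Re (u * E_ n ^+ 2 - 1)| @[n --> \oo] --> `|complex.Re (u * E ^+ 2 - 1)|.
    by apply: cvg_norm.
  by apply: (ler_cvg_to C (@cvg_bound M)); exact: nearW.
have hI : `|complex.Im (u * E ^+ 2 - 1)| <= D * (sl_coef alpha M * (2 * A) ^+ M.+1).
  have h n : `|complex.Im (u * E_ n ^+ 2 - 1)| <=
      D * (sl_resid alpha s M * n.+1%:R^-1 + sl_coef alpha M * (2 * A) ^+ M.+1).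
    exact: le_trans (ler_Im_normc _) (bound M n).
  have C : `|complex.Im (u * E_ n ^+ 2 - 1)| @[n --> \oo] --> `|complex.Im (u * E ^+ 2 - 1)|.
    by apply: cvg_norm.
  by apply: (ler_cvg_to C (@cvg_bound M)); exact: nearW.
apply: (le_trans (normc_le_ReIm _)).
have -> : 2 * D * (sl_coef alpha M * (2 * A) ^+ M.+1) =
  D * (sl_coef alpha M * (2 * A) ^+ M.+1) + D * (sl_coef alpha M * (2 * A) ^+ M.+1) by ring.
exact: lerD.
Qed.

Let cvg_eps : 2 * D * (sl_coef alpha M * (2 * A) ^+ M.+1) @[M --> \oo] --> 0.
Proof.
rewrite -(mulr0 (2 * D)); apply: cvgM; first exact: cvg_cst.
have A2 : 0 <= 2 * A by rewrite mulr_ge0// normc_ge0.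
have c : 2 * A * exp_coeff (2 * A) M @[M --> \oo] --> 0.
  rewrite -(mulr0 (2 * A)); apply: cvgM; first exact: cvg_cst.
  exact: cvg_series_cvg_0 (is_cvg_series_exp_coeff (2 * A)).
apply: (squeeze_cvgr _ (cvg_cst 0) c); apply: nearW => M.
rewrite mulr_ge0 ?(ltW (sl_coef_gt0 _ _))// ?exprn_ge0//= exprS mulrCA.
rewrite ler_wpM2l// mulrC ler_wpM2l ?exprn_ge0//; exact: sl_coef_le.
Qed.

(** If [E] vanished, 1 would be bounded by the truncation term, which tends to 0 as [M] grows. *)
Lemma transform_limit_neq0 : E != 0.
Proof.
apply/eqP => E0.
have h : forall M, 1 <= 2 * D * (sl_coef alpha M * (2 * A) ^+ M.+1).
  move=> M; have := transform_limit_bound M.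
  by rewrite E0 expr0n /= mulr0 sub0r normcN Normc.normc1.
have : (1 : R) <= 0 by apply: (ler_cvg_to (cvg_cst (1 : R)) cvg_eps); exact: nearW.
by rewrite ler10.
Qed.

Lemma transform_limit :
  complex.Re (sl_sum alpha s M 1) @[M --> \oo] --> complex.Re (E ^- 2) /\
  complex.Im (sl_sum alpha s M 1) @[M --> \oo] --> complex.Im (E ^- 2).
Proof.
have E0 := transform_limit_neq0.
have c : (Normc.normc (E ^+ 2))^-1 * (2 * D * (sl_coef alpha M * (2 * A) ^+ M.+1))
    @[M --> \oo] --> 0.
  by rewrite -(mulr0 (Normc.normc (E ^+ 2))^-1); apply: cvgM => //; exact: cvg_cst.
have b M : Normc.normc (sl_sum alpha s M 1 - E ^- 2) <=
    (Normc.normc (E ^+ 2))^-1 * (2 * D * (sl_coef alpha M * (2 * A) ^+ M.+1)).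
  have -> : sl_sum alpha s M 1 - E ^- 2 = (E ^+ 2)^-1 * (sl_sum alpha s M 1 * E ^+ 2 - 1).
    by rewrite mulrBr mulrCA mulVf ?expf_neq0// !mulr1.
  rewrite Normc.normcM Normc.normcV ler_wpM2l ?invr_ge0 ?normc_ge0//.
  exact: transform_limit_bound.
have main (f : R[i] -> R) : (forall z, `|f z| <= Normc.normc z) ->
    (forall z u, f (z - u) = f z - f u) ->
    f (sl_sum alpha s M 1) @[M --> \oo] --> f (E ^- 2).
  move=> fn fB; apply/cvgrPdist_le => /= e e0.
  move/cvgrPdist_le : c => /(_ e e0); apply: filterS => M /=.
  rewrite sub0r normrN => h; rewrite distrC -fB (le_trans (fn _))// (le_trans (b M))//.
  exact: le_trans (ler_norm _) h.
split; apply: main => [z|z u].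
- exact: ler_Re_normc.
- by rewrite RecD RecN.
- exact: ler_Im_normc.
- by rewrite ImcD ImcN.
Qed.

End transform_limit.

(** * Passage to the limit *)

Section Rintegral_finite_sums.
Context d (T : measurableType d) (R : realType) (mu : {measure set T -> \bar R}).
Variables (D : set T) (F : nat -> T -> R).
Hypothesis mD : measurable D.
Hypothesis iF : forall k, mu.-integrable D (EFin \o F k).

Lemma Rintegrable_sum n : mu.-integrable D (EFin \o (fun x => \sum_(k < n) F k x)).
Proof.
elim: n => [|n IH].
  by under eq_fun do rewrite big_ord0; exact: integrable0.
under eq_fun do rewrite big_ord_recr /=.
exact: (integrableD mD IH (iF n)).
Qed.

Lemma Rintegral_sum n : \int[mu]_(x in D) (\sum_(k < n) F k x) =
  \sum_(k < n) \int[mu]_(x in D) F k x.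
Proof.
elim: n => [|n IH].
  by rewrite big_ord0; under eq_Rintegral do rewrite big_ord0; rewrite Rintegral_cst// mul0r.
rewrite big_ord_recr /= -IH -RintegralD//; last exact: Rintegrable_sum.
by apply: eq_Rintegral => x _; rewrite big_ord_recr.
Qed.

End Rintegral_finite_sums.

(** * Riemann sums of continuous functions on the unit interval *)

Section riemann_sum.
Context {R : realType}.
Notation mu := (@lebesgue_measure R).
Variable g : R -> R.
Hypothesis cg : {within `[0, 1], continuous g}.

Lemma itv01_bounded : exists K, forall x, 0 <= x <= 1 -> `|g x| <= K.
Proof.
have cng : {within `[0, 1], continuous (fun x => `|g x|)}.
  apply/subspace_continuousP => x Ax; apply: cvg_norm.
  by move/subspace_continuousP : cg; apply.
have [c _ h] := @EVT_max R (fun x => `|g x|) 0 1 ler01 cng.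
by exists `|g c| => x x01; apply: h; rewrite in_itv.
Qed.

Lemma cvg_within01 (y : nat -> R) (x : R) : (forall n, 0 <= y n <= 1) -> 0 <= x <= 1 ->
  y n @[n --> \oo] --> x -> g (y n) @[n --> \oo] --> g x.
Proof.
move=> y01 x01 yx; have gx : g @ within `[0, 1] (nbhs x) --> g x.
  by move/subspace_continuousP : cg; apply; rewrite /= in_itv.
apply: cvg_comp gx => U; rewrite /within /= nbhs_simpl => hU.
have := yx _ hU; rewrite !nbhs_simpl /=; apply: filterS => n; apply.
by rewrite /= in_itv /=; exact: y01.
Qed.

Let step (n : nat) (x : R) : R :=
  \sum_(k < n.+1) g (k%:R / n.+1%:R) * \1_(`[k%:R / n.+1%:R, k.+1%:R / n.+1%:R[%classic : set R) x.

Let stepE n x : 0 <= x < 1 -> exists k, [/\ (k < n.+1)%N,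
  k%:R / n.+1%:R <= x < k.+1%:R / n.+1%:R & step n x = g (k%:R / n.+1%:R)].
Proof.
move=> /andP[x0 x1]; have n0 : (0 : R) < n.+1%:R by rewrite ltr0n.
pose k := Num.truncn (x * n.+1%:R).
have xn0 : 0 <= x * n.+1%:R by rewrite mulr_ge0.
have /andP[k1 k2] := truncn_itv xn0.
have kx : k%:R / n.+1%:R <= x < k.+1%:R / n.+1%:R.
  by rewrite ler_pdivrMr// ltr_pdivlMr// k1 k2.
have kn : (k < n.+1)%N.
  rewrite -(ltr_nat R) (le_lt_trans k1)// -[ltRHS]mul1r ltr_pM2r//.
exists k; split => //; rewrite /step (bigD1 (Ordinal kn)) //= big1; last first.
  move=> i ik; rewrite indicE memNset ?mulr0// /= in_itv /= => /andP[i1 i2].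
  have [/andP[k3 k4]] := kx.
  have : (i < k.+1)%N.
    by rewrite -(ltr_nat R) -(ltr_pM2r (x := n.+1%:R^-1)) ?invr_gt0// (le_lt_trans i1).
  have : (k < i.+1)%N.
    by rewrite -(ltr_nat R) -(ltr_pM2r (x := n.+1%:R^-1)) ?invr_gt0// (le_lt_trans k3).
  move=> h1 h2; move/eqP : ik; apply; apply: val_inj => /=; lia.
by rewrite addr0 indicE mem_set ?mulr1//= in_itv.
Qed.

(** A left Riemann sum is the integral of a step function whose value at [x] is that of [g] at a
    grid point within [1 / n.+1] of [x]; dominated convergence concludes. *)
Lemma riemann_sum_cvg :
  n.+1%:R^-1 * (\sum_(k < n.+1) g (k%:R / n.+1%:R)) @[n --> \oo] --> \int[mu]_(x in `[0, 1]) g x.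
Proof.
have [K hK] := itv01_bounded.
have K0 : 0 <= K by apply: le_trans (hK 0 _); rewrite ?lexx ?ler01.
have grid01 (k n : nat) : (k <= n)%N -> 0 <= (k%:R / n.+1%:R : R) <= 1.
  move=> kn; rewrite divr_ge0//= ler_pdivrMr ?ltr0n// mul1r ler_nat; exact: leqW.
have intg : mu.-integrable `[0, 1] (EFin \o g).
  by apply: continuous_compact_integrable => //; exact: segment_compact.
(* The steps are half-open intervals and do not cover the point 1. *)
have -> : \int[mu]_(x in `[0, 1]) g x = \int[mu]_(x in `[0, 1[) g x.
  rewrite Rintegral_itv_bndo_bndc//; apply: integrableS intg => //.
  by move=> x /=; rewrite !in_itv /= => /andP[-> /ltW].
have mI (k n : nat) : measurable (`[k%:R / n.+1%:R, k.+1%:R / n.+1%:R[%classic : set R).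
  exact: measurable_itv.
have iI (k n : nat) : mu.-integrable setT (EFin \o (fun x => g (k%:R / n.+1%:R) *
    \1_(`[k%:R / n.+1%:R, k.+1%:R / n.+1%:R[%classic : set R) x)).
  by apply: RintegrableZl => //; exact: integrable_indic_itv.
have sumE n : \int[mu]_(x in `[0, 1[) step n x = n.+1%:R^-1 * (\sum_(k < n.+1) g (k%:R / n.+1%:R)).
  have -> : \int[mu]_(x in `[0, 1[) step n x = \int[mu]_x step n x.
    rewrite Rintegral_mkcond; apply: eq_Rintegral => x _; rewrite patchE.
    case: ifPn => // xI; rewrite /step big1// => k _.
    rewrite indicE memNset ?mulr0//= in_itv /= => /andP[k1 k2].
    move: xI; rewrite notin_setE /= in_itv /=; apply; apply/andP; split.
      by apply: le_trans k1; rewrite divr_ge0.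
    by apply: (lt_le_trans k2); rewrite ler_pdivrMr ?ltr0n// mul1r ler_nat.
  rewrite /step (@Rintegral_sum _ _ _ mu setT (fun k x => g (k%:R / n.+1%:R) *
    \1_(`[k%:R / n.+1%:R, k.+1%:R / n.+1%:R[%classic : set R) x))//.
  rewrite mulr_sumr; apply: eq_bigr => i _; rewrite RintegralZl//; last exact: integrable_indic_itv.
  rewrite mulrC; congr (_ * _); rewrite /Rintegral integral_indic//= setIT.
  rewrite lebesgue_measure_itv /= lte_fin ltr_pM2r ?invr_gt0//.
  by rewrite ltr_nat ltnSn -EFinB -mulrBl -natrB// subSnn mul1r.
under eq_fun do rewrite -sumE.
have mstep n : measurable_fun setT (step n).
  by apply: measurable_sum => k; apply: measurable_funM => //; exact: measurable_indic.
apply: (@cvg_Rintegral_dominated _ _ _ mu _ step g (fun=> K)) => //.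
- by move=> n; apply: measurable_funTS; exact: mstep.
- apply: aeW => x; rewrite /= in_itv /= => x01.
  have [y yP] := choice (fun n => stepE n x01).
  rewrite (_ : (fun n => step n x) = (fun n => g ((y n)%:R / n.+1%:R))); last first.
    by apply/funext => n; have [] := yP n.
  have /andP[x0 x1] := x01.
  apply: cvg_within01.
  + by move=> n; have [yn _ _] := yP n; exact: grid01.
  + by rewrite x0 ltW.
  + apply/cvgrPdist_le => /= e e0.
    have /cvgrPdist_le /(_ e e0) := @cvg_harmonic R.
    apply: filterS => n; rewrite sub0r normrN /harmonic /= ger0_norm// => ne.
    have [_ /andP[y1 y2] _] := yP n.
    rewrite ger0_norm ?subr_ge0// (le_trans _ ne)//.
    move: y2; rewrite -[(y n).+1%:R]natr1 mulrDl mul1r => y2.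
    by rewrite lerBlDl ltW.
- have mg : measurable_fun (`[0%R, 1%R]%classic : set R) g by have /integrableP[/measurable_EFinP] := intg.
  apply: measurable_funS mg => //.
  by move=> x /=; rewrite !in_itv /= => /andP[-> /ltW].
- move=> n x; rewrite /= in_itv /= => x01.
  by have [k [kn _ ->]] := stepE n x01; apply: hK; exact: grid01.
- apply/integrableP; split; first exact: measurable_cst.
  rewrite [X in (X < _)%E](_ : _ = \int[mu]_(x in `[0%R, 1%R[) cst `|K|%:E x)%E//.
  rewrite integral_cst//= lebesgue_measure_itv /= lte_fin ltr01.
  by rewrite -EFinB -EFinM ltry.
Qed.

End riemann_sum.

Lemma within_powR_continuous (R : realType) (a : R) : 0 <= a ->
  {within `[0, 1], continuous (fun l : R => l `^ a)}.
Proof.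
move=> a0; have cp x : 0 < x -> {for x, continuous (fun l : R => l `^ a)}.
  move=> x0; apply/differentiable_continuous/derivable1_diffP.
  by have [] := is_derive1_powR a x0.
apply/continuous_within_itvP; first exact: ltr01.
split.
- by move=> x; rewrite in_itv /= => /andP[x0 _]; exact: cp.
(* The power 0 is constantly 1, also at the origin, whereas positive powers tend to 0 there. *)
- have [->|aN0] := eqVneq a 0.
    by under eq_fun do rewrite powRr0; rewrite powRr0; exact: cvg_cst.
  by rewrite powR0//; apply: powR_cvg0; rewrite lt_neqAle eq_sym aN0.
- by apply: cvg_at_left_filter; exact: cp.
Qed.

(** Multiplying by the conjugate of the integral turns its squared modulus into a real integral;
    separate bounds for the real and imaginary parts would not give the constant [K]. *)
Lemma normc_cint_le d (T : measurableType d) (R : realType) (P : probability T R)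
    (f : T -> R[i]) (K : R) : cmeasurable f -> (forall x, Normc.normc (f x) <= K) ->
  Normc.normc (cint P f) <= K.
Proof.
move=> mf fK; have intf := cintegrable_bounded P mf fK.
have K0 : 0 <= K by rewrite (le_trans _ (fK point)) ?normc_ge0.
set z := cint P f; have [->//|z0] := eqVneq (Normc.normc z) 0.
have zp : 0 < Normc.normc z by rewrite lt_neqAle eq_sym z0 normc_ge0.
rewrite -(ler_pM2l zp).
have -> : Normc.normc z * Normc.normc z = complex.Re (z^*%C * z).
  case: {z0 zp} z => a b /=; rewrite -expr2 sqr_sqrtr ?addr_ge0 ?sqr_ge0//; ring.
rewrite /z -cintZl// -/z.
have -> : complex.Re (cint P (fun x => z^*%C * f x)) = \int[P]_x complex.Re (z^*%C * f x) by [].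
have -> : Normc.normc z * K = \int[P]_x (Normc.normc z * K).
  by rewrite Rintegral_cst// [X in fine X](@probability_setT _ _ _ P) mulr1.
have nz : Normc.normc z^*%C = Normc.normc z by case: (z) => a b /=; rewrite sqrrN.
apply: le_Rintegral => //.
- by have [] := cintegrableZl z^*%C intf.
- exact: finite_measure_integrable_cst.
- move=> x _; apply: (le_trans (ler_norm _)); apply: (le_trans (ler_Re_normc _)).
  by rewrite Normc.normcM nz ler_wpM2l ?normc_ge0.
Qed.

Section brownian_bridge.
Context d (T : measurableType d) (R : realType) (P : probability T R).
Variables (B : R -> T -> R) (alpha : R).
Hypothesis hB : standard_brownian_motion P B.
Hypothesis alpha0 : 0 <= alpha.
Notation mu := (@lebesgue_measure R).

(** The deterministic perturbation [e] is zero for the bridge itself and a multiple of the tent for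
    the Cameron-Martin shift. *)
Definition bridge_integrand (e : R -> R) (w : T) (l : R) : R :=
  l `^ alpha * (B l w - l * B 1 w + e l) ^+ 2.

Definition bridge_int (e : R -> R) (w : T) : R :=
  \int[mu]_(l in `[0, 1]) bridge_integrand e w l.

Lemma bridge_integrand_ge0 e w l : 0 <= bridge_integrand e w l.
Proof. by rewrite mulr_ge0 ?powR_ge0 ?sqr_ge0. Qed.

Lemma bridge_int_ge0 e w : 0 <= bridge_int e w.
Proof. by apply: Rintegral_ge0 => l _; exact: bridge_integrand_ge0. Qed.

Lemma within_path_continuous w : {within `[0, 1], continuous (fun l => B l w)}.
Proof.
have sub : `[0%R, 1%R]%classic `<=` (`[0%R, +oo[%classic : set R).
  by move=> x /=; rewrite !in_itv /= andbT => /andP[].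
exact: (continuous_subspaceW sub (@bm_continuous _ _ _ _ _ hB w)).
Qed.

Lemma within_bridge_continuous w :
  {within `[0, 1], continuous (fun l => B l w - l * B 1 w)}.
Proof.
apply/subspace_continuousP => x x01; apply: cvgB.
  by have /subspace_continuousP := @within_path_continuous w; apply.
apply: cvgM; last exact: cvg_cst.
by apply: cvg_within_filter; exact: cvg_id.
Qed.

Lemma bridge_integrand_continuous (e : R -> R) w : {within `[0, 1], continuous e} ->
  {within `[0, 1], continuous (bridge_integrand e w)}.
Proof.
move=> /subspace_continuousP ce; apply/subspace_continuousP => x x01; apply: cvgM.
  by have /subspace_continuousP := within_powR_continuous alpha0; apply.
have h : (fun l => B l w - l * B 1 w + e l) @ within `[0, 1] (nbhs x) -->
    B x w - x * B 1 w + e x.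
  apply: cvgD; last exact: ce.
  by have /subspace_continuousP := @within_bridge_continuous w; apply.
by under eq_fun do rewrite expr2; rewrite expr2; exact: cvgM.
Qed.

Definition bridge_sum (e : R -> R) (n : nat) (w : T) : R :=
  n.+1%:R^-1 * \sum_(k < n.+1) bridge_integrand e w (k%:R / n.+1%:R).

Lemma bridge_sum_cvg (e : R -> R) w : {within `[0, 1], continuous e} ->
  bridge_sum e n w @[n --> \oo] --> bridge_int e w.
Proof. by move=> ce; apply: riemann_sum_cvg; exact: bridge_integrand_continuous. Qed.

Lemma measurable_bridge_sum e n : measurable_fun setT (bridge_sum e n).
Proof.
apply: measurable_funM => //; apply: measurable_sum => k.
apply: measurable_funM => //; apply: measurable_funX; apply: measurable_funD => //.
apply: measurable_funB; first by apply: (bm_measurable hB); rewrite divr_ge0.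
by apply: measurable_funM => //; exact: (bm_measurable hB).
Qed.

(** Pointwise limit of Riemann sums, each involving finitely many times. *)
Lemma measurable_bridge_int (e : R -> R) : {within `[0, 1], continuous e} ->
  measurable_fun setT (bridge_int e).
Proof.
move=> ce; apply: (@measurable_fun_cvg _ _ _ setT (fun n => bridge_sum e n)) => //.
  by move=> n; exact: measurable_bridge_sum.
by move=> w _; exact: bridge_sum_cvg.
Qed.

Definition incr (n : nat) (i : 'I_n.+1) (w : T) : R :=
  B (i.+1%:R / n.+1%:R) w - B (i%:R / n.+1%:R) w.

Lemma measurable_incr n i : measurable_fun setT (@incr n i).
Proof. by apply: measurable_funB; apply: (bm_measurable hB); rewrite divr_ge0. Qed.

Lemma indep_incr n : mutually_independent P (@incr n).
Proof.
apply: (@bm_independent _ _ _ _ _ hB n.+1 (fun i => i%:R / n.+1%:R)).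
  by rewrite mul0r.
by move=> i _; rewrite ler_pM2r ?invr_gt0 ?ltr0n// ler_nat.
Qed.

Lemma law_incr n i (A : set R) : measurable A ->
  P (@incr n i @^-1` A) = normal_prob 0 (Num.sqrt (n.+1%:R^-1 : R)) A.
Proof.
move=> mA.
have h1 : 0 <= i%:R / n.+1%:R :> R by rewrite divr_ge0.
have h2 : i%:R / n.+1%:R < i.+1%:R / n.+1%:R :> R.
  by rewrite ltr_pM2r ?invr_gt0 ?ltr0n// ltr_nat.
have := @bm_gaussian _ _ _ _ _ hB _ _ h1 h2 A mA.
by rewrite -mulrBl -natrB// subSnn mul1r.
Qed.

Lemma psum_incr n k w : (k <= n.+1)%N ->
  psum k (rvec (@incr n) w) = B (k%:R / n.+1%:R) w - B 0 w.
Proof.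
elim: k => [_|k IH kn]; first by rewrite psum0 mul0r subrr.
rewrite (@psumS _ _ _ (Ordinal kn)) IH 1?ltnW// tnth_mktuple /incr /=; ring.
Qed.

Definition weight (n k : nat) : R := (k%:R / n.+1%:R) `^ alpha.

Lemma bridge_quad_incr n w : B 0 w = 0 ->
  bridge_quad (weight n) (rvec (@incr n) w) = bridge_sum (cst 0) n w.
Proof.
move=> B0; rewrite /bridge_quad /bridge_sum; congr (_ * _); apply: eq_bigr => k _.
have kn : (k <= n.+1)%N by exact: ltnW.
have n0 : n.+1%:R != 0 :> R by rewrite pnatr_eq0.
rewrite (psum_incr _ kn) (psum_incr _ (leqnn _)) B0 !subr0 (divff n0).
by rewrite /bridge_integrand /grid /= addr0.
Qed.

(** The discrete formula holds for each Riemann sum, which almost surely is a quadratic form in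
    independent increments. The transforms converge by dominated convergence, the exponentials being
    bounded by 1 on this half-plane. *)
Lemma bridge_transform (s : R[i]) : 0 <= complex.Re s ->
  let E := cint P (fun w => cexp (- s * (bridge_int (cst 0) w)%:C)) in
  E != 0 /\
  complex.Re (sl_sum alpha s M 1) @[M --> \oo] --> complex.Re (E ^- 2) /\
  complex.Im (sl_sum alpha s M 1) @[M --> \oo] --> complex.Im (E ^- 2).
Proof.
move=> s0 E.
have c0 : {within `[0, 1], continuous (cst 0 : R -> R)}.
  by apply: continuous_subspaceT => x; exact: cvg_cst.
pose q n w := bridge_quad (weight n) (rvec (@incr n) w).
have q0 n w : 0 <= q n w by apply: bridge_quad_ge0 => k; exact: powR_ge0.
have mq n : measurable_fun setT (q n).
  apply: measurableT_comp; first exact: measurable_bridge_quad.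
  exact: (measurable_rvec (@measurable_incr n)).
pose F n w := cexp (- s * (q n w)%:C).
pose G w := cexp (- s * (bridge_int (cst 0) w)%:C).
have mF n : cmeasurable (F n).
  apply: cmeasurable_exp; apply: cmeasurableM; first exact: cmeasurable_cst.
  exact: cmeasurable_real.
have mG : cmeasurable G.
  apply: cmeasurable_exp; apply: cmeasurableM; first exact: cmeasurable_cst.
  by apply: cmeasurable_real; exact: measurable_bridge_int.
have n1 x : 0 <= x -> Normc.normc (cexp (- s * x%:C)) <= 1.
  move=> x0; rewrite normc_cexp RecM RecN /= mulr0 subr0 -expR0 ler_expR mulNr oppr_le0.
  exact: mulr_ge0.
pose E_ n := cint P (F n).
have E1 n : Normc.normc (E_ n) <= 1.
  by apply: normc_cint_le => // w; exact: n1.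
have ae : {ae P, forall w, [set: T] w -> q n w @[n --> \oo] --> bridge_int (cst 0) w}.
  apply: filterS (bm_start hB) => w B0 _.
  rewrite (_ : (fun n => q n w) = (fun n => bridge_sum (cst 0) n w)); last first.
    by apply/funext => n; exact: bridge_quad_incr.
  exact: bridge_sum_cvg.
have cF (f g : R -> R) : continuous f -> continuous g -> forall a b : R,
    {ae P, forall w, [set: T] w -> f (a * q n w) * g (b * q n w) @[n --> \oo] -->
      f (a * bridge_int (cst 0) w) * g (b * bridge_int (cst 0) w)}.
  move=> cf cg a b; apply: filterS ae => w h _; have {}h := h I.
  have k (c : R) : c * q n w @[n --> \oo] --> c * bridge_int (cst 0) w.
    exact: (cvgM (cvg_cst c) h).
  by apply: cvgM; [exact: (cvg_comp _ _ (k a) (cf _))|exact: (cvg_comp _ _ (k b) (cg _))].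
have FE x : complex.Re (cexp (- s * x%:C)) =
    expR (- complex.Re s * x) * cos (- complex.Im s * x) /\
    complex.Im (cexp (- s * x%:C)) =
    expR (- complex.Re s * x) * sin (- complex.Im s * x).
  by rewrite /cexp /= RecM ImcM RecN ImcN /= !mulr0 subr0 add0r.
have ReE : complex.Re (E_ n) @[n --> \oo] --> complex.Re E.
  apply: (@cvg_Rintegral_dominated _ _ _ P setT (fun n w => complex.Re (F n w))
     (fun w => complex.Re (G w)) (fun=> 1)) => //.
  - by move=> n; have [] := mF n.
  - rewrite /F /G; have := cF _ _ (@continuous_expR R) (@continuous_cos R)
      (- complex.Re s) (- complex.Im s).
    apply: filterS => w h _; rewrite (FE _).1.
    by under eq_fun do rewrite (FE _).1; exact: h.
  - by have [] := mG.
  - by move=> n w _; apply: le_trans (ler_Re_normc _) (n1 _ (q0 n w)).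
  - exact: finite_measure_integrable_cst.
have ImE : complex.Im (E_ n) @[n --> \oo] --> complex.Im E.
  apply: (@cvg_Rintegral_dominated _ _ _ P setT (fun n w => complex.Im (F n w))
     (fun w => complex.Im (G w)) (fun=> 1)) => //.
  - by move=> n; have [] := mF n.
  - rewrite /F /G; have := cF _ _ (@continuous_expR R) (@continuous_sin R)
      (- complex.Re s) (- complex.Im s).
    apply: filterS => w h _; rewrite (FE _).2.
    by under eq_fun do rewrite (FE _).2; exact: h.
  - by have [] := mG.
  - by move=> n w _; apply: le_trans (ler_Im_normc _) (n1 _ (q0 n w)).
  - exact: finite_measure_integrable_cst.
have Erec (n : nat) (dd : nat -> R[i]) :
  dd n.+1 = 0 -> dd n = (n.+1%:R^-1)%:C ->
  (forall k, (k < n)%N -> dd k =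
    (2 + 2 * s * (n.+1%:R^-1 ^+ 2 * (k.+1%:R / n.+1%:R) `^ alpha)%:C) * dd k.+1 - dd k.+2) ->
  E_ n ^+ 2 * dd 0%N = 1.
  move=> dN dn dS.
  apply: (discrete_bridge_transform (@measurable_incr n) (@indep_incr n) (@law_incr n) s0 _ dN dn dS).
  by move=> k; exact: powR_ge0.
split; first exact: transform_limit_neq0 alpha0 E1 ReE ImE Erec.
exact: transform_limit alpha0 E1 ReE ImE Erec.
Qed.

End brownian_bridge.

(** * Identification with the Bessel function *)

Section gamma_function.
Context {R : realType}.
Notation mu := (@lebesgue_measure R).
Implicit Types p x s : R.

(** Half of the exponential decay absorbs the power: beyond 1, [p] is raised to an integer and a
    single Taylor term of the exponential is used. *)
Lemma powR_expR_dominated p : 0 <= p -> exists2 C, 0 <= C &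
  forall s, 0 <= s -> s `^ p * expR (- s) <= C * expR (- (s / 2)).
Proof.
move=> p0; pose n := Num.truncn p.
have pn : p <= n.+1%:R by have /andP[_ /ltW] := truncn_itv p0.
pose C := 1 + 2 ^+ n.+1 * n.+1`!%:R : R.
have C1 : 1 <= C by rewrite lerDl mulr_ge0// exprn_ge0.
exists C; first exact: le_trans C1.
move=> s s0; have -> : expR (- s) = expR (- (s / 2)) * expR (- (s / 2)).
  by rewrite -expRD; congr expR; field.
rewrite mulrA ler_wpM2r ?expR_ge0//.
rewrite expRN ler_pdivrMr ?expR_gt0//.
have e1 : 1 <= expR (s / 2) by rewrite -expR0 ler_expR divr_ge0.
have [s1|s1] := leP s 1.
  apply: (@le_trans _ _ 1); first exact: powR_le1.
  by rewrite mulr_ege1.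
have sp : s `^ p <= s ^+ n.+1.
  by rewrite -powR_mulrn//; apply: ler_powR => //; exact: ltW.
apply: (le_trans sp).
have s20 : 0 <= s / 2 by rewrite divr_ge0.
have := @expR_ge1Dxn R (s / 2) n s20.
have f0 : (0 : R) < n.+1`!%:R by rewrite ltr0n fact_gt0.
have -> : s ^+ n.+1 = 2 ^+ n.+1 * n.+1`!%:R * ((s / 2) ^+ n.+1 / n.+1`!%:R).
  rewrite mulrA -[X in X / _]mulrA [_ * (s / 2) ^+ _]mulrC mulrA mulfK ?gt_eqF//.
  by rewrite -exprMn mulrC divfK.
move=> h; apply: (@le_trans _ _ (2 ^+ n.+1 * n.+1`!%:R * expR (s / 2))).
  by rewrite ler_wpM2l ?mulr_ge0 ?exprn_ge0// (le_trans _ h)// lerDr.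
by rewrite ler_wpM2r ?expR_ge0// lerDr.
Qed.

Let itv0y : set (measurableTypeR R) := `]0, +oo[%classic.

Let mitv0y : measurable itv0y. Proof. exact: measurable_itv. Qed.

Let integrable_itv0y (f : R -> R) : mu.-integrable setT (EFin \o f) ->
  mu.-integrable itv0y (EFin \o f).
Proof. exact: integrableS. Qed.

Lemma integrable_expR_half : mu.-integrable itv0y (EFin \o (fun s => expR (- (s / 2)))).
Proof.
have h : mu.-integrable setT (EFin \o exponential_pdf (2^-1 : R)).
  by apply: integrable_exponential_pdf; rewrite invr_gt0.
have : mu.-integrable itv0y (EFin \o (fun s => 2 * exponential_pdf 2^-1 s)).
  by apply: RintegrableZl => //; exact: integrable_itv0y.
apply: eq_integrable => // s /set_mem; rewrite /itv0y /= in_itv /= andbT => s0.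
congr EFin; rewrite exponential_pdfE ?ltW//= mulrA divff// mul1r.
by congr expR; rewrite mulNr mulrC.
Qed.

Lemma measurable_gamma_integrand p : measurable_fun setT (fun s => s `^ p * expR (- s)).
Proof.
apply: measurable_funM; first exact: measurable_powR.
by apply: measurableT_comp => //; exact: measurableT_comp.
Qed.

Lemma integrable_gamma p : 0 <= p ->
  mu.-integrable itv0y (EFin \o (fun s => s `^ p * expR (- s))).
Proof.
move=> p0; have [C C0 hC] := powR_expR_dominated p0.
apply: (@integrable_dominated _ (measurableTypeR R) R mu itv0y (fun s => s `^ p * expR (- s)) (fun s => C * expR (- (s / 2)))) => //.
- by apply: measurable_funTS; exact: measurable_gamma_integrand.
- move=> s; rewrite /itv0y /= in_itv /= andbT => s0.
  rewrite ger0_norm ?mulr_ge0 ?powR_ge0 ?expR_ge0//; exact: hC (ltW s0).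
- by apply: RintegrableZl => //; exact: integrable_expR_half.
Qed.

Lemma Gamma_gt0 x : 1 <= x -> 0 < Gamma x.
Proof.
move=> x1; have x10 : 0 <= x - 1 by rewrite subr_ge0.
apply: (@lt_le_trans _ _ (expR (- 2))); first exact: expR_gt0.
pose f (s : R) : R := expR (- 2) * \1_(`[1, 2]%classic : set R) s.
have -> : expR (- 2) = \int[mu]_(s in itv0y) f s :> R.
  rewrite RintegralZl//; last first.
    by exact: (integrable_itv0y (integrable_indic_itv 1 2 true false)).
  rewrite /Rintegral integral_indic//= (_ : _ `&` _ = `[1, 2]%classic).
    by rewrite lebesgue_measure_itv /= lte_fin ltr1n /= -[2]/(1 + 1) addrK mulr1.
  apply/seteqP; split => s /=; rewrite !in_itv /=; first by case.
  move=> /andP[s1 s2]; rewrite /itv0y s1 s2; split => //; rewrite /= in_itv /= andbT.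
  exact: lt_le_trans s1.
apply: le_Rintegral => //.
- apply: RintegrableZl => //.
  by exact: (integrable_itv0y (integrable_indic_itv 1 2 true false)).
- exact: integrable_gamma.
- move=> s; rewrite /itv0y /= in_itv /= andbT => s0; rewrite /f indicE.
  have [/set_mem /=|_] := boolP (s \in _); last by rewrite mulr0 mulr_ge0 ?powR_ge0 ?expR_ge0.
  rewrite in_itv /= mulr1 => /andP[s1 s2].
  rewrite -[leLHS]mul1r ler_pM ?expR_ge0//; last by rewrite ler_expR lerN2.
  by have := @ler_powR R s s1 _ _ x10; rewrite powRr0.
Qed.

(** The integrand is the derivative of the power [x] times [exp (- s)], which vanishes at both ends.
    With [1 < x] it is continuous up to 0, so the fundamental theorem applies on [[0, n]]; every
    argument met in the Bessel series is above 1. *)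
Lemma Rintegral_derive_gamma x : 1 < x ->
  \int[mu]_(s in itv0y) (x * (s `^ (x - 1) * expR (- s)) - s `^ x * expR (- s)) = 0.
Proof.
move=> x1; have x0 : 0 < x by exact: lt_trans x1.
have x10 : 0 < x - 1 by rewrite subr_gt0.
pose f (s : R) : R := x * (s `^ (x - 1) * expR (- s)) - s `^ x * expR (- s).
pose F (s : R) : R := s `^ x * expR (- s).
have i1 : mu.-integrable itv0y (EFin \o (fun s => x * (s `^ (x - 1) * expR (- s)))).
  by apply: RintegrableZl => //; apply: integrable_gamma; exact: ltW.
have i2 : mu.-integrable itv0y (EFin \o (fun s => s `^ x * expR (- s))).
  by apply: integrable_gamma; exact: ltW.
have if_ : mu.-integrable itv0y (EFin \o f) by exact: (integrableB _ i1 i2).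
have mf : measurable_fun setT f.
  apply: measurable_funB; last exact: measurable_gamma_integrand.
  by apply: measurable_funM => //; exact: measurable_gamma_integrand.
have ifn : mu.-integrable itv0y (EFin \o (fun s => `|f s|)).
  exact: (integrable_abse if_).
pose f_ (n : nat) := f \_ (`]0, n%:R] : set R).
have c1 : \int[mu]_(s in itv0y) f_ n s @[n --> \oo] --> \int[mu]_(s in itv0y) f s.
  apply: (@cvg_Rintegral_dominated _ _ _ mu itv0y f_ f (fun s => `|f s|)) => //.
  - move=> n; apply: measurable_funTS; apply/(measurable_restrictT _ _).1 => //.
    exact: measurable_funTS.
  - apply: aeW => s; rewrite /itv0y /= in_itv /= andbT => s0; apply: cvg_near_cst.
    near=> n; rewrite /f_ patchE mem_set//= in_itv /= s0 /=.
    rewrite (le_trans (ler_norm _))//; near: n; exact: nbhs_infty_ger.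
  - exact: measurable_funTS.
  - by move=> n s _; rewrite /f_ patchE; case: ifP => // _; rewrite normr0.
have [C C0 hC] := powR_expR_dominated (ltW x0).
have F0 : F n%:R @[n --> \oo] --> 0.
  have c : C * expR (- 2^-1) ^+ n @[n --> \oo] --> 0.
    rewrite -(mulr0 C); apply: cvgM; first exact: cvg_cst.
    by apply: cvg_expr; rewrite ger0_norm ?expR_ge0// expR_lt1 oppr_lt0 invr_gt0.
  apply: (squeeze_cvgr _ (cvg_cst 0) c); apply: nearW => n.
  rewrite mulr_ge0 ?powR_ge0 ?expR_ge0//= -expRM_natl.
  by rewrite (le_trans (hC _ _))// mulrN.
have dF s : 0 < s -> is_derive s 1 F (f s).
  move=> s0; have e := is_derive1_comp (is_derive_expR (- s)) (is_deriveN (is_derive_id s (1:R))).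
  have := is_deriveM (is_derive1_powR x s0) e.
  by move/is_derive_eq; apply; rewrite /f -![_ *: _]/(_ * _) /=; ring.
have rc p : 0 < p -> (s `^ p * expR (- s)) @[s --> 0^'+] --> (0 : R) `^ p * expR (- 0).
  move=> p0; apply: cvgM; first by rewrite powR0 ?gt_eqF//; exact: powR_cvg0.
  apply: cvg_at_right_filter; apply: (@continuous_comp _ _ _ (fun s : R => - s) expR).
    exact: oppr_continuous.
  exact: continuous_expR.
have fc s : 0 < s -> {for s, continuous f}.
  move=> s0; have h p : {for s, continuous (fun s : R => s `^ p * expR (- s))}.
    have hc : {for s, continuous (fun s : R => s `^ p)}.
      apply/differentiable_continuous/derivable1_diffP.
      by have [] := is_derive1_powR p s0.
    have he : {for s, continuous (fun s : R => expR (- s))}.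
      apply: (@continuous_comp _ _ _ (fun s : R => - s) expR).
        exact: oppr_continuous.
      exact: continuous_expR.
    exact: (cvgM hc he).
  apply: cvgB; last exact: h.
  by apply: cvgM; [exact: cvg_cst|exact: h].
have c2 : \int[mu]_(s in itv0y) f_ n s @[n --> \oo] --> 0.
  rewrite (_ : (fun n => \int[mu]_(s in itv0y) f_ n s) = (fun n => F n%:R))//.
  apply/funext => n; rewrite /f_ -Rintegral_mkcondr.
  rewrite (_ : itv0y `&` _ = `]0, n%:R]%classic); last first.
    apply/seteqP; split => s /=; rewrite !in_itv /=; first by case.
    by move=> /andP[s0 sn]; rewrite /itv0y /= in_itv /= s0 sn.
  have [->|n0] := eqVneq n 0%N.
    by rewrite set_itvoc0 ?Rintegral_set0 /F ?powR0 ?mul0r ?gt_eqF//.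
  have ab : 0 < n%:R :> R by rewrite ltr0n lt0n.
  have cf : {within `[0, n%:R], continuous f}.
    apply/continuous_within_itvP => //; split.
    - by move=> s; rewrite in_itv /= => /andP[s0 _]; exact: fc.
    - apply: cvgB; last exact: rc.
      by apply: cvgM; [exact: cvg_cst|exact: rc].
    - by apply: cvg_at_left_filter; exact: fc.
  rewrite Rintegral_itv_obnd_cbnd; last first.
    apply: (@integrableS _ _ _ mu `[0, n%:R]%classic) => //.
      by move=> s /=; rewrite !in_itv /= => /andP[/ltW -> ->].
    by apply: continuous_compact_integrable => //; exact: segment_compact.
  rewrite /Rintegral (@continuous_FTC2 _ f F)//.
  - by rewrite /= {2}/F powR0 ?gt_eqF// mul0r subr0.
  - split => [s||].
    + by rewrite in_itv /= => /andP[s0 _]; have [] := dF s s0.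
    + exact: rc.
    + apply: cvg_at_left_filter; apply/differentiable_continuous/derivable1_diffP.
      by have [] := dF _ ab.
  - move=> s; rewrite in_itv /= => /andP[s0 _]; rewrite derive1E.
    by have [] := dF s s0.
exact: (cvg_unique _ c1 c2).
Unshelve. all: end_near. Qed.

Lemma GammaS x : 1 < x -> Gamma (x + 1) = x * Gamma x.
Proof.
move=> x1; have x0 : 0 < x by exact: lt_trans x1.
have i1 : mu.-integrable itv0y (EFin \o (fun s => s `^ (x - 1) * expR (- s))).
  by apply: integrable_gamma; rewrite subr_ge0 ltW.
have i2 : mu.-integrable itv0y (EFin \o (fun s => s `^ x * expR (- s))).
  by apply: integrable_gamma; exact: ltW.
have := Rintegral_derive_gamma x1.
rewrite RintegralB//; last exact: RintegrableZl.
rewrite RintegralZl// /Gamma addrK => /eqP; rewrite subr_eq0 => /eqP <-//.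
Qed.

End gamma_function.

Section bessel.
Context {R : realType}.
Implicit Types (t : R) (z : R[i]).

(** Both powers use the same argument of [z], so the branch cut has no effect on the product. *)
Lemma cpowRN_mul z (g : R) : z != 0 -> cpowR z g * cpowR z (- g) = 1.
Proof.
move=> z0; have n0 : Normc.normc z != 0.
  by apply: contra_neq z0 => h; exact: Normc.eq0_normc.
rewrite /cpowR powRN mulNr cosN sinN.
set a := _ `^ g; set c := cos _; set s := sin _.
have a0 : a != 0 by rewrite /a powR_eq0 (negbTE n0).
have cs : c ^+ 2 + s ^+ 2 = 1 by exact: cos2Dsin2.
have -> : a%:C * (c +i* s) * ((a^-1)%:C * (c -i* s)) =
   (a * a^-1)%:C * ((c +i* s) * (c -i* s)) by rewrite rmorphM; ring.
rewrite divff// mul1r; simpc.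
by apply/eqP; rewrite eq_complex /=; apply/andP; split; apply/eqP; [rewrite -cs; ring | ring].
Qed.

(** Induction on [k]: the divisor in the recursion of [sl_coef] factors as
    [(k + 1) (k + g + 1) (alpha + 2) ^ 2], which matches the factorial and the functional equation
    of Gamma. *)
Lemma sl_coef_Gamma (alpha : R) (k : nat) : 0 <= alpha -> let g := (alpha + 2)^-1 in
  Gamma (g + 1) / (k`!%:R * Gamma (k%:R + g + 1)) = sl_coef alpha k * (alpha + 2) ^+ (2 * k).
Proof.
move=> a0 g; have a2 : 0 < alpha + 2 by lra.
have g0 : 0 < g by rewrite invr_gt0.
have G0 j : 0 < Gamma (j%:R + g + 1).
  by apply: Gamma_gt0; rewrite lerDr addr_ge0// ltW.
elim: k => [|k IH].
  have := G0 0%N; rewrite /= fact0 add0r !mul1r => h.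
  by rewrite mulfV ?gt_eqF// muln0 expr0.
have -> : Gamma (k.+1%:R + g + 1) = (k%:R + g + 1) * Gamma (k%:R + g + 1).
  rewrite -GammaS; last first.
    have k0 : (0 : R) <= k%:R by [].
    by move: g0 k0; move: (g) (k%:R : R) => g' k'; lra.
  by congr Gamma; rewrite -natr1; ring.
have := IH; have := G0 k; have := sl_coef_gt0 a0 k.
rewrite /= factS natrM mulnS exprD sl_expS.
have -> : sl_exp alpha k + (alpha + 2) - 1 = k.+1%:R * (alpha + 2).
  by rewrite /sl_exp -natr1; ring.
have -> : sl_exp alpha k + (alpha + 2) = (k%:R + g + 1) * (alpha + 2).
  by rewrite /sl_exp /g; field; rewrite gt_eqF.
have k1 : 0 < k%:R + g + 1 by rewrite ltr_wpDl// addr_ge0// ltW.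
have k2 : (0 : R) < k.+1%:R by rewrite ltr0n.
have k3 : (0 : R) < k`!%:R by rewrite ltr0n fact_gt0.
move: (sl_coef _ _) (Gamma (k%:R + g + 1)) (Gamma (g + 1)) => c G G1 c0 G0' E.
have -> : G1 = c * (alpha + 2) ^+ (2 * k) * (k`!%:R * G).
  by rewrite -E divfK// mulf_neq0 ?gt_eqF.
move: ((alpha + 2) ^+ (2 * k)) => X.
move: k1 k2 k3 a2; move: (k%:R + g + 1) (k.+1%:R : R) (k`!%:R : R) (alpha + 2) => u v y b.
move=> /gt_eqF /negbT u0 /gt_eqF /negbT v0 /gt_eqF /negbT y0 /gt_eqF /negbT b0.
by move: G0' => /gt_eqF /negbT G0'; field; rewrite u0 v0 y0 b0 G0'.
Qed.

Lemma csqrt_sqr t : csqrt t ^+ 2 = t%:C.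
Proof.
rewrite /csqrt; have [t0|t0] := leP 0 t.
  by rewrite -rmorphXn /= sqr_sqrtr.
have -> : (0 +i* Num.sqrt `|t|) ^+ 2 = (- Num.sqrt `|t| ^+ 2)%:C :> R[i].
  by rewrite expr2; simpc; rewrite -expr2.
by rewrite sqr_sqrtr// ltr0_norm// opprK.
Qed.

(** Since [z ^ 2 = 2 i t / (alpha + 2) ^ 2], the sign [(-1) ^ k] turns the Bessel terms into those
    of the series for [s = - i t], and the prefactor of the Bessel function is cancelled by the
    negative power of [z]. *)
Lemma bessel_transform (alpha t : R) (E : R[i]) : 0 <= alpha -> t != 0 -> E != 0 ->
  complex.Re (sl_sum alpha (0 +i* (- t)) M 1) @[M --> \oo] --> complex.Re (E ^- 2) ->
  complex.Im (sl_sum alpha (0 +i* (- t)) M 1) @[M --> \oo] --> complex.Im (E ^- 2) ->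
  let z : R[i] := (1 +i* 1) * csqrt t / (alpha + 2)%:C in
  (Gamma ((alpha + 3) / (alpha + 2)))%:C *
    besselJ (alpha + 2)^-1 (2 * z) * cpowR z (- (alpha + 2)^-1) * E ^+ 2 = 1.
Proof.
move=> a0 t0 E0 cR cI z; have a2 : 0 < alpha + 2 by lra.
have aC : (alpha + 2)%:C != 0 :> R[i] by rewrite (fmorph_eq0 (real_complex R)) gt_eqF.
set g := (alpha + 2)^-1.
have g0 : 0 < g by rewrite invr_gt0.
have z2 : z ^+ 2 = 2 * (0 +i* t) / (alpha + 2)%:C ^+ 2.
  rewrite /z !exprMn csqrt_sqr exprVn; congr (_ / _).
  rewrite (_ : (2 : R[i]) = (2 : R)%:C); last by rewrite rmorph_nat.
  by rewrite expr2; simpc; apply/eqP; rewrite eq_complex /=; apply/andP; split; apply/eqP; ring.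
have z0 : z != 0.
  apply: contra_neq t0 => zE; move: z2; rewrite zE expr0n /= => /esym/eqP.
  rewrite mulf_eq0 invr_eq0 expf_eq0 (negbTE aC) andbF orbF mulf_eq0 pnatr_eq0 /=.
  by rewrite eq_complex /= => /andP[_ /eqP].
have gE : (alpha + 3) / (alpha + 2) = g + 1 by rewrite /g; field; rewrite gt_eqF.
rewrite gE /besselJ.
have -> : 2 * z / 2 = z by rewrite mulrAC divff ?mul1r// pnatr_eq0.
set u := fun k : nat => _.
have GG : 0 < Gamma (g + 1) by apply: Gamma_gt0; rewrite lerDr ltW.
have uE k : (Gamma (g + 1))%:C * u k = sl_term alpha (0 +i* (- t)) k 1.
  rewrite /u /sl_term powR1 mulr1 exprM z2 mulrA -rmorphM /=.
  have -> : Gamma (g + 1) * ((-1) ^+ k / (k`!%:R * Gamma (k%:R + g + 1))) =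
    (-1) ^+ k * (sl_coef alpha k * (alpha + 2) ^+ (2 * k)).
    by rewrite -sl_coef_Gamma//; ring.
  rewrite expr_div_n -exprM rmorphM rmorphXn rmorphN1 rmorphM rmorphXn /=.
  have -> : 2 * (0 +i* - t) = (-1) * (2 * (0 +i* t)) :> R[i].
    by rewrite mulrCA; congr (_ * _); rewrite mulN1r; simpc.
  rewrite [(-1 * _) ^+ k]exprMn.
  have : (alpha + 2)%:C ^+ (2 * k) != 0 :> R[i] by rewrite expf_neq0.
  move: ((alpha + 2)%:C ^+ (2 * k)) ((2 * (0 +i* t)) ^+ k) ((-1) ^+ k) (sl_coef alpha k)%:C => x y w v x0.
  by field.
have serE M : (Gamma (g + 1))%:C * (series u M.+1) = sl_sum alpha (0 +i* (- t)) M 1.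
  rewrite /series /= big_mkord mulr_sumr /sl_sum; apply: eq_bigr => k _; exact: uE.
have ReS n : series (fun k => complex.Re (u k)) n = complex.Re (series u n).
  by rewrite /series /=; elim/big_ind2 : _ => // x y x' y' -> ->; rewrite RecD.
have ImS n : series (fun k => complex.Im (u k)) n = complex.Im (series u n).
  by rewrite /series /=; elim/big_ind2 : _ => // x y x' y' -> ->; rewrite ImcD.
have key (f : R[i] -> R) (v : nat -> R) : (forall (c : R) z, f (c%:C * z) = c * f z) ->
    (forall n, v n = f (series u n)) ->
    f (sl_sum alpha (0 +i* (- t)) M 1) @[M --> \oo] --> f (E ^- 2) ->
    limn v = (Gamma (g + 1))^-1 * f (E ^- 2).
  (* [sl_sum] at [M] has [M.+1] terms, whence the shift by one. *)
  move=> fZ vE cf; apply/cvg_lim => //; rewrite -(cvg_shiftn 1).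
  have : (Gamma (g + 1))^-1 * f (sl_sum alpha (0 +i* (- t)) M 1) @[M --> \oo] -->
     (Gamma (g + 1))^-1 * f (E ^- 2) by apply: cvgM => //; exact: cvg_cst.
  apply: cvg_trans; apply: near_eq_cvg; apply: nearW => n.
  by rewrite /= addn1 vE -serE fZ mulrA mulVf ?mul1r// gt_eqF.
have -> : cseries_sum u = (Gamma (g + 1))^-1%:C * E ^- 2.
  rewrite /cseries_sum (key _ _ _ ReS cR); last by move=> c x; rewrite RecM /= mul0r subr0.
  rewrite (key _ _ _ ImS cI); last by move=> c x; rewrite ImcM /= mul0r addr0.
  by apply: complex_ext; rewrite ?RecM ?ImcM /= mul0r ?subr0 ?addr0.
have -> : (Gamma (g + 1))%:C * (cpowR z g * ((Gamma (g + 1))^-1%:C * E ^- 2)) *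
    cpowR z (- g) * E ^+ 2 = ((Gamma (g + 1))%:C * (Gamma (g + 1))^-1%:C) *
    (cpowR z g * cpowR z (- g)) * (E ^- 2 * E ^+ 2) by ring.
by rewrite cpowRN_mul// -rmorphM /= divff ?gt_eqF// mulVf ?expf_neq0// !mulr1.
Qed.

End bessel.

(** Each of the [m] divisors is at most the square of [(alpha + 2) * M.+1]. With [M] of order
    [sqrt s], the single term [M] then already grows like [exp (c sqrt s)]. *)
Lemma sl_coef_ge (R : realType) (alpha : R) (M m : nat) : 0 <= alpha -> (m <= M)%N ->
  (((alpha + 2) * M.+1%:R) ^- 2) ^+ m <= sl_coef alpha m.
Proof.
move=> a0; have a2 : 0 < alpha + 2 by lra.
have M0 : (0 : R) < M.+1%:R by rewrite ltr0n.
have b0 : 0 < (alpha + 2) * M.+1%:R by rewrite mulr_gt0.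
elim: m => [_|m IH mM]; first by rewrite expr0.
have -> : sl_coef alpha m.+1 = (sl_exp alpha m.+1 * (sl_exp alpha m.+1 - 1))^-1 * sl_coef alpha m.
  by rewrite mulrC.
have x0 : 0 <= ((alpha + 2) * M.+1%:R) ^- 2 by rewrite invr_ge0 exprn_ge0// ltW.
rewrite exprS; apply: ler_pM => //; [exact: exprn_ge0| |exact/IH/ltnW].
have e3 := sl_expS_ge3 a0 m.
rewrite lef_pV2 ?posrE ?exprn_gt0 ?mulr_gt0//; [|lra|lra].
have mM' : m.+1%:R + 1 <= M.+1%:R :> R by rewrite natr1 ler_nat.
have h : sl_exp alpha m.+1 <= (alpha + 2) * M.+1%:R.
  rewrite /sl_exp mulrC; apply: (@le_trans _ _ ((alpha + 2) * (m.+1%:R + 1))).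
    by rewrite mulrDr mulr1 lerD2l; lra.
  by rewrite ler_pM2l.
rewrite expr2 ler_pM//; lra.
Qed.

(** * Small balls and tails *)

Section tails.
Context d (T : measurableType d) (R : realType) (P : probability T R).
Variables (B : R -> T -> R) (alpha : R).
Hypothesis hB : standard_brownian_motion P B.
Hypothesis alpha0 : 0 <= alpha.

Definition bridge_sq (w : T) : R := bridge_int B alpha (cst 0) w.
Notation Q := bridge_sq.

Lemma bridge_sq_ge0 w : 0 <= Q w. Proof. exact: bridge_int_ge0. Qed.

Lemma measurable_bridge_sq : measurable_fun setT Q.
Proof.
apply: (measurable_bridge_int hB alpha0); apply: continuous_subspaceT => x; exact: cvg_cst.
Qed.

Lemma sl_sum_real (s : R) M : sl_sum alpha s%:C M 1 =
  (\sum_(m < M.+1) sl_coef alpha m * (2 * s) ^+ m)%:C.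
Proof.
rewrite rmorph_sum; apply: eq_bigr => m _ /=.
rewrite /sl_term powR1 mulr1 rmorphM rmorphXn rmorphM /=.
by congr (_ * (_ * _) ^+ _); rewrite rmorph_nat.
Qed.

(* For real [s] the series has nonnegative terms, each bounded by its limit
   [E ^- 2]. *)
Lemma laplace_bridge_le (s : R) M : 0 <= s ->
  sl_coef alpha M * (2 * s) ^+ M * (\int[P]_w expR (- s * Q w)) ^+ 2 <= 1.
Proof.
move=> s0; have s0' : 0 <= complex.Re s%:C by [].
have [] := bridge_transform hB alpha0 s0'.
have -> : cint P (fun w => cexp (- s%:C * (bridge_int B alpha (cst 0) w)%:C)) =
    (\int[P]_w expR (- s * Q w))%:C.
  have e w : cexp (- s%:C * (bridge_int B alpha (cst 0) w)%:C) = (expR (- s * Q w))%:C.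
    by rewrite -rmorphN -rmorphM cexp_real.
  rewrite (eq_cint P e); apply: complex_ext => //=.
  by rewrite Rintegral_cst// mul0r.
set E := \int[P]_w _ => E0 [cR _].
have {}E0 : E != 0 by move: E0; rewrite (fmorph_eq0 (real_complex R)).
have E2 : 0 < E ^+ 2 by rewrite exprn_even_gt0.
rewrite -ler_pdivlMr// div1r.
move: cR; under eq_fun do rewrite sl_sum_real /=.
rewrite -rmorphXn -fmorphV /= => cR.
have t0 m : 0 <= sl_coef alpha m * (2 * s) ^+ m.
  by rewrite mulr_ge0 ?exprn_ge0 ?mulr_ge0// ltW// sl_coef_gt0.
have nd : nondecreasing_seq (fun M => \sum_(m < M.+1) sl_coef alpha m * (2 * s) ^+ m).
  by apply/nondecreasing_seqP => n; rewrite [leRHS]big_ord_recr lerDl.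
have := nondecreasing_cvgn_le nd (cvgP _ cR) M; rewrite (cvg_lim _ cR)//.
by apply: le_trans; rewrite big_ord_recr/= lerDr sumr_ge0.
Qed.

(** Chernoff bound: the probability is at most [exp (s / t)] times the transform, which is at most
    [exp (- M)] for [s] of order [M ^ 2]. With [M] proportional to [t], cost and gain are both
    linear in [t]. *)
Lemma bridge_small_ball : exists C c : R, [/\ 0 <= C, 0 < c & forall t : R, 1 <= t ->
  (P [set w | (Q w <= t^-1)%R] <= (expR (C - c * t))%:E)%E].
Proof.
pose b := alpha + 2; have b0 : 0 < b by rewrite /b; have h := alpha0; lra.
pose c0 := expR 2 / 2 * b ^+ 2; have c00 : 0 < c0 by rewrite mulr_gt0 ?divr_gt0 ?expR_gt0 ?exprn_gt0.
(* With this slope the cost [s / t] is about [de * t / 2], half of the gain [M], which is about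
   [de * t]. *)
pose de := (2 * c0)^-1; have de0 : 0 < de by rewrite invr_gt0 mulr_gt0.
exists (c0 + 2), (de / 2); split; [lra|lra|move=> t t1].
have t0 : 0 < t by lra.
pose M := Num.truncn (de * t).
have /andP[M1 M2] : M%:R <= de * t < M.+1%:R by apply: truncn_itv; rewrite mulr_ge0 ?ltW.
(* With this [s], the [M]-th term of the series is at least [e ^ (2 M)]. *)
pose s := c0 * M.+1%:R ^+ 2.
have s0 : 0 <= s by rewrite mulr_ge0 ?exprn_ge0 ?ltW.
have E0 : 0 <= \int[P]_w expR (- s * Q w) by apply: Rintegral_ge0 => w _; exact: expR_ge0.
have EM : \int[P]_w expR (- s * Q w) <= expR (- M%:R).
  rewrite -(ler_pXn2r (n := 2)) ?nnegrE ?expR_ge0//.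
  have := laplace_bridge_le M s0; have := sl_coef_ge alpha0 (leqnn M); rewrite -/b.
  have -> : 2 * s = expR 2 * (b * M.+1%:R) ^+ 2.
    by rewrite /s /c0; field.
  set x := (b * _) ^+ 2 => h1 h2.
  have x0 : 0 < x by rewrite exprn_gt0// mulr_gt0// ltr0n.
  have h3 : (expR 2) ^+ M <= sl_coef alpha M * (expR 2 * x) ^+ M.
    rewrite exprMn mulrCA ler_peMr ?exprn_ge0 ?expR_ge0//.
    by move: h1; rewrite exprVn -div1r ler_pdivrMr// exprn_gt0.
  have h4 : expR 2 ^+ M * (\int[P]_w expR (- s * Q w)) ^+ 2 <= 1.
    by apply: le_trans h2; rewrite ler_wpM2r// exprn_ge0.
  rewrite -ler_pdivlMl ?exprn_gt0 ?expR_gt0// mulr1 in h4; apply: le_trans h4 _.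
  by rewrite -!expRM_natl -expRN ler_expR; lra.
have mE : measurable_fun setT (fun w => expR (- s * Q w)).
  by apply: measurableT_comp => //; apply: measurable_funM => //; exact: measurable_bridge_sq.
have iE : P.-integrable setT (EFin \o (fun w => expR (- s * Q w))).
  apply: (@integrable_bounded _ _ _ P _ 1) => // w.
  by rewrite ger0_norm ?expR_ge0// -expR0 ler_expR mulNr oppr_le0 mulr_ge0// bridge_sq_ge0.
have mA : measurable [set w | Q w <= t^-1].
  rewrite (_ : [set w | _] = Q @^-1` `]-oo, t^-1]%classic); last by apply/seteqP; split => w /=; rewrite in_itv.
  by rewrite -[X in measurable X]setTI; apply: measurable_bridge_sq.
have -> : P [set w | Q w <= t^-1] = (\int[P]_w (\1_[set w | (Q w <= t^-1)%R] w)%:E)%E.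
  by rewrite integral_indic// setIT.
apply: (@le_trans _ _ (\int[P]_w (expR (s / t) * expR (- s * Q w))%:E)%E).
  apply: ge0_le_integral => //.
  - by apply/measurable_EFinP; exact: measurable_indic.
  - by apply/measurable_EFinP; exact: measurable_funM.
  - move=> w _; rewrite lee_fin indicE; case: (boolP (w \in _)) => [|_]; last first.
      by rewrite mulr_ge0 ?expR_ge0.
    rewrite inE /= => h; rewrite -expRD -expR0 ler_expR mulNr -mulrBr mulr_ge0// subr_ge0//.
rewrite (_ : (\int[P]_w _)%E = (expR (s / t) * \int[P]_w expR (- s * Q w))%:E); last first.
  rewrite -RintegralZl// /Rintegral fineK//; apply: integrable_fin_num => //.
  exact: RintegrableZl.
rewrite lee_fin; apply: (@le_trans _ _ (expR (s / t) * expR (- M%:R))).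
  by rewrite ler_wpM2l ?expR_ge0.
rewrite -expRD ler_expR.
have e1 : M.+1%:R <= de * t + 1 by rewrite -natr1 lerD2r.
have e2 : s / t <= c0 * (de * t + 1) ^+ 2 / t.
  by rewrite ler_pM2r ?invr_gt0// ler_pM2l// ler_pXn2r// nnegrE; nra.
have e3 : c0 * (de * t + 1) ^+ 2 / t = de * t / 2 + 1 + c0 / t.
  by rewrite /de; field; rewrite !gt_eqF.
have e4 : c0 / t <= c0 by apply: ler_piMr; [exact: ltW|rewrite invf_le1].
move: M2; rewrite -natr1; lra.
Qed.

Lemma bridge_sq_gt0 : P [set w | 0 < Q w] = 1%E.
Proof.
have mA : measurable [set w | Q w <= 0].
  rewrite (_ : [set w | _] = Q @^-1` `]-oo, 0]%classic); last by apply/seteqP; split => w /=; rewrite in_itv.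
  by rewrite -[X in measurable X]setTI; apply: measurable_bridge_sq.
have -> : [set w | 0 < Q w] = ~` [set w | Q w <= 0].
  by apply/seteqP; split => w /=; rewrite ltNge => /negP.
rewrite probability_setC//.
have [C [c [C0 c0 h]]] := bridge_small_ball.
suff -> : P [set w | Q w <= 0] = 0%E by rewrite sube0.
apply/eqP; rewrite eq_le measure_ge0 andbT.
apply/lee_addgt0Pr => e e0; rewrite add0e.
(* Chosen so that the small ball bound is at most [exp (- 1 / e)], which is below [e] because
   [1 / e <= exp (1 / e)]. *)
pose t := 1 + (C + e^-1) / c.
have ei : 0 < e^-1 by rewrite invr_gt0.
have t1 : 1 <= t by rewrite lerDl divr_ge0 ?ltW// ltr_wpDl.
apply: (@le_trans _ _ (P [set w | Q w <= t^-1])).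
  apply: le_measure; rewrite ?inE//.
    rewrite (_ : [set w | _] = Q @^-1` `]-oo, t^-1]%classic); last by apply/seteqP; split => w /=; rewrite in_itv.
    by rewrite -[X in measurable X]setTI; apply: measurable_bridge_sq.
  by move=> w /= /le_trans; apply; rewrite invr_ge0 (le_trans ler01).
apply: (le_trans (h t t1)); rewrite lee_fin; apply: (@le_trans _ _ (expR (- e^-1))).
  rewrite ler_expR /t mulrDr mulrCA divff ?gt_eqF// !mulr1; lra.
rewrite expRN invf_ple ?posrE ?expR_gt0//.
by apply: le_trans (expR_ge1Dx _); rewrite lerDr.
Qed.

End tails.

Section exponential_tails.
Context d (T : measurableType d) (R : realType) (P : probability T R).

Lemma measurable_fun_ge (Y : T -> R) (x : R) : measurable_fun setT Y ->
  measurable [set w | x <= Y w].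
Proof.
move=> mY; rewrite (_ : [set w | _] = Y @^-1` `[x, +oo[%classic); last first.
  by apply/seteqP; split => w /=; rewrite in_itv /= andbT.
by rewrite -[X in measurable X]setTI; apply: mY.
Qed.

Lemma exponential_markov (Y : T -> R) (K x : R) : measurable_fun setT Y ->
  (\int[P]_w (expR (Y w))%:E <= K%:E)%E ->
  (P [set w | (x <= Y w)%R] <= (K * expR (- x))%:E)%E.
Proof.
move=> mY h; have mA := measurable_fun_ge x mY.
have mE : measurable_fun setT (fun w => (expR (Y w))%:E).
  by apply/measurable_EFinP; exact: measurableT_comp.
have -> : P [set w | x <= Y w] = (\int[P]_w (\1_[set w | (x <= Y w)%R] w)%:E)%E.
  by rewrite integral_indic// setIT.
apply: (@le_trans _ _ (\int[P]_w ((expR (- x))%:E * (expR (Y w))%:E))%E).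
  apply: ge0_le_integral => //.
  - by apply/measurable_EFinP; exact: measurable_indic.
  - by apply: emeasurable_funM => //; exact: measurable_cst.
  - move=> w _; rewrite -EFinM lee_fin indicE; case: (boolP (w \in _)) => [|_]; last first.
      by rewrite mulr_ge0 ?expR_ge0.
    rewrite inE /= => hx; rewrite -expRD -expR0 ler_expR; lra.
rewrite ge0_integralZl ?lee_fin ?expR_ge0//.
by rewrite [K * _]mulrC EFinM; apply: lee_wpmul2l => //; rewrite lee_fin expR_ge0.
Qed.

(** Beyond [t0] half of the exponent [c * t] absorbs [C]. Up to [t0] the required bound exceeds 1,
    because [K * t0 <= 1 / 2] and [1 <= 2 exp (- 1 / 2)]. *)
Lemma subexponential_of_tail (Z : T -> R) (C c : R) : measurable_fun setT Z ->
  0 <= C -> 0 < c ->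
  (forall t, 1 <= t -> (P [set w | (t <= `|Z w|)%R] <= (expR (C - c * t))%:E)%E) ->
  subexponential P Z.
Proof.
move=> mZ C0 c0 h; pose t0 := 1 + 2 * C / c.
have t01 : 1 <= t0 by rewrite lerDl divr_ge0 ?mulr_ge0// ltW.
pose K := Num.min (c / 2) (2 * t0)^-1.
have K1 : K <= c / 2 by rewrite ge_min lexx.
have K2 : K <= (2 * t0)^-1 by rewrite ge_min lexx orbT.
have K0 : 0 < K by rewrite lt_min divr_gt0//= invr_gt0 mulr_gt0// (lt_le_trans ltr01).
exists K; split => // t t_ge0; have [tt0|tt0] := leP t t0.
  apply: (le_trans (probability_le1 P _)).
    by apply: (@measurable_fun_ge (fun w => `|Z w|)); exact: measurableT_comp.
  rewrite lee_fin; apply: (@le_trans _ _ (2 * expR (- 2^-1))).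
    by have := @expR_ge1Dx R (- 2^-1); lra.
  rewrite ler_pM2l// ler_expR lerN2; apply: (@le_trans _ _ (K * t0)).
    by rewrite ler_pM2l.
  rewrite -ler_pdivlMr ?(lt_le_trans ltr01)//; apply: (le_trans K2).
  by rewrite invfM.
apply: (le_trans (h t _)); first by apply: le_trans t01 (ltW tt0).
rewrite lee_fin; apply: (@le_trans _ _ (expR (- (K * t)))); last first.
  by rewrite ler_peMl ?expR_ge0// ler1n.
rewrite ler_expR.
have h1 : 2 * C <= c * t.
  have e : 2 * C = c * (t0 - 1) by rewrite /t0; field; rewrite gt_eqF.
  by rewrite e ler_pM2l//; lra.
have h2 : K * t <= c / 2 * t by rewrite ler_wpM2r.
lra.
Qed.

Lemma expR_average_le (n : nat) (x : 'I_n.+1 -> R) :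
  expR (n.+1%:R^-1 * \sum_i x i) <= n.+1%:R^-1 * \sum_i expR (x i).
Proof.
set m := n.+1%:R^-1 * _; have n0 : n.+1%:R != 0 :> R by rewrite pnatr_eq0.
have h i : expR m * (1 + (x i - m)) <= expR (x i).
  (* tangent line of [expR] at the average [m] *)
  rewrite -[in leRHS](subrK m (x i)) expRD mulrC ler_wpM2r ?expR_ge0//.
  exact: expR_ge1Dx.
have -> : expR m = n.+1%:R^-1 * \sum_i (expR m * (1 + (x i - m))).
  rewrite -mulr_sumr big_split /= sumrB !sumr_const card_ord.
  rewrite -[m *+ _]mulr_natl {3}/m mulVKf// subrr addr0 mulrCA mulVf// mulr1//.
by rewrite ler_wpM2l ?invr_ge0// ler_sum.
Qed.

End exponential_tails.

(** As [l <= 1], the factor [exp (x ^ 2 / 4)] removes at most half of the Gaussian exponent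
    [x ^ 2 / (2 l)]. This at most doubles the variance and gives the bound [sqrt 2]. *)
Lemma normal_exp_sqr_le (R : realType) (l : R) : 0 < l -> l <= 1 ->
  (\int[normal_prob 0 (Num.sqrt l)]_x (expR (x ^+ 2 / 4))%:E <= 2%:E)%E.
Proof.
move=> l0 l1.
have mE : measurable_fun setT (fun x : R => (expR (x ^+ 2 / 4))%:E).
  apply/measurable_EFinP; apply: measurableT_comp => //.
  by apply: measurable_funM => //; exact: measurable_funX.
have s0 : Num.sqrt l != 0 by rewrite gt_eqF// sqrtr_gt0.
have a0 : 0 < (4 * l)^-1 by rewrite invr_gt0 mulr_gt0.
have pk0 : 0 < normal_peak (Num.sqrt l) by rewrite normal_peak_gt0.
rewrite ge0_integral_normal_prob//.
apply: (@le_trans _ _ (\int[lebesgue_measure]_x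
   (normal_peak (Num.sqrt l) * gau (4 * l)^-1 0 x)%:E)%E).
  apply: ge0_le_integral => //.
  - by move=> x _; rewrite mule_ge0// lee_fin ?expR_ge0// normal_pdf_ge0.
  - by apply: emeasurable_funM => //; apply/measurable_EFinP; exact: measurable_normal_pdf.
  - by apply/measurable_EFinP; apply: measurable_funM => //; exact: measurable_gau.
  - move=> x _; rewrite -EFinM lee_fin normal_pdfE// mulrCA ler_pM2l//.
    rewrite /normal_fun /gau subr0 sqr_sqrtr ?(ltW l0)// -expRD ler_expR.
    have -> : x ^+ 2 / 4 + - x ^+ 2 / (l *+ 2) = - ((4 * l)^-1 * x ^+ 2) - x ^+ 2 * ((1 - l) / (4 * l)).
      by field; rewrite gt_eqF.
    by rewrite gerDl oppr_le0 mulr_ge0 ?sqr_ge0// divr_ge0 ?subr_ge0// mulr_ge0// (ltW l0).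
have ig := @integrable_gau R _ 0 a0.
rewrite (_ : (\int[_]_x _)%E = (normal_peak (Num.sqrt l) * \int[lebesgue_measure]_x gau (4 * l)^-1 0 x)%:E); last first.
  rewrite -RintegralZl// /Rintegral fineK//; apply: integrable_fin_num => //.
  exact: RintegrableZl.
rewrite integral_gau// lee_fin /normal_peak sqr_sqrtr ?(ltW l0)// ler_pdivrMl; last first.
  by rewrite sqrtr_gt0 pmulrn_lgt0// mulr_gt0// pi_gt0.
have p0 := @pi_gt0 R.
rewrite invrK (_ : pi * (4 * l) = (l * pi *+ 2) * 2); last by rewrite -mulr_natr; ring.
rewrite sqrtrM ?ler_pM2l ?sqrtr_gt0 ?pmulrn_lgt0 ?mulr_gt0//; last first.
  by rewrite mulrn_wge0// mulr_ge0 ?(ltW l0) ?(ltW p0).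
have : Num.sqrt (2 : R) <= Num.sqrt (2 ^+ 2) by rewrite ler_wsqrtr// expr2; lra.
by rewrite sqrtr_sqr ger0_norm.
Qed.

Section brownian_tails.
Context d (T : measurableType d) (R : realType) (P : probability T R).
Variables (B : R -> T -> R) (alpha : R).
Hypothesis hB : standard_brownian_motion P B.
Hypothesis alpha0 : 0 <= alpha.
Notation Q := (bridge_sq B alpha).

Lemma brownian_exp_sqr_le l : 0 <= l -> l <= 1 ->
  (\int[P]_w (expR (B l w ^+ 2 / 4))%:E <= 2%:E)%E.
Proof.
(* At time 0 the law is degenerate and [bm_gaussian] does not apply; the almost sure value 0 is
   used. *)
rewrite le_eqVlt => /orP[/eqP <-|l0] l1.
  have m0 := bm_measurable hB (lexx 0).
  rewrite (@ae_eq_integral _ _ _ P setT (cst 1)%E)//.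
  - by rewrite integral_cst// mul1e [X in (X <= _)%E](@probability_setT _ _ _ P) lee_fin ler1n.
  - apply/measurable_EFinP; apply: measurableT_comp => //.
    by apply: measurable_funM => //; exact: measurable_funX.
  - by apply: filterS (bm_start hB) => w -> _; rewrite expr0n mul0r expR0.
pose X w := B l w - B 0 w.
have m0 := bm_measurable hB (lexx 0).
have ml := bm_measurable hB (ltW l0).
have mX : measurable_fun setT X by exact: measurable_funB.
have mE : measurable_fun setT (fun x : R => (expR (x ^+ 2 / 4))%:E).
  apply/measurable_EFinP; apply: measurableT_comp => //.
  by apply: measurable_funM => //; exact: measurable_funX.
rewrite (@ae_eq_integral _ _ _ P setT (fun w => (expR (X w ^+ 2 / 4))%:E))//.
- pose M := isMeasurableFun.Build _ _ T (measurableTypeR R) X mX.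
  pose F : {mfun T >-> measurableTypeR R} := HB.pack X M.
  rewrite [leLHS](_ : _ = \int[pushforward P F]_y (expR (y ^+ 2 / 4))%:E)%E; last first.
    by rewrite ge0_integral_pushforward// => y _; rewrite lee_fin expR_ge0.
  apply: le_trans (normal_exp_sqr_le l0 l1); rewrite le_eqVlt; apply/orP; left; apply/eqP.
  apply: eq_measure_integral => A mA _.
  have := @bm_gaussian _ _ _ _ _ hB _ _ (lexx 0) l0 A mA.
  by rewrite subr0.
- exact: measurableT_comp mE ml.
- exact: measurableT_comp mE mX.
- by apply: filterS (bm_start hB) => w h _; rewrite /X h subr0.
Qed.

Lemma brownian_tail l (t : R) : 0 <= l -> l <= 1 ->
  (P [set w | (t <= B l w ^+ 2)%R] <= (2 * expR (- (t / 4)))%:E)%E.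
Proof.
move=> l0 l1; have ml := bm_measurable hB l0.
rewrite (_ : [set w | _] = [set w | (t / 4 <= B l w ^+ 2 / 4)%R]); last first.
  by apply/seteqP; split => w /=; rewrite ler_pM2r.
apply: (@exponential_markov _ _ _ P (fun w => B l w ^+ 2 / 4)).
  by apply: measurable_funM => //; exact: measurable_funX.
exact: brownian_exp_sqr_le.
Qed.

(** For [0 <= l <= 1], [(x - l y) ^ 2 <= 2 x ^ 2 + 2 y ^ 2], so a sixteenth of it is at most the
    mean of [x ^ 2 / 4] and [y ^ 2 / 4]. Convexity is used over the grid and over this pair, so only
    one-time marginals enter. *)
Lemma bridge_sum_exp_le n :
  (\int[P]_w (expR (bridge_sum B alpha (cst 0) n w / 16))%:E <= 2%:E)%E.
Proof.
have ms := measurable_bridge_sum alpha hB.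
pose D (k : 'I_n.+1) w := (expR (B (k%:R / n.+1%:R) w ^+ 2 / 4) + expR (B 1 w ^+ 2 / 4)) / 2.
have p01 (k : 'I_n.+1) : 0 <= (k%:R / n.+1%:R : R) <= 1.
  by rewrite divr_ge0//= ler_pdivrMr ?ltr0n// mul1r ler_nat ltnW.
have mexp l : 0 <= l -> measurable_fun setT (fun w => expR (B l w ^+ 2 / 4)).
  move=> l0; apply: measurableT_comp => //.
  apply: measurable_funM => //; apply: measurable_funX; exact: (bm_measurable hB).
have mD k : measurable_fun setT (D k).
  have /andP[k0 _] := p01 k.
  by apply: measurable_funM => //; apply: measurable_funD; apply: mexp.
have D0 k w : 0 <= D k w by rewrite divr_ge0// addr_ge0 ?expR_ge0.
have point (k : 'I_n.+1) w : expR (bridge_integrand B alpha (cst 0) w (k%:R / n.+1%:R) / 16) <= D k w.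
  have /andP[k0 k1] := p01 k; rewrite /D.
  set l := k%:R / _ in k0 k1 *; set x := B l w; set y := B 1 w.
  have h1 : bridge_integrand B alpha (cst 0) w l / 16 <= (x ^+ 2 / 4 + y ^+ 2 / 4) / 2.
    rewrite /bridge_integrand -/x -/y /= addr0.
    have wl := powR_le1 k0 k1 alpha0; have w0 := powR_ge0 l alpha.
    have : l `^ alpha * (x - l * y) ^+ 2 <= (x - l * y) ^+ 2 by rewrite ler_piMl ?sqr_ge0.
    have : (l * y) ^+ 2 <= y ^+ 2 by rewrite exprMn ler_piMl ?sqr_ge0// expr_le1.
    have := sqr_ge0 (x + l * y); nra.
  have := @expR_average_le R 1 (fun i => if i == ord0 then x ^+ 2 / 4 else y ^+ 2 / 4).
  rewrite !big_ord_recl !big_ord0 /= !addr0 => h2.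
  by rewrite [leRHS]mulrC; apply: le_trans h2; rewrite ler_expR [leRHS]mulrC.
apply: (@le_trans _ _ (\int[P]_w (n.+1%:R^-1 * \sum_k D k w)%:E)%E).
  apply: ge0_le_integral => //.
  - by apply/measurable_EFinP; apply: measurableT_comp => //; apply: measurable_funM => //; exact: ms.
  - by apply/measurable_EFinP; apply: measurable_funM => //; apply: measurable_sum.
  - move=> w _; rewrite lee_fin /bridge_sum -mulrA mulr_suml.
    apply: (le_trans (expR_average_le _)); rewrite ler_wpM2l ?invr_ge0//.
    by apply: ler_sum => k _; exact: point.
under eq_integral do rewrite EFinM -sumEFin.
rewrite ge0_integralZl//; last 2 first.
- by apply: emeasurable_sum => k; apply/measurable_EFinP.
- by move=> w _; apply: sume_ge0 => k _; rewrite lee_fin.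
rewrite ge0_integral_sum//; last 2 first.
- by move=> k; apply/measurable_EFinP.
- by move=> k w _; rewrite lee_fin.
rewrite -lee_pdivlMl ?invr_gt0// invrK.
apply: (@le_trans _ _ (\sum_(k < n.+1) 2%:E)%E); last first.
  by rewrite sumEFin sumr_const card_ord -EFinM lee_fin mulr_natl.
apply: lee_sum => k _; have /andP[k0 k1] := p01 k.
under eq_integral do rewrite /D mulrC EFinM EFinD.
rewrite ge0_integralZl//; last 2 first.
- by apply: emeasurable_funD; apply/measurable_EFinP; exact: mexp.
- by move=> w _; rewrite lee_fin addr_ge0 ?expR_ge0.
rewrite ge0_integralD//; last 2 first.
- by apply/measurable_EFinP; exact: mexp.
- by apply/measurable_EFinP; exact: mexp.
rewrite -lee_pdivlMl ?invr_gt0// invrK.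
apply: le_trans (leeD (brownian_exp_sqr_le k0 k1) (brownian_exp_sqr_le ler01 (lexx _))) _.
by rewrite -EFinD lee_fin; lra.
Qed.

Lemma bridge_sq_exp_le : (\int[P]_w (expR (Q w / 16))%:E <= 2%:E)%E.
Proof.
pose f n w := (expR (bridge_sum B alpha (cst 0) n w / 16))%:E.
have mf n : measurable_fun setT (f n).
  apply/measurable_EFinP; apply: measurableT_comp => //; apply: measurable_funM => //.
  exact: (measurable_bridge_sum alpha hB).
have f0 n w : [set: T] w -> (0 <= f n w)%E by rewrite lee_fin expR_ge0.
have c0 : {within `[0, 1], continuous (cst 0 : R -> R)}.
  by apply: continuous_subspaceT => x; exact: cvg_cst.
have cf w : f n w @[n --> \oo] --> (expR (Q w / 16))%:E.
  apply: cvg_EFin; first exact: nearW.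
  have c2 : bridge_sum B alpha (cst 0) n w / 16 @[n --> \oo] --> Q w / 16.
    by apply: cvgM; [exact: (bridge_sum_cvg hB alpha0)|exact: cvg_cst].
  by apply: (cvg_comp _ _ c2); exact: continuous_expR.
have := fatou P measurableT mf f0.
under eq_integral => w _ do rewrite (cvg_limn_einf_sup (cf w)).1.
move=> h; apply: (le_trans h).
rewrite limn_einf_lim; apply: lime_le; first exact: is_cvg_einfs.
apply: nearW => n; apply: (@le_trans _ _ (\int[P]_w f n w)%E).
  by apply: ereal_inf_lbound; exists n => //=.
exact: bridge_sum_exp_le.
Qed.

Lemma bridge_sq_tail (x : R) : (P [set w | (x <= Q w)%R] <= (2 * expR (- (x / 16)))%:E)%E.
Proof.
rewrite (_ : [set w | _] = [set w | (x / 16 <= Q w / 16)%R]); last first.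
  by apply/seteqP; split => w /=; rewrite ler_pM2r.
apply: (@exponential_markov _ _ _ P (fun w => Q w / 16)); last exact: bridge_sq_exp_le.
by apply: measurable_funM => //; exact: (measurable_bridge_sq hB alpha0).
Qed.

End brownian_tails.

Section finite_sup.
Context {R : realType}.

Lemma finite_sup_bound n (x : 'I_n.+1 -> R) : has_ubound [set x l | l in [set: 'I_n.+1]].
Proof.
exists (\sum_l `|x l|) => _ [l _ <-]; rewrite (bigD1 l)//= (le_trans (ler_norm _))//.
by rewrite lerDl sumr_ge0.
Qed.

Lemma norm_finite_sup_gt n (x : 'I_n.+1 -> R) (c : R) :
  c < `|sup [set x l | l in [set: 'I_n.+1]]| -> exists l, c < `|x l|.
Proof.
move=> h; apply: contrapT => /forallNP nx; move: h; apply/negP; rewrite -leNgt.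
have {}nx l : `|x l| <= c by rewrite leNgt; apply/negP; exact: nx.
rewrite ler_norml; apply/andP; split.
  apply: (@le_trans _ _ (x ord0)); first by have := nx ord0; rewrite ler_norml => /andP[].
  by apply: ub_le_sup; [exact: finite_sup_bound|exists ord0].
apply: ge_sup; first by exists (x ord0), ord0.
by move=> _ [l _ <-]; have := nx l; rewrite ler_norml => /andP[].
Qed.

(** The finite family is made into a sequence by [inord], which only repeats indices and so does not
    change the supremum. *)
Lemma measurable_finite_sup d (T : measurableType d) n (X : 'I_n.+1 -> T -> R) :
  (forall l, measurable_fun setT (X l)) ->
  measurable_fun setT (fun w => sup [set X l w | l in [set: 'I_n.+1]]).
Proof.
move=> mX; pose h (k : nat) w := X (inord k) w.
have e w : [set X l w | l in [set: 'I_n.+1]] = range (h ^~ w).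
  apply/seteqP; split => [_ [l _ <-]|_ [k _ <-]]; last by exists (inord k).
  by exists l => //; rewrite /h inord_val.
rewrite (_ : (fun w => _) = (fun w => sups (h ^~ w) 0)); last first.
  apply/funext => w; rewrite e /sups /sdrop; congr sup.
  by apply/seteqP; split => [_ [k _ <-]|_ [k _ <-]]; exists k.
apply: measurable_fun_sups => w; last exact: mX.
by move=> _; rewrite -e; exact: finite_sup_bound.
Qed.

End finite_sup.

(** * Tails of the norm, of its inverse and of maxima *)

Section bridge_norm_tails.
Context d (T : measurableType d) (R : realType) (P : probability T R).
Variables (B : R -> T -> R) (alpha : R).
Hypothesis hB : standard_brownian_motion P B.
Hypothesis alpha0 : 0 <= alpha.
Notation Q := (bridge_sq B alpha).
Notation V := (bridge_norm alpha B).

Lemma bridge_normE w : V w = Num.sqrt (Q w).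
Proof. by congr Num.sqrt; apply: eq_Rintegral => l _; rewrite /bridge_integrand addr0. Qed.

Lemma bridge_norm_sqr w : V w ^+ 2 = Q w.
Proof. by rewrite bridge_normE sqr_sqrtr// bridge_sq_ge0. Qed.

Lemma bridge_norm_ge0 w : 0 <= V w. Proof. exact: sqrtr_ge0. Qed.

Lemma measurable_bridge_norm : measurable_fun setT V.
Proof.
rewrite (_ : V = Num.sqrt \o Q); last by apply/funext => w; exact: bridge_normE.
apply: measurableT_comp; last exact: measurable_bridge_sq hB alpha0.
by apply: continuous_measurable_fun; exact: sqrt_continuous.
Qed.

Lemma measurable_inv_bridge_norm : measurable_fun setT (fun w => (V w)^-1).
Proof.
under eq_fun do rewrite -powR_inv1 ?bridge_norm_ge0//.
exact: (measurableT_comp (@measurable_powR R (-1)) measurable_bridge_norm).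
Qed.

Lemma bridge_norm_gt0 : P [set w | 0 < V w] = 1%E.
Proof.
rewrite -(bridge_sq_gt0 hB alpha0); congr (P _).
by apply/seteqP; split => w /=; rewrite bridge_normE sqrtr_gt0.
Qed.

(** The small ball bound at radius [t ^- 2]. Keeping the square in the exponent matters for the
    quotient below, where the level is [sqrt t]. *)
Lemma inv_bridge_norm_tail : exists C c : R, [/\ 0 <= C, 0 < c & forall t : R, 1 <= t ->
  (P [set w | (t <= `|(V w)^-1|)%R] <= (expR (C - c * t ^+ 2))%:E)%E].
Proof.
have [C [c [C0 c0 h]]] := bridge_small_ball hB alpha0.
exists C, c; split => // t t1; have t0 : 0 < t by apply: lt_le_trans t1.
apply: le_trans (h (t ^+ 2) _); last by rewrite expr_ge1// ltW.
have mQ := measurable_bridge_sq hB alpha0.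
apply: le_measure; rewrite ?inE.
- apply: (@measurable_fun_ge _ _ _ (fun w => `|(V w)^-1|)); apply: measurableT_comp => //.
  exact: measurable_inv_bridge_norm.
- rewrite (_ : [set w | _] = Q @^-1` `]-oo, (t ^+ 2)^-1]%classic); last by apply/seteqP; split => w /=; rewrite in_itv.
  by rewrite -[X in measurable X]setTI; apply: mQ.
move=> w /=; rewrite -bridge_norm_sqr -exprVn ger0_norm ?invr_ge0 ?bridge_norm_ge0// => tV.
(* The inverse of 0 is 0 by convention, so outcomes with [V w = 0] are not in this event. *)
have V0 : 0 < V w by rewrite -invr_gt0 (lt_le_trans t0).
rewrite ler_pXn2r ?nnegrE ?invr_ge0 ?bridge_norm_ge0 ?(ltW t0)//.
by rewrite -[V w]invrK lef_pV2// posrE ?invr_gt0.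
Qed.

Lemma subexponential_inv_bridge_norm : subexponential P (fun w => (V w)^-1).
Proof.
have [C [c [C0 c0 h]]] := inv_bridge_norm_tail.
apply: (subexponential_of_tail _ C0 c0).
  exact: measurable_inv_bridge_norm.
move=> t t1; apply: (le_trans (h t t1)); rewrite lee_fin ler_expR lerD2l lerN2 ler_pM2l//.
by rewrite expr2 ler_peMl//; lra.
Qed.

(** A quotient of size [t] forces [sqrt t] on the numerator or on the inverse norm. Both have
    Gaussian-type tails, hence exponential ones in [t], and the union bound requires no information
    on their dependence. *)
Lemma subexponential_studentized : subexponential P (fun w => B 1 w / V w).
Proof.
have [C [c [C0 c0 h]]] := inv_bridge_norm_tail.
have mV : measurable_fun setT (fun w => (V w)^-1) by exact: measurable_inv_bridge_norm.
have mB := bm_measurable hB (@ler01 R).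
have c'0 : 0 < Num.min c (1 / 4) by rewrite lt_min c0 divr_gt0.
(* The added 2 absorbs the total weight 3 of the two tails, since [3 <= exp 2]. *)
have C'0 : 0 <= C + 2 by lra.
apply: (subexponential_of_tail _ C'0 c'0); first exact: measurable_funM.
move=> t t1; have t0 : 0 < t by apply: lt_le_trans t1.
have st : Num.sqrt t ^+ 2 = t by rewrite sqr_sqrtr// ltW.
have st1 : 1 <= Num.sqrt t by rewrite -(sqrtr1 R) ler_wsqrtr.
pose A1 := [set w | t <= B 1 w ^+ 2]; pose A2 := [set w | Num.sqrt t <= `|(V w)^-1|].
have mA1 : measurable A1.
  by apply: (@measurable_fun_ge _ _ _ (fun w => B 1 w ^+ 2)); exact: measurable_funX.
have mA2 : measurable A2.
  by apply: (@measurable_fun_ge _ _ _ (fun w => `|(V w)^-1|)); exact: measurableT_comp.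
apply: (@le_trans _ _ (P (A1 `|` A2))).
  apply: le_measure; rewrite ?inE.
  - apply: (@measurable_fun_ge _ _ _ (fun w => `|B 1 w / V w|)); apply: measurableT_comp => //.
    exact: measurable_funM.
  - exact: measurableU.
  move=> w /= hw; apply: contrapT => /not_orP[/negP + /negP]; rewrite -!ltNge => h1 h2.
  have h3 : `|B 1 w| < Num.sqrt t by rewrite -sqrtr_sqr ltr_sqrt.
  move: hw; apply/negP; rewrite -ltNge normrM -[ltRHS]st expr2.
  by rewrite ltr_pM.
apply: (le_trans (measureU2 _ mA1 mA2)).
apply: (le_trans (leeD (brownian_tail hB t ler01 (lexx _)) (h _ st1))).
rewrite -EFinD lee_fin st.
have m1 : Num.min c (1 / 4) <= c by rewrite ge_min lexx.
have m2 : Num.min c (1 / 4) <= 1 / 4 by rewrite ge_min lexx orbT.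
move: (Num.min _ _) m1 m2 => m m1 m2.
have e1 : expR (- (t / 4)) <= expR (C - m * t).
  rewrite ler_expR; have : m * t <= 1 / 4 * t by rewrite ler_wpM2r// ltW.
  lra.
have e2 : expR (C - c * t) <= expR (C - m * t).
  rewrite ler_expR; have : m * t <= c * t by rewrite ler_wpM2r// ltW.
  lra.
have -> : C + 2 - m * t = 2 + (C - m * t) by ring.
rewrite [leRHS]expRD; have u0 := expR_ge0 (C - m * t); have e3 := @expR_ge1Dx R 2.
have e4 : (1 + 2) * expR (C - m * t) <= expR 2 * expR (C - m * t) by rewrite ler_wpM2r.
lra.
Qed.

(** A union bound over the [p] marginals; the copies may depend on each other arbitrarily. *)
Lemma bridge_norm_max_bigO (d' : nat -> measure_display)
    (T' : forall p, measurableType (d' p)) (P' : forall p, probability (T' p) R)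
    (X : forall p, 'I_p -> {RV (P' p) >-> R}) :
  (forall p (l : 'I_p) (A : set R), measurable A ->
     P' p (X p l @^-1` A) = P (V @^-1` A)) ->
  bigO_P P' (fun p w => sup [set X p l w | l in [set: 'I_p]])
    (fun p => Num.sqrt (ln p%:R)).
Proof.
(* With 6 the tail exponent is [36 / 16] times [ln p], which exceeds [2 ln p], so the [p] terms sum
   to at most [2 / p]. *)
move=> lawX eps eps0; exists 6; split => //.
have n1 : \forall p \near \oo, (1 < p)%N by exists 2%N.
have n2 : \forall p \near \oo, 2 / eps <= p%:R by exact: nbhs_infty_ger.
apply: filterS2 n1 n2 => -[//|p] p1 pe.
set c := 6 * Num.sqrt (ln p.+1%:R).
have lp : 0 <= ln (p.+1%:R : R) by rewrite ln_ge0// ler1n.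
have c0 : 0 <= c by rewrite mulr_ge0.
have mX l : measurable_fun setT (X p.+1 l) by exact: measurable_funPT.
pose A (i : nat) := [set w | c < `|X p.+1 (inord i) w|].
have mgt d0 (T0 : measurableType d0) (Y : T0 -> R) : measurable_fun setT Y ->
    measurable [set w | c < `|Y w|].
  move=> mY; rewrite (_ : [set w | _] = (fun w => `|Y w|) @^-1` `]c, +oo[%classic); last first.
    by apply/seteqP; split => w /=; rewrite in_itv /= andbT.
  by rewrite -[X in measurable X]setTI; apply: (measurableT_comp (@normr_measurable R setT) mY).
have mA i : measurable (A i) by exact: mgt.
have PA i : (P' p.+1 (A i) <= (2 * expR (- (ln p.+1%:R) *+ 2))%:E)%E.
  rewrite (_ : A i = X p.+1 (inord i) @^-1` [set x | c < `|x|])//.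
  rewrite lawX; last first.
    by apply: (@mgt _ (measurableTypeR R) id); exact: measurable_id.
  apply: (@le_trans _ _ (P [set w | c ^+ 2 <= Q w])).
    apply: le_measure; rewrite ?inE.
    - by apply: mgt; exact: measurable_bridge_norm.
    - by apply: measurable_fun_ge; exact: measurable_bridge_sq hB alpha0.
    move=> w /=; rewrite ger0_norm ?bridge_norm_ge0// -bridge_norm_sqr => h.
    by rewrite ler_pXn2r ?nnegrE ?bridge_norm_ge0// ltW.
  apply: (le_trans (bridge_sq_tail hB alpha0 _)); rewrite lee_fin ler_pM2l// ler_expR.
  rewrite /c exprMn sqr_sqrtr// -mulr_natl; lra.
apply: (@le_trans _ _ (P' p.+1 (\big[setU/set0]_(i < p.+1) A i))).
  apply: le_measure; rewrite ?inE.
  - apply: mgt; exact: measurable_finite_sup.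
  - by apply: bigsetU_measurable => i _.
  move=> w /= /norm_finite_sup_gt[l hl]; rewrite -bigcup_mkord; exists (l : nat) => //=.
  by rewrite /A /= inord_val.
apply: (le_trans (le_mu_bigsetU _ _)) => //.
apply: (@le_trans _ _ (\sum_(i < p.+1) (2 * expR (- (ln p.+1%:R) *+ 2))%:E)%E).
  by apply: lee_sum => i _; exact: PA.
rewrite sumEFin sumr_const card_ord lee_fin -[X in expR X]mulr_natl expRM_natl expRN lnK ?posrE//.
rewrite -[leLHS]mulr_natl; move: pe; rewrite ler_pdivrMr// => pe.
have p0 : 0 < p.+1%:R :> R by [].
rewrite (_ : _ * _ = 2 / p.+1%:R); last by field; rewrite gt_eqF.
by rewrite ler_pdivrMr// mulrC.
Qed.

End bridge_norm_tails.

(** * Cameron-Martin shifts and absolute continuity *)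

Section gaussian_shift.
Context d (T : measurableType d) (R : realType) (P : probability T R) (n : nat) (h : R).
Variables (X : 'I_n -> T -> R).
Hypothesis h0 : 0 < h.
Hypothesis mX : forall i, measurable_fun setT (X i).
Hypothesis indepX : mutually_independent P X.
Hypothesis lawX : forall i (A : set R), measurable A ->
  P (X i @^-1` A) = normal_prob 0 (Num.sqrt h) A.

Definition shift_tuple (m : nat) (c : R) (t : n.-tuple R) : n.-tuple R :=
  [tuple tnth t i + (if (i < m)%N then c else 0) | i < n].

Lemma tnth_shift_tuple m c t i :
  tnth (shift_tuple m c t) i = tnth t i + (if (i < m)%N then c else 0).
Proof. by rewrite tnth_mktuple. Qed.

Lemma measurable_shift_tuple m c : measurable_fun setT (shift_tuple m c).
Proof.
apply/measurable_fun_tnthP => i.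
rewrite (_ : _ \o _ = fun t => tnth t i + (if (i < m)%N then c else 0)).
  by apply: measurable_funD => //; exact: measurable_tnth.
by apply/funext => t /=; rewrite tnth_shift_tuple.
Qed.

Lemma shift_tuple0 c t : shift_tuple 0 c t = t.
Proof. by apply: eq_from_tnth => i; rewrite tnth_shift_tuple addr0. Qed.

Lemma shift_tuple_upd (j : 'I_n) c t x :
  shift_tuple j.+1 c (upd t j x) = shift_tuple j c (upd t j (x + c)).
Proof.
apply: eq_from_tnth => i; rewrite !tnth_shift_tuple !tnth_upd.
case: eqP => [->|/eqP ij]; first by rewrite ltnn ltnSn addr0.
by rewrite ltnS leq_eqVlt (_ : (i == j :> nat) = false)//; apply/negbTE.
Qed.

(** Finite-dimensional Cameron-Martin formula, by induction on the number of shifted coordinates: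
    coordinate [m] is resampled and shifted, and its weight joins [f] before the induction
    hypothesis is applied. *)
Lemma gaussian_shift (f : n.-tuple R -> \bar R) (m : nat) (c : R) : (m <= n)%N ->
  measurable_fun setT f -> (forall t, 0 <= f t)%E ->
  (\int[P]_w f (shift_tuple m c (rvec X w)) =
   \int[P]_w (f (rvec X w) *
     (expR (c / h * psum m (rvec X w) - m%:R * (c ^+ 2 / (h *+ 2))))%:E))%E.
Proof.
have s0 : Num.sqrt h != 0 by rewrite gt_eqF// sqrtr_gt0.
have sE : Num.sqrt h ^+ 2 = h by rewrite sqr_sqrtr// ltW.
elim: m f => [|m IH] f mn mf f0.
  apply: eq_integral => w _.
  by rewrite shift_tuple0 psum0 mulr0 mul0r subrr expR0 mule1.
pose j : 'I_n := Ordinal mn.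
pose g t := (f t * (expR (c / h * tnth t j - c ^+ 2 / (h *+ 2)))%:E)%E.
have mexp (a b : R) (u : n.-tuple R -> R) : measurable_fun setT u ->
    measurable_fun setT (fun t => (expR (a * u t - b))%:E).
  move=> mu; apply/measurable_EFinP; apply: measurableT_comp => //.
  by apply: measurable_funB => //; exact: measurable_funM.
have mg : measurable_fun setT g.
  by apply: emeasurable_funM => //; apply: mexp; exact: measurable_tnth.
have g0 t : (0 <= g t)%E by rewrite mule_ge0// lee_fin expR_ge0.
transitivity (\int[P]_w g (shift_tuple m c (rvec X w)))%E; last first.
  rewrite IH ?(ltnW mn)//; apply: eq_integral => w _.
  rewrite /g -muleA -EFinM -expRD; congr (_ * (expR _)%:E)%E.
  by rewrite (psumS _ j) -natr1 /=; ring.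
rewrite (ge0_integral_resample mX indepX lawX j (f := f \o shift_tuple m.+1 c)); last 2 first.
- exact: measurableT_comp mf (measurable_shift_tuple _ _).
- by move=> t; exact: f0.
rewrite (ge0_integral_resample mX indepX lawX j (f := g \o shift_tuple m c)); last 2 first.
- exact: measurableT_comp mg (measurable_shift_tuple _ _).
- by move=> t; exact: g0.
apply: eq_integral => w _ /=.
under eq_integral do rewrite (shift_tuple_upd j).
rewrite (@normal_prob_shift _ (Num.sqrt h) c (fun x => f (shift_tuple m c (upd (rvec X w) j x))))//; last first.
  apply: measurableT_comp mf _; apply: measurableT_comp (measurable_shift_tuple _ _) _.
  apply: measurable_upd => //; exact: measurable_id.
apply: eq_integral => x _; rewrite /g tnth_shift_tuple ltnn addr0 tnth_upd eqxx sE//.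
Qed.

End gaussian_shift.

Lemma finite_measure_eq_rays (R : realType)
    (m1 m2 : {measure set (measurableTypeR R) -> \bar R}) :
  (m1 setT < +oo)%E ->
  (forall x, m1 (`]-oo, x[%classic : set R) = m2 (`]-oo, x[%classic : set R)) ->
  forall A, measurable A -> m1 A = m2 A.
Proof.
move=> m1oo m12 A mA.
apply: (@measure_unique _ R (measurableTypeR R) (@RGenInftyO.G R)
  (fun n => `]-oo, n%:R[%classic) (@RGenInftyO.measurableE R) _ _ _ m1 m2) => //.
- move=> _ _ [x ->] [y ->]; exists (Num.min x y).
  by apply/seteqP; split => z /=; rewrite !in_itv /= lt_min => /andP.
- by move=> n; exists n%:R.
- apply/seteqP; split => // x _; exists (Num.truncn `|x|).+1 => //=.
  rewrite in_itv /= (le_lt_trans (ler_norm _))//.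
  by have /andP[] := truncn_itv (normr_ge0 x).
- by move=> _ [x ->].
- move=> n; apply: le_lt_trans m1oo; apply: le_measure; rewrite ?inE//.
Qed.

Section null_preimage.
Context {R : realType}.
Notation mu := (@lebesgue_measure R).

(* Cover [A] by short intervals: the preimage of an interval of length [l] has
   diameter at most [l / c]. *)
Lemma null_preimage_expansive (A D : set R) (f : R -> R) (c : R) : 0 < c ->
  measurable A -> mu A = 0%E -> measurable D -> measurable_fun setT f ->
  (forall x y, D x -> D y -> c * `|x - y| <= `|f x - f y|) ->
  mu (D `&` f @^-1` A) = 0%E.
Proof.
move=> c0 mA A0 mD mf fD.
apply/eqP; rewrite eq_le measure_ge0 andbT.
apply/lee_addgt0Pr => e e0; rewrite add0e.
have lA : ((wlength idfun)^* A)%mu = 0%E.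
  by apply/negligible_outer_measure; apply/negligibleP.
(* Each piece is enclosed in an interval of radius [l / c] around one of its points, which
   multiplies lengths by [2 / c]. *)
have ec : 0 < e * c / 2 by rewrite divr_gt0// mulr_gt0.
have mpre I : measurable I -> measurable (D `&` f @^-1` I).
  by move=> mI; apply: measurableI => //; rewrite -[X in measurable X]setTI; exact: mf.
move: lA; rewrite outer_measure_open_itv_cover => lA.
have [|_ [F [Fitv AF] <-]] := lb_ereal_inf_adherent ec _ (S := [set \sum_(k <oo) wlength idfun (F k) | F in open_itv_cover A]%E).
  by rewrite lA.
rewrite lA add0e => Fe.
have oF k : measurable (F k) by have [ab ->] := Fitv k; exact: measurable_itv.
have wF0 k : (0 <= wlength idfun (F k))%E by exact: wlength_ge0.
have step k : (mu (D `&` f @^-1` F k) <= (2 / c)%:E * wlength idfun (F k))%E.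
  have [E0|/set0P[x [Dx Fx]]] := eqVneq (D `&` f @^-1` F k) set0.
    by rewrite E0 measure0 mule_ge0// lee_fin divr_ge0// ltW.
  have [[a b] /= FE] := Fitv k; move: Fx; rewrite FE /= in_itv /= => /andP[ax xb].
  have ab := lt_trans ax xb.
  pose r := (b - a) / c; have r0 : 0 < r by rewrite divr_gt0// subr_gt0.
  apply: (@le_trans _ _ (mu `[x - r, x + r]%classic)).
    apply: le_measure; rewrite ?inE//; first by apply: mpre; exact: measurable_itv.
    move=> y [Dy]; rewrite /= !in_itv /= => /andP[ay yb].
    have h := fD _ _ Dy Dx.
    have h2 : `|y - x| <= r.
      rewrite /r ler_pdivlMr// mulrC (le_trans h)// ler_norml; apply/andP; split; lra.
    by move: h2; rewrite ler_distl.
  rewrite lebesgue_measure_itv /= lte_fin ifT; last by lra.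
  rewrite wlength_itv /= lte_fin ab -!EFinB -EFinM lee_fin /r; lra.
apply: (@le_trans _ _ (\sum_(k <oo) mu (D `&` f @^-1` F k))%E).
  apply: measure_sigma_subadditive.
  - by move=> k; exact: mpre.
  - exact: mpre.
  - by move=> x [Dx /AF[k _ Fk]]; exists k.
apply: (@le_trans _ _ (\sum_(k <oo) (2 / c)%:E * wlength idfun (F k))%E).
  by apply: lee_nneseries => // k _; exact: step.
rewrite nneseriesZl//; apply: (@le_trans _ _ ((2 / c)%:E * (e * c / 2)%:E)%E).
  by apply: lee_wpmul2l; [rewrite lee_fin divr_ge0// ltW|exact: ltW].
rewrite -EFinM lee_fin [leLHS](_ : _ = e)//; field; rewrite gt_eqF//.
Qed.

(** On either side of the vertex [- b / k], at distance at least [1 / n.+1] from it, the polynomial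
    expands distances. These countably many regions cover all but the vertex. *)
Lemma null_preimage_quadratic (A : set R) (a b k : R) : k != 0 ->
  measurable A -> mu A = 0%E ->
  mu ((fun x => a + 2 * b * x + k * x ^+ 2) @^-1` A) = 0%E.
Proof.
move=> k0 mA A0; set f := fun x => _.
have mf : measurable_fun setT f.
  apply: measurable_funD; first by apply: measurable_funD => //; exact: measurable_funM.
  by apply: measurable_funM => //; exact: measurable_funX.
pose D (s : bool) (n : nat) : set R := [set x | n.+1%:R^-1 <= (-1) ^+ s * (x + b / k)].
have mD s n : measurable (D s n).
  rewrite (_ : D s n = (fun x => (-1) ^+ s * (x + b / k)) @^-1` `[n.+1%:R^-1, +oo[%classic); last first.
    by apply/seteqP; split => x /=; rewrite in_itv /= andbT.
  have m : measurable_fun setT (fun x : R => (-1) ^+ s * (x + b / k)).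
    by apply: measurable_funM => //; exact: measurable_funD.
  by rewrite -[X in measurable X]setTI; apply: m.
have mfA : measurable (f @^-1` A) by rewrite -[X in measurable X]setTI; exact: (mf measurableT _ mA).
have neg s n : mu.-negligible (D s n `&` f @^-1` A).
  have m1 : measurable (D s n `&` f @^-1` A) by exact: measurableI.
  apply/negligibleP; first exact: m1.
  have n0 : (0 : R) < n.+1%:R^-1 by rewrite invr_gt0.
  apply: (@null_preimage_expansive _ _ _ (`|k| * n.+1%:R^-1)) => //.
    by rewrite mulr_gt0// normr_gt0.
  move=> x y Dx Dy.
  have -> : f x - f y = k * (x - y) * ((x + b / k) + (y + b / k)).
    by rewrite /f; field.
  rewrite !normrM -[leLHS]mulrA [_ * `|x - y|]mulrC mulrA ler_wpM2l ?mulr_ge0//.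
  apply: (@le_trans _ _ ((-1) ^+ s * (x + b / k) + (-1) ^+ s * (y + b / k))).
    by rewrite /D /= in Dx Dy; move: Dx Dy n0; move: (_ * _) (_ * _) (_^-1) => u v w; lra.
  by rewrite -mulrDr (le_trans (ler_norm _))// normrM normrX normrN1 expr1n mul1r.
apply/negligibleP; first exact: mfA.
apply: (@negligibleS _ _ _ mu ([set - (b / k)] `|` ((\bigcup_n (D false n `&` f @^-1` A)) `|` (\bigcup_n (D true n `&` f @^-1` A))))).
  move=> x Ax; have [xb|xb] := eqVneq x (- (b / k)); first by left.
  right; have x0 : 0 < `|x + b / k| by rewrite normr_gt0 -[b / k]opprK subr_eq0.
  pose n := Num.truncn (`|x + b / k|^-1).
  have hn : n.+1%:R^-1 <= `|x + b / k|.
    rewrite invf_ple ?posrE// ltW//.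
    by have /andP[] : n%:R <= `|x + b / k|^-1 < n.+1%:R by apply: truncn_itv; rewrite invr_ge0.
  have [s0|s0] := leP 0 (x + b / k).
    by left; exists n => //; split => //; rewrite /D /= mul1r -(ger0_norm s0).
  by right; exists n => //; split => //; rewrite /D /= mulN1r -(ltr0_norm s0).
apply: negligibleU; first by apply/negligibleP => //; exact: lebesgue_measure_set1.
by apply: negligibleU; apply: negligible_bigcup.
Qed.

End null_preimage.

Lemma psum_shift_tuple (R : realType) N m k (c : R) (t : N.-tuple R) : (k <= N)%N ->
  psum k (shift_tuple m c t) = psum k t + (minn k m)%:R * c.
Proof.
elim: k => [_|k IH kN]; first by rewrite !psum0 min0n mul0r addr0.
rewrite !(psumS _ (Ordinal kN)) /= IH ?(ltnW kN)// tnth_shift_tuple /=.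
have -> : (minn k.+1 m = minn k m + (k < m))%N by lia.
by rewrite natrD; case: (k < m)%N => /=; ring.
Qed.

Section cameron_martin.
Context d (T : measurableType d) (R : realType) (P : probability T R).
Variables (B : R -> T -> R) (alpha : R).
Hypothesis hB : standard_brownian_motion P B.
Hypothesis alpha0 : 0 <= alpha.
Variable th : R.

(* Bridge of the Cameron-Martin path [l |-> min l (1 / 2)]. *)
Definition tent (l : R) : R := Num.min l (1 / 2) - l / 2.

(** Cameron-Martin density of the drift [th] acting on [[0, 1 / 2]]; [th ^ 2 / 4] is half its
    energy. *)
Definition cm_weight (w : T) : R := expR (th * B (1 / 2) w - th ^+ 2 / 4).

Notation Qth := (bridge_int B alpha (fun l => th * tent l)).
Notation Q := (bridge_sq B alpha).
Notation Z := cm_weight.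

Lemma tent_continuous : continuous tent.
Proof.
move=> x; apply: cvgB; last by apply: cvgM => //; exact: cvg_cst.
apply: (@continuous_min R R id (cst (1 / 2)) x); [exact: cvg_id|exact: cvg_cst].
Qed.

Lemma within_tent_continuous : {within `[0, 1], continuous (fun l => th * tent l)}.
Proof.
apply: continuous_subspaceT => x; apply: cvgM; [exact: cvg_cst|exact: tent_continuous].
Qed.

Lemma measurable_cm_weight : measurable_fun setT Z.
Proof.
apply: measurableT_comp => //; apply: measurable_funB => //; apply: measurable_funM => //.
by apply: (bm_measurable hB); rewrite divr_ge0.
Qed.

(** With [2 j + 2] steps the time 1/2 is a grid point, and the first [j + 1] increments are exactly
    those before it. *)
Lemma bridge_quad_shift (j : nat) w : B 0 w = 0 ->
  bridge_quad (weight alpha (2 * j).+1)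
    (shift_tuple j.+1 (th * (2 * j).+2%:R^-1) (rvec (@incr _ _ _ B (2 * j).+1) w)) =
  bridge_sum B alpha (fun l => th * tent l) (2 * j).+1 w.
Proof.
move=> B0; rewrite /bridge_quad /bridge_sum; congr (_ * _); apply: eq_bigr => k _.
have kn : (k <= (2 * j).+2)%N by exact: ltnW.
have n0 : (0 : R) < (2 * j).+2%:R by rewrite ltr0n.
rewrite !psum_shift_tuple// (psum_incr _ _ kn) (psum_incr _ _ (leqnn _)) B0 !subr0.
rewrite (divff (lt0r_neq0 n0)) /bridge_integrand /weight; congr (_ * _ ^+ 2).
have -> : minn (2 * j).+2 j.+1 = j.+1 by lia.
have e2 : (2 * j).+2%:R = 2 * j.+1%:R :> R by rewrite -natrM; congr (_%:R); lia.
have -> : tent (k%:R / (2 * j).+2%:R) = ((minn k j.+1)%:R - k%:R / 2) / (2 * j).+2%:R.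
  rewrite /tent mulrBl; congr (_ - _); last by rewrite mulrAC.
  have -> : 1 / 2 = j.+1%:R / (2 * j).+2%:R :> R.
    have j0 : j.+1%:R != 0 :> R by rewrite pnatr_eq0.
    by rewrite e2; move: (j.+1%:R : R) j0 => y y0; field.
  have [kj|jk] := leqP k j.+1.
    by rewrite min_l// ler_pM2r ?invr_gt0// ler_nat.
  by rewrite min_r// ler_pM2r ?invr_gt0// ler_nat ltnW.
rewrite /grid e2; have j0 : j.+1%:R != 0 :> R by rewrite pnatr_eq0.
move: (j.+1%:R : R) j0 (k%:R : R) ((minn k j.+1)%:R : R) => y y0 x m.
by move: (B _ w) (B 1 w) => u v; field.
Qed.

(** The drift is constant before 1/2, so the discrete density depends on the walk only through its
    value there: the weight is almost surely the same for every [j], and only the functional varies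
    in the limit. *)
Lemma cameron_martin_discrete (j : nat) (g : R -> R) : measurable_fun setT g ->
  (forall x, 0 <= g x) ->
  (\int[P]_w (g (bridge_sum B alpha (fun l => th * tent l) (2 * j).+1 w))%:E =
   \int[P]_w (g (bridge_sum B alpha (cst 0) (2 * j).+1 w) * Z w)%:E)%E.
Proof.
move=> mg g0; pose n := (2 * j).+1.
have h0 : 0 < n.+1%:R^-1 :> R by rewrite invr_gt0 ltr0n.
have mE : measurable_fun setT (EFin \o g) by exact/measurable_EFinP.
have mq : measurable_fun setT (bridge_quad (n := n) (weight alpha n)).
  exact: measurable_bridge_quad.
have jn : (j.+1 <= n.+1)%N by rewrite /n; lia.
have mf : measurable_fun setT (fun t => (g (bridge_quad (n := n) (weight alpha n) t))%:E).
  exact: (measurableT_comp mE mq).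
have f0 t : (0 <= (g (bridge_quad (n := n) (weight alpha n) t))%:E)%E by rewrite lee_fin.
have S := gaussian_shift h0 (measurable_incr hB (n:=n)) (indep_incr hB (n:=n)) (law_incr hB (n:=n))
  (th * n.+1%:R^-1) jn mf f0.
have mr := measurable_rvec (measurable_incr hB (n:=n)).
rewrite (@ae_eq_integral _ _ _ P setT (fun w => (g (bridge_quad (n := n) (weight alpha n)
   (shift_tuple j.+1 (th * n.+1%:R^-1) (rvec (@incr _ _ _ B n) w))))%:E))//; last 3 first.
- exact: (measurableT_comp mE (measurable_bridge_sum alpha hB _ _)).
- exact: (measurableT_comp mf (measurableT_comp (measurable_shift_tuple _ _) mr)).
- by apply: filterS (bm_start hB) => w B0 _; rewrite bridge_quad_shift.
rewrite S; apply: ae_eq_integral => //.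
- apply: emeasurable_funM; first exact: (measurableT_comp mf mr).
  apply/measurable_EFinP; apply: measurableT_comp => //; apply: measurable_funB => //.
  by apply: measurable_funM => //; exact: (measurableT_comp (@measurable_psum _ _ _) mr).
- apply/measurable_EFinP; apply: measurable_funM; last exact: measurable_cm_weight.
  exact: (measurableT_comp mg (measurable_bridge_sum alpha hB _ _)).
apply: filterS (bm_start hB) => w B0 _.
have e2 : n.+1%:R = 2 * j.+1%:R :> R by rewrite -natrM; congr (_%:R); rewrite /n; lia.
have j0 : j.+1%:R != 0 :> R by rewrite pnatr_eq0.
rewrite -/n -EFinM bridge_quad_incr// (psum_incr _ _ jn) B0 subr0 /Z.
move: n e2 {h0 mq jn mf f0 S mr} => n e2.
rewrite e2; move: (j.+1%:R : R) j0 => y y0.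
have -> : th / (2 * y) / (2 * y)^-1 = th by field.
have -> : y / (2 * y) = 1 / 2 by field.
by have -> : y * ((th / (2 * y)) ^+ 2 / ((2 * y)^-1 *+ 2)) = th ^+ 2 / 4 by field.
Qed.

(** The discrete formula for the constant function 1 says that the weight has mean 1. *)
Lemma integrable_cm_weight : P.-integrable setT (EFin \o Z).
Proof.
apply/integrableP; split; first by apply/measurable_EFinP; exact: measurable_cm_weight.
rewrite [X in (X < _)%E](_ : _ = 1%E) ?ltry//.
have := @cameron_martin_discrete 0 (cst 1) (measurable_cst _) (fun=> ler01).
rewrite [X in X = _ -> _](_ : _ = \int[P]_w cst 1%E w)%E// integral_cst// mul1e.
rewrite [X in X = _ -> _](@probability_setT _ _ _ P) => ->.
by apply: eq_integral => w _ /=; rewrite mul1r ger0_norm ?expR_ge0.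
Qed.

Lemma cvg_bridge_sum_odd (e : R -> R) w : {within `[0, 1], continuous e} ->
  bridge_sum B alpha e (2 * j).+1 w @[j --> \oo] --> bridge_int B alpha e w.
Proof.
move=> ce; have h : (2 * j).+1 @[j --> \oo] --> \oo.
  apply/cvgnyPge => A; exists A => //= j /=; lia.
apply: (@cvg_comp _ _ _ (fun j => (2 * j).+1) (fun n => bridge_sum B alpha e n w) _ _ _ h).
exact: (bridge_sum_cvg hB alpha0).
Qed.

Lemma cameron_martin (g : R -> R) : continuous g -> (forall x, 0 <= g x <= 1) ->
  \int[P]_w g (Qth w) = \int[P]_w (g (Q w) * Z w).
Proof.
move=> cg g01; have mg : measurable_fun setT g by exact: continuous_measurable_fun.
have c0 : {within `[0, 1], continuous (cst 0 : R -> R)}.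
  by apply: continuous_subspaceT => x; exact: cvg_cst.
have mS e j : measurable_fun setT (fun w => g (bridge_sum B alpha e (2 * j).+1 w)).
  exact: (measurableT_comp mg (measurable_bridge_sum alpha hB _ _)).
have cS (e : R -> R) w : {within `[0, 1], continuous e} ->
    g (bridge_sum B alpha e (2 * j).+1 w) @[j --> \oo] --> g (bridge_int B alpha e w).
  by move=> ce; apply: continuous_cvg; [exact: cg|exact: cvg_bridge_sum_odd].
have ng x : `|g x| <= 1 by have /andP[a b] := g01 x; rewrite ger0_norm.
have c1 : \int[P]_w g (bridge_sum B alpha (fun l => th * tent l) (2 * j).+1 w) @[j --> \oo] -->
    \int[P]_w g (Qth w).
  apply: (@cvg_Rintegral_dominated _ _ _ P setT _ _ (fun=> 1)) => //.
  - by apply: aeW => w _; apply: cS; exact: within_tent_continuous.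
  - exact: (measurableT_comp mg (measurable_bridge_int hB alpha0 within_tent_continuous)).
  - exact: finite_measure_integrable_cst.
have c2 : \int[P]_w (g (bridge_sum B alpha (cst 0) (2 * j).+1 w) * Z w) @[j --> \oo] -->
    \int[P]_w (g (Q w) * Z w).
  apply: (@cvg_Rintegral_dominated _ _ _ P setT _ _ Z) => //.
  - by move=> j; apply: measurable_funM; [exact: mS|exact: measurable_cm_weight].
  - by apply: aeW => w _; apply: cvgM; [exact: cS|exact: cvg_cst].
  - apply: measurable_funM; last exact: measurable_cm_weight.
    exact: (measurableT_comp mg (measurable_bridge_sq hB alpha0)).
  - by move=> j w _; rewrite normrM [`|Z w|]ger0_norm ?expR_ge0// ler_piMl ?expR_ge0.
  - exact: integrable_cm_weight.
have E j : \int[P]_w g (bridge_sum B alpha (fun l => th * tent l) (2 * j).+1 w) =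
    \int[P]_w (g (bridge_sum B alpha (cst 0) (2 * j).+1 w) * Z w).
  rewrite /Rintegral; congr fine; apply: cameron_martin_discrete => // x.
  by have /andP[] := g01 x.
move: c1; under eq_fun do rewrite E.
by move=> c1; apply: (cvg_unique _ c1 c2).
Qed.

(** Continuous approximation from below; it vanishes from [x] on, so its limit is the indicator of
    the open ray. *)
Let ramp (x : R) (k : nat) (y : R) : R := Num.min 1 (Num.max 0 (k%:R * (x - y))).

Let ramp_continuous x k : continuous (ramp x k).
Proof.
move=> y; apply: (@continuous_min R R (cst 1) (fun y => Num.max 0 (k%:R * (x - y))) y).
  exact: cvg_cst.
apply: (@continuous_max R R (cst 0) (fun y => k%:R * (x - y)) y); first exact: cvg_cst.
by apply: cvgM; [exact: cvg_cst|apply: cvgB; [exact: cvg_cst|exact: cvg_id]].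
Qed.

Let ramp01 x k y : 0 <= ramp x k y <= 1.
Proof. by rewrite /ramp le_min ler01 le_max lexx /= ge_min lexx. Qed.

Let ramp_cvg x y : ramp x k y @[k --> \oo] --> (\1_(`]-oo, x[%classic : set R) y : R).
Proof.
apply: cvg_near_cst; have [yx|xy] := ltP y x.
  have : \forall k \near \oo, (x - y)^-1 <= k%:R by exact: nbhs_infty_ger.
  apply: filterS => k hk; rewrite indicE mem_set ?in_itv//= /ramp.
  have h1 : 1 <= k%:R * (x - y) by rewrite -ler_pdivrMr ?subr_gt0// div1r.
  by rewrite max_r ?min_l// (le_trans ler01).
apply: nearW => k; rewrite indicE memNset/=; last by rewrite in_itv /= ltNge xy.
by rewrite /ramp max_l ?min_r// mulr_ge0_le0// subr_le0.
Qed.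

Lemma cameron_martin_ray (x : R) :
  \int[P]_w \1_(`]-oo, x[%classic : set R) (Qth w) =
  \int[P]_w (\1_(`]-oo, x[%classic : set R) (Q w) * Z w).
Proof.
have mI : measurable_fun setT (\1_(`]-oo, x[%classic : set R) : R -> R).
  by apply: measurable_indic; exact: measurable_itv.
have mQ := measurable_bridge_sq hB alpha0.
have mQth := measurable_bridge_int hB alpha0 within_tent_continuous.
have mr k : measurable_fun setT (ramp x k).
  by apply: continuous_measurable_fun; exact: ramp_continuous.
have c1 : \int[P]_w ramp x k (Qth w) @[k --> \oo] -->
    \int[P]_w \1_(`]-oo, x[%classic : set R) (Qth w).
  apply: (@cvg_Rintegral_dominated _ _ _ P setT _ _ (fun=> 1)) => //.
  - by move=> k; exact: (measurableT_comp (mr k) mQth).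
  - by apply: aeW => w _; exact: ramp_cvg.
  - exact: (measurableT_comp mI mQth).
  - by move=> k w _; have /andP[a b] := ramp01 x k (Qth w); rewrite ger0_norm.
  - exact: finite_measure_integrable_cst.
have c2 : \int[P]_w (ramp x k (Q w) * Z w) @[k --> \oo] -->
    \int[P]_w (\1_(`]-oo, x[%classic : set R) (Q w) * Z w).
  apply: (@cvg_Rintegral_dominated _ _ _ P setT _ _ Z) => //.
  - move=> k; apply: measurable_funM; last exact: measurable_cm_weight.
    exact: (measurableT_comp (mr k) mQ).
  - by apply: aeW => w _; apply: cvgM; [exact: ramp_cvg|exact: cvg_cst].
  - apply: measurable_funM; last exact: measurable_cm_weight.
    exact: (measurableT_comp mI mQ).
  - move=> k w _; have /andP[a b] := ramp01 x k (Q w).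
    by rewrite normrM [`|Z w|]ger0_norm ?expR_ge0// ler_piMl ?expR_ge0// ger0_norm.
  - exact: integrable_cm_weight.
have E k : \int[P]_w ramp x k (Qth w) = \int[P]_w (ramp x k (Q w) * Z w).
  by apply: cameron_martin; [exact: ramp_continuous|exact: ramp01].
move: c1; under eq_fun do rewrite E.
by move=> c1; apply: (cvg_unique _ c1 c2).
Qed.

End cameron_martin.

(** * Null sets and the Lebesgue density *)

Section density.
Context d (T : measurableType d) (R : realType) (P : probability T R).
Variables (B : R -> T -> R) (alpha : R).
Hypothesis hB : standard_brownian_motion P B.
Hypothesis alpha0 : 0 <= alpha.
Notation mu := (@lebesgue_measure R).
Notation Q := (bridge_sq B alpha).
Notation Qth th := (bridge_int B alpha (fun l => th * tent l)).

Definition tent_energy : R := \int[mu]_(l in `[0, 1]) (l `^ alpha * tent l ^+ 2).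

Definition bridge_tent (w : T) : R :=
  \int[mu]_(l in `[0, 1]) (l `^ alpha * (B l w - l * B 1 w) * tent l).

Let integrable01 (f : R -> R) : {within `[0, 1], continuous f} ->
  mu.-integrable `[0, 1] (EFin \o f).
Proof. by move=> cf; apply: continuous_compact_integrable => //; exact: segment_compact. Qed.

Let cpow : {within `[0, 1], continuous (fun l : R => l `^ alpha)}.
Proof. exact: within_powR_continuous. Qed.

Let cM (f g : R -> R) : {within `[0, 1], continuous f} -> {within `[0, 1], continuous g} ->
  {within `[0, 1], continuous (fun l => f l * g l)}.
Proof.
move=> /subspace_continuousP cf /subspace_continuousP cg; apply/subspace_continuousP => x x01.
by apply: cvgM; [exact: cf|exact: cg].
Qed.

Let ctent : {within `[0, 1], continuous (@tent R)}.
Proof. by apply: continuous_subspaceT => x; exact: tent_continuous. Qed.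

Let cenergy : {within `[0, 1], continuous (fun l => l `^ alpha * tent l ^+ 2)}.
Proof. exact: (cM cpow (cM ctent ctent)). Qed.

Let cbt w : {within `[0, 1], continuous (fun l => l `^ alpha * (B l w - l * B 1 w) * tent l)}.
Proof.
apply: (cM (cM cpow _) ctent); exact: (within_bridge_continuous hB).
Qed.

Let c0 : {within `[0, 1], continuous (cst 0 : R -> R)}.
Proof. by apply: continuous_subspaceT => x; exact: cvg_cst. Qed.

Lemma bridge_int_tent th w : Qth th w = Q w + 2 * bridge_tent w * th + tent_energy * th ^+ 2.
Proof.
have i1 := integrable01 (bridge_integrand_continuous (w := w) hB alpha0 c0).
have i2 : mu.-integrable `[0, 1] (EFin \o
    (fun l => 2 * th * (l `^ alpha * (B l w - l * B 1 w) * tent l))).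
  by apply: RintegrableZl => //; exact: integrable01.
have i3 : mu.-integrable `[0, 1] (EFin \o (fun l => th ^+ 2 * (l `^ alpha * tent l ^+ 2))).
  by apply: RintegrableZl => //; exact: integrable01.
have -> : Q w + 2 * bridge_tent w * th + tent_energy * th ^+ 2 =
  Q w + (2 * th) * bridge_tent w + th ^+ 2 * tent_energy by ring.
rewrite /bridge_tent /tent_energy -!RintegralZl//; try exact: integrable01.
rewrite -RintegralD// -RintegralD//; last exact: (integrableD _ i1 i2).
apply: eq_Rintegral => l _; rewrite /bridge_integrand /=; ring.
Qed.

(** On [[1 / 4, 1 / 2]] the tent is [l / 2 >= 1 / 8]. Positivity makes the shifted functional a
    genuine quadratic in [th] for every outcome. *)
Lemma tent_energy_gt0 : 0 < tent_energy.
Proof.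
pose c : R := (1 / 4) `^ alpha * (1 / 8) ^+ 2.
have c0' : 0 < c by rewrite mulr_gt0 ?powR_gt0 ?exprn_gt0.
have sub : (`[1 / 4, 1 / 2]%classic : set R) `<=` `[0, 1]%classic.
  by move=> x /=; rewrite !in_itv /= => /andP[h1 h2]; apply/andP; split; lra.
have h : ((c * (1 / 4))%:E <= \int[mu]_(l in `[0%R, 1%R]) (l `^ alpha * tent l ^+ 2)%:E)%E.
  apply: (@le_trans _ _ (\int[mu]_(l in (`[(1 / 4)%R, (1 / 2)%R]%classic : set R)) (l `^ alpha * tent l ^+ 2)%:E)%E); last first.
    apply: ge0_subset_integral => //.
    - exact: measurable_int (integrable01 cenergy).
    - by move=> l _; rewrite lee_fin mulr_ge0 ?powR_ge0 ?sqr_ge0.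
  apply: (@le_trans _ _ (\int[mu]_(l in (`[(1 / 4)%R, (1 / 2)%R]%classic : set R)) cst c%:E l)%E).
    rewrite integral_cst//= lebesgue_measure_itv /= lte_fin ifT; last by lra.
    by rewrite -EFinB -EFinM lee_fin ler_pM2l//; lra.
  apply: ge0_le_integral => //.
  - by move=> l _; rewrite lee_fin ltW.
  - apply: measurable_funS (measurable_int _ (integrable01 cenergy)) => //.
  move=> l; rewrite /= in_itv /= => /andP[l1 l2]; rewrite lee_fin /c /tent.
  have l0 : 0 <= l by lra.
  rewrite min_l//; apply: ler_pM; rewrite ?powR_ge0 ?sqr_ge0//.
    by apply: ge0_ler_powR => //; rewrite nnegrE; lra.
  by rewrite ler_pXn2r// ?nnegrE; lra.
rewrite /tent_energy /Rintegral.
have fin : (\int[mu]_(l in `[0%R, 1%R]) (l `^ alpha * tent l ^+ 2)%:E)%E \is a fin_num.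
  by apply: integrable_fin_num => //; exact: integrable01.
rewrite -lte_fin fineK//; apply: lt_le_trans h; rewrite lte_fin mulr_gt0//; lra.
Qed.

(** Solved from the quadratic expansion at [th = 1], whose other terms are already known to be
    measurable. *)
Lemma measurable_bridge_tent : measurable_fun setT bridge_tent.
Proof.
have m1 := measurable_bridge_int hB alpha0 (@within_tent_continuous _ 1).
have m0 := measurable_bridge_sq hB alpha0.
rewrite (_ : bridge_tent = fun w => 2^-1 * (Qth 1 w - Q w - tent_energy)).
  by apply: measurable_funM => //; apply: measurable_funB => //; exact: measurable_funB.
by apply/funext => w; rewrite bridge_int_tent; field.
Qed.

Section change_of_measure.
Variable th : R.
Notation Z := (cm_weight B th).

(** The reweighted measure is made an instance so that the identity on rays extends to Borel sets by
    uniqueness of finite measures. *)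
Let W (S : set T) : \bar R := (\int[P]_(w in S) (Z w)%:E)%E.

Let iZ : P.-integrable setT (EFin \o Z).
Proof. exact: (integrable_cm_weight hB alpha0). Qed.

Let W0 : W set0 = 0%E. Proof. by rewrite /W integral_set0. Qed.

Let W_ge0 S : (0 <= W S)%E.
Proof. by apply: integral_ge0 => w _; rewrite lee_fin expR_ge0. Qed.

Let W_sigma_additive : semi_sigma_additive W.
Proof.
move=> /= A mA tA mUA; rewrite /W integral_bigcup//=; last first.
  exact: (integrableS _ _ (@subsetT _ _)).
apply: is_cvg_ereal_nneg_natsum_cond => n _ _.
by apply: integral_ge0 => w _; rewrite lee_fin expR_ge0.
Qed.

HB.instance Definition _ := isMeasure.Build _ _ _ W W0 W_ge0 W_sigma_additive.

Lemma cameron_martin_set (A : set R) : measurable A ->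
  P (Qth th @^-1` A) = (\int[P]_(w in Q @^-1` A) (Z w)%:E)%E.
Proof.
move=> mA.
have mQ := measurable_bridge_sq hB alpha0.
have mQth := measurable_bridge_int hB alpha0 (@within_tent_continuous _ th).
pose M := isMeasurableFun.Build _ _ T (measurableTypeR R) (Qth th) mQth.
pose F : {mfun T >-> measurableTypeR R} := HB.pack (Qth th) M.
pose M' := isMeasurableFun.Build _ _ T (measurableTypeR R) Q mQ.
pose G : {mfun T >-> measurableTypeR R} := HB.pack Q M'.
apply: (@finite_measure_eq_rays R (pushforward P F) (pushforward W G)) => //.
  rewrite -[X in (X < _)%E]/(P (F @^-1` _)) preimage_setT; apply: le_lt_trans (ltry 1).
  exact: probability_le1.
move=> x; rewrite -[LHS]/(P (Qth th @^-1` _)) -[RHS]/(W (Q @^-1` _)).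
set I := (`]-oo, x[%classic : set R).
have mI : measurable I by exact: measurable_itv.
have mpre (q : T -> R) : measurable_fun setT q -> measurable (q @^-1` I).
  by move=> mq; rewrite -[X in measurable X]setTI; exact: (mq measurableT _ mI).
have e1 : P (Qth th @^-1` I) = (\int[P]_w (\1_I (Qth th w))%:E)%E.
  by rewrite -[RHS](_ : (\int[P]_w (\1_(Qth th @^-1` I) w)%:E)%E = _)// integral_indic ?setIT//; exact: mpre.
have e2 : W (Q @^-1` I) = (\int[P]_w (\1_I (Q w) * Z w)%:E)%E.
  rewrite /W integral_mkcond; apply: eq_integral => w _; rewrite patchE.
  case: ifPn => h; first by rewrite indicE mem_set ?mul1r//; move: h; rewrite inE.
  by rewrite indicE memNset ?mul0r//; move: h; rewrite notin_setE.
have := cameron_martin_ray hB alpha0 th x; rewrite /Rintegral -/I e1 e2 => h.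
rewrite -[LHS]fineK ?h ?fineK//.
- have h2 : P.-integrable setT (EFin \o (fun w => \1_I (Q w) * Z w)).
    apply: (@integrable_dominated _ _ _ _ _ _ Z) => //.
      apply: measurable_funM; last exact: measurable_cm_weight hB th.
      exact: (measurableT_comp (measurable_indic mI) mQ).
    move=> w _; rewrite normrM [`|Z w|]ger0_norm ?expR_ge0// ler_piMl ?expR_ge0//.
    by rewrite indicE; case: (_ \in _); rewrite ?normr1 ?normr0.
  exact: integrable_fin_num.
- by rewrite -e1 fin_num_measure//; exact: mpre.
Qed.

End change_of_measure.

Lemma bridge_sq_null (A : set R) : measurable A -> mu A = 0%E -> P (Q @^-1` A) = 0%E.
Proof.
move=> mA A0.
have mQ := measurable_bridge_sq hB alpha0.
pose q (z : T * measurableTypeR R) : R :=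
  Q z.1 + 2 * bridge_tent z.1 * z.2 + tent_energy * z.2 ^+ 2.
have mq : measurable_fun setT q.
  apply: measurable_funD.
    apply: measurable_funD; first exact: (measurableT_comp mQ).
    apply: measurable_funM; last exact: measurable_snd.
    by apply: measurable_funM => //; exact: (measurableT_comp measurable_bridge_tent).
  by apply: measurable_funM => //; apply: measurable_funX; exact: measurable_snd.
pose f z := (\1_A (q z) : R)%:E.
have mf : measurable_fun setT f.
  apply/measurable_EFinP; exact: (measurableT_comp (measurable_indic mA) mq).
have f0 z : (0 <= f z)%E by rewrite lee_fin.
have qA w : measurable_fun setT (fun y : R => Q w + 2 * bridge_tent w * y + tent_energy * y ^+ 2).
  apply: measurable_funD; first by apply: measurable_funD => //; exact: measurable_funM.
  by apply: measurable_funM => //; exact: measurable_funX.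
have := fubini_tonelli (m1 := P) (m2 := mu) f mf f0.
under eq_integral => w _.
  rewrite (_ : (\int[mu]_y f (w, y))%E = 0%E); last first.
    rewrite /f /q /= -[LHS](_ : (\int[mu]_y (\1_((fun y => Q w + 2 * bridge_tent w * y + tent_energy * y ^+ 2) @^-1` A) y : R)%:E)%E = _)//.
    rewrite integral_indic//; last first.
      by rewrite -[X in measurable X]setTI; exact: (qA w measurableT _ mA).
    rewrite setIT; apply: null_preimage_quadratic => //; by rewrite gt_eqF// tent_energy_gt0.
  over.
rewrite integral0 => /esym.
pose g := fubini_G P f.
have g0 y : (0 <= g y)%E by exact: integral_ge0.
rewrite (eq_integral (fun y => `|g y|%E)); last by move=> y _; rewrite gee0_abs.
have mg := measurable_fun_fubini_tonelli_G (m1 := P) f mf f0.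
move=> /(ae_eq_integral_abs mu measurableT mg) [N [mN N0 gN]].
(* For almost every shift [th], the shifted functional avoids the null set [A]. *)
have [th gth] : exists th, g th = 0%E.
  apply: contrapT => /forallNP gne.
  have sN : (`[0%R, 1%R]%classic : set R) `<=` N by move=> y _; apply: gN => /= h; apply: (gne y); exact: h.
  have : (mu (`[0%R, 1%R]%classic : set R) <= mu N)%E by apply: le_measure => //; rewrite inE.
  by rewrite N0 lebesgue_measure_itv /= lte_fin ltr01 sube0 lee_fin ler10.
have mQA : measurable (Q @^-1` A) by rewrite -[X in measurable X]setTI; exact: (mQ measurableT _ mA).
have : (\int[P]_(w in Q @^-1` A) `|(cm_weight B th w)%:E| = 0)%E.
  under eq_integral do rewrite gee0_abs ?lee_fin ?expR_ge0//.
  rewrite -cameron_martin_set// -gth /g.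
  rewrite -[RHS](_ : (\int[P]_w (\1_(Qth th @^-1` A) w : R)%:E)%E = _)//.
    rewrite integral_indic ?setIT//.
    have mQth := measurable_bridge_int hB alpha0 (@within_tent_continuous _ th).
    by rewrite -[X in measurable X]setTI; exact: (mQth measurableT _ mA).
  apply: eq_integral => w _; rewrite /f /q /= -bridge_int_tent//.
have mZ : measurable_fun (Q @^-1` A) (EFin \o cm_weight B th).
  by apply: measurable_funTS; apply/measurable_EFinP; exact: (measurable_cm_weight hB).
(* The weight is strictly positive, so a vanishing integral over the event makes the event itself
   null. *)
move=> /(ae_eq_integral_abs P mQA mZ) [N' [mN' N'0 hN']].
apply/eqP; rewrite eq_le measure_ge0 andbT -N'0; apply: le_measure; rewrite ?inE//.
by move=> w Aw; apply: hN' => /= /(_ Aw) [] /eqP; rewrite gt_eqF// expR_gt0.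
Qed.

(** Absolute continuity is passed from the square to its root, and Radon-Nikodym provides the
    density. *)
Lemma bridge_norm_density : has_lebesgue_density P (bridge_norm alpha B).
Proof.
have mV := measurable_bridge_norm hB alpha0.
pose M := isMeasurableFun.Build _ _ T (measurableTypeR R) (bridge_norm alpha B) mV.
pose F : {mfun T >-> measurableTypeR R} := HB.pack (bridge_norm alpha B) M.
pose nu : probability (measurableTypeR R) R := distribution P F.
have dom : nu `<< mu.
  apply/null_content_dominatesP => A mA A0.
  rewrite -[LHS]/(P (bridge_norm alpha B @^-1` A)).
  pose A' : set R := Num.sqrt @^-1` A.
  have ms : measurable_fun setT (Num.sqrt : R -> R).
    by apply: continuous_measurable_fun; exact: sqrt_continuous.
  have mA' : measurable A' by rewrite -[X in measurable X]setTI; exact: (ms measurableT _ mA).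
  (* Here the square root expands distances by at least [1 / (2 * n.+1)]. Negative numbers must be
     left out, since their root is 0 by convention and their preimage need not be null. *)
  pose D (n : nat) : set R := `[0, n.+1%:R ^+ 2]%classic.
  have mD n : measurable (D n) by exact: measurable_itv.
  have D0 n : mu (D n `&` A') = 0%E.
    have n0 : (0 : R) < 2 * n.+1%:R by rewrite mulr_gt0.
    apply: (@null_preimage_expansive _ _ _ _ (2 * n.+1%:R)^-1) => //.
    move=> x y; rewrite /D /= !in_itv /= => /andP[x0 xn] /andP[y0 yn].
    rewrite mulrC ler_pdivrMr//.
    have sn (z : R) : 0 <= z -> z <= n.+1%:R ^+ 2 -> Num.sqrt z <= n.+1%:R.
      move=> z0 zn; have : Num.sqrt z <= Num.sqrt (n.+1%:R ^+ 2) by rewrite ler_wsqrtr.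
      by rewrite sqrtr_sqr ger0_norm.
    have -> : x - y = (Num.sqrt x - Num.sqrt y) * (Num.sqrt x + Num.sqrt y).
      by rewrite -subr_sqr !sqr_sqrtr.
    rewrite normrM ler_wpM2l// ger0_norm ?addr_ge0 ?sqrtr_ge0//.
    by have := sn _ x0 xn; have := sn _ y0 yn; lra.
  pose E n := D n `&` A'.
  have mE n : measurable (E n) by exact: measurableI.
  have cover : bridge_norm alpha B @^-1` A `<=` \bigcup_n (Q @^-1` E n).
    move=> w Aw; exists (Num.truncn (Num.sqrt (Q w))) => //.
    have Q0 : 0 <= Q w by exact: bridge_sq_ge0.
    split; last by rewrite /A' /= -bridge_normE.
    rewrite /D /= in_itv /= Q0 /= -{1}(sqr_sqrtr Q0) ler_pXn2r ?nnegrE ?sqrtr_ge0// ltW//.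
    by have /andP[] := truncn_itv (sqrtr_ge0 (Q w)).
  have negE n : P.-negligible (Q @^-1` E n).
    apply/negligibleP; last exact: bridge_sq_null (mE n) (D0 n).
    have mQ := measurable_bridge_sq hB alpha0; rewrite -[X in measurable X]setTI.
    exact: (mQ measurableT _ (mE n)).
  apply/negligibleP; first by rewrite -[X in measurable X]setTI; exact: (mV measurableT _ mA).
  exact: (negligibleS cover (negligible_bigcup negE)).
pose f := Radon_Nikodym_SigmaFinite.f nu mu.
have f0 x : (0 <= f x)%E by exact: Radon_Nikodym_SigmaFinite.f_ge0.
have ffin x : f x \is a fin_num by exact: Radon_Nikodym_SigmaFinite.f_fin_num.
exists (fine \o f); split => [|x|A mA].
- apply: measurableT_comp => //.
  exact: measurable_int (Radon_Nikodym_SigmaFinite.f_integrable dom).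
- by rewrite /= fine_ge0.
rewrite -[LHS]/(nu A) (Radon_Nikodym_SigmaFinite.f_integral dom mA).
by apply: eq_integral => x _; rewrite /= fineK.
Qed.

End density.

(** * The characteristic function and the conclusion *)

Section characteristic_function.
Context d (T : measurableType d) (R : realType) (P : probability T R).

Lemma charfun_continuous (X : T -> R) : measurable_fun setT X ->
  continuous (fun t => complex.Re (charfun P X t)) /\
  continuous (fun t => complex.Im (charfun P X t)).
Proof.
move=> mX; suff key (f : R -> R) : continuous f -> (forall x, `|f x| <= 1) ->
    continuous (fun t : R => \int[P]_w f (t * X w)).
  by split; apply: key;
    [exact: continuous_cos|exact: cos_max|exact: continuous_sin|exact: sin_max].
move=> cf f1 t; apply/(@cvg_nbhsP _ R^o) => u ut.
have mf : measurable_fun setT f by exact: continuous_measurable_fun.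
have mfX c : measurable_fun setT (fun w => f (c * X w)).
  by apply: (measurableT_comp mf); exact: measurable_funM.
apply: (@cvg_Rintegral_dominated _ _ _ P setT (fun n w => f (u n * X w)) _ (fun=> 1)) => //.
- apply: aeW => w _; apply: continuous_cvg; first exact: cf.
  by apply: cvgM => //; exact: cvg_cst.
- exact: finite_measure_integrable_cst.
Qed.

End characteristic_function.

Section bridge_charfun.
Context d (T : measurableType d) (R : realType) (P : probability T R).
Variables (B : R -> T -> R) (alpha : R).
Hypothesis hB : standard_brownian_motion P B.
Hypothesis alpha0 : 0 <= alpha.
Notation V := (bridge_norm alpha B).

(** The transform at [s = - i t], on the boundary of the half-plane where it was computed. *)
Lemma charfun_bridge_norm t : charfun P (fun w => V w ^+ 2) t =
  cint P (fun w => cexp (- (0 +i* (- t)) * (bridge_int B alpha (cst 0) w)%:C)).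
Proof.
have e w : cexp (- (0 +i* (- t)) * (bridge_int B alpha (cst 0) w)%:C) =
    cos (t * V w ^+ 2) +i* sin (t * V w ^+ 2).
  have -> : - (0 +i* (- t)) * (bridge_int B alpha (cst 0) w)%:C =
      0 +i* (t * bridge_int B alpha (cst 0) w).
    by apply: complex_ext; rewrite ?RecM ?ImcM ?RecN ?ImcN /=; ring.
  by rewrite bridge_norm_sqr /cexp /= expR0 !mul1r.
by rewrite (eq_cint P e).
Qed.

(** The transform identity gives the square at each nonzero [t]; continuity and the value at 0 hold
    for any characteristic function and select the branch. *)
Lemma inv_sqrt_branch_charfun : inv_sqrt_branch
  (fun t : R =>
     let z : R[i] := (1 +i* 1) * csqrt t / (alpha + 2)%:C in
     (Gamma ((alpha + 3) / (alpha + 2)))%:C *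
     besselJ (alpha + 2)^-1 (2 * z) * cpowR z (- (alpha + 2)^-1))
  (charfun P (fun w => V w ^+ 2)).
Proof.
have mV2 : measurable_fun setT (fun w => V w ^+ 2).
  by apply: measurable_funX; exact: measurable_bridge_norm hB alpha0.
have [cR cI] := charfun_continuous P mV2; split => //.
  rewrite /charfun; under eq_Rintegral do rewrite mul0r cos0.
  under [X in _ +i* X]eq_Rintegral do rewrite mul0r sin0.
  rewrite !Rintegral_cst// mul0r [X in fine X](@probability_setT _ _ _ P) mulr1.
  by [].
move=> t t0; have s0 : 0 <= complex.Re (0 +i* (- t)) by [].
have [E0 [RE IE]] := bridge_transform hB alpha0 s0.
rewrite charfun_bridge_norm; exact: (bessel_transform alpha0 t0 E0 RE IE).
Qed.

End bridge_charfun.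

Theorem lemmaA1 (R : realType) (d : measure_display) (T : measurableType d)
    (P : probability T R) (B : R -> T -> R) (alpha : R)
    (hB : standard_brownian_motion P B) (halpha : 0 <= alpha) :
  let V := bridge_norm alpha B in
  [/\ measurable_fun [set: T] V,
      [/\ inv_sqrt_branch
            (fun t : R =>
               let z : R[i] := (1 +i* 1) * csqrt t / (alpha + 2)%:C in
               (Gamma ((alpha + 3) / (alpha + 2)))%:C *
               besselJ (alpha + 2)^-1 (2 * z) * cpowR z (- (alpha + 2)^-1))
            (charfun P (fun w => V w ^+ 2)),
          has_lebesgue_density P V &
          P [set w | 0 < V w] = 1%E],
      subexponential P (fun w => (V w)^-1) /\
      subexponential P (fun w => B 1 w / V w) &
      forall (d' : nat -> measure_display)
        (T' : forall p, measurableType (d' p))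
        (P' : forall p, probability (T' p) R)
        (X : forall p, 'I_p -> {RV (P' p) >-> R}),
        (forall p (l : 'I_p) (A : set R), measurable A ->
           P' p (X p l @^-1` A) = P (V @^-1` A)) ->
        bigO_P P' (fun p w => sup [set X p l w | l in [set: 'I_p]])
          (fun p => Num.sqrt (ln p%:R))].
Proof.
move=> V; split.
- exact: measurable_bridge_norm hB halpha.
- split; first exact: inv_sqrt_branch_charfun.
    exact: bridge_norm_density.
  exact: bridge_norm_gt0.
- split; first exact: subexponential_inv_bridge_norm.
  exact: subexponential_studentized.
- move=> d' T' P' X lawX; exact: (bridge_norm_max_bigO hB halpha lawX).
Qed.
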